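(* Let $\mathbb{K}=\mathbb{R}$ or $\mathbb{C}$, $1\le m\le r$, $\theta_1\ge\cdots\ge\theta_m>0>\theta_{m+1}\ge\cdots\ge\theta_r$, $\Theta=\operatorname{diag}(\theta_i)$. Let $G=(g_1,\ldots,g_r)$ be a random vector in $\mathbb{K}^r$, $(G(k))_{k\ge1}$ i.i.d. copies, $G_i^n=(g_i(1),\ldots,g_i(n))^T$, and $X_n$ deterministic real diagonal with eigenvalues $\lambda_1^n\ge\cdots\ge\lambda_n^n$. Let $\widetilde{X_n}$ be given either by the i.i.d. perturbation model $X_n+\frac1n\sum_i\theta_iG_i^n(G_i^n)^*$ or by the orthonormalized perturbation model $X_n+\sum_i\theta_iU_i^n(U_i^n)^*$ ($(U_i^n)$ the Gram–Schmidt orthonormalization of $(G_i^n)$), with eigenvalues $\widetilde\lambda_1^n\ge\cdots\ge\widetilde\lambda_n^n$. Assume (A) $\frac1n\sum_i\delta_{\lambda_i^n}\to\mu$ weakly, $\mu$ compactly supported with support bounds $a\le b$; (B) $\mathbb{E}e^{\alpha\sum_i|g_i|^2}<\infty$ for some $\alpha>0$ and, in the orthonormalized model, $\mathbb{P}(\sum_i\lambda_ig_i=0)=0$ for all $\lambda\ne0$; (C) $\lambda_1^n\to b$, $\lambda_n^n\to a$. Define on $(b,\infty)$ $$H(z)=P_{\Theta,r}(K^*(z),C^* ),\quad (C^* )_{ij}=\mathbb{E}[\overline{g_i}g_j],\quad (K^*(z))_{ij}=(C^* )_{ij}\int\frac{d\mu(\lambda)}{z-\lambda}.$$ Then there exists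 $k\in\{0,\ldots,m\}$ such that $H$ has $m-k$ zeroes $\lambda_1^*\ge\cdots\ge\lambda_{m-k}^*$ in $(b,\infty)$ (counted with multiplicity). The unique point of $\mathbb{R}^m$ at which the good rate function $L$ of the large deviation principle (in the scale $n$) for the law of $(\widetilde\lambda_1^n,\ldots,\widetilde\lambda_m^n)$ vanishes is $(\lambda_1^*,\ldots,\lambda_{m-k}^*,b,\ldots,b)$, and consequently $(\widetilde\lambda_1^n,\ldots,\widetilde\lambda_m^n)$ converges almost surely to this point.
   Context: $\mathsf H_r$: $r\times r$ Hermitian (real symmetric if $\mathbb{K}=\mathbb{R}$) matrices. The polynomial $P_{\Theta,r}:\mathsf H_r\times\mathsf H_r\to\mathbb{R}$ depends on the model: in the i.i.d. model, $P_{\Theta,r}(K,C)=\det(\Theta^{-1}-K)$. In the orthonormalized model: for $C\in\mathsf H_r$ put $q_1(C)=1$, $q_i(C)=\det[C_{kl}]_{k,l=1}^{i-1}$ for $2\le i\le r$; for $1\le j<i\le r$ let $\gamma^{j,i}(C)$ be the $(i-1)\times(i-1)$ matrix with $\gamma_{kl}=C_{kl}$ for $l\ne j$ and $\gamma_{kj}=-C_{ki}$; let $F=F(C)$ be upper triangular with $F_{ii}=q_i(C)$, $F_{ji}=\det\gamma^{j,i}(C)$ for $j<i$; then $P_{\Theta,r}(K,C)=\det\big(\operatorname{diag}(\theta_1^{-1}(F^*CF)_{11},\ldots,\theta_r^{-1}(F^*CF)_{rr})-F^*KF\big)$. With $K^n(z)_{ij}=\frac1n\sum_k\frac{\overline{g_i(k)}g_j(k)}{z-\lambda_k^n}$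 and $C^n_{ij}=\frac1n\sum_k\overline{g_i(k)}g_j(k)$, a point $z\notin\{\lambda_i^n\}$ is an eigenvalue of $\widetilde{X_n}$ iff $P_{\Theta,r}(K^n(z),C^n)=0$. Under (A),(B),(C), the law of $(\widetilde\lambda_1^n,\ldots,\widetilde\lambda_m^n)$ satisfies a large deviation principle in the scale $n$ with a (necessarily unique) good rate function $L$. *)

(* Defs.v *)
From HB Require Import structures.
From mathcomp Require Import all_boot all_order all_algebra.
From mathcomp Require Import all_classical all_reals all_analysis.
From mathcomp Require Import complex.

Set Implicit Arguments.
Unset Strict Implicit.
Unset Printing Implicit Defensive.

Import Order.TTheory GRing.Theory Num.Theory.
Import numFieldNormedType.Exports.
Local Open Scope classical_set_scope.
Local Open Scope ring_scope.
Local Open Scope complex_scope.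

Section Defs.
Variable R : realType.
Local Notation C := R[i].

Definition ctr m n (A : 'M[C]_(m, n)) : 'M[C]_(n, m) := (map_mx conjc A)^T.

(* Ordered (nonincreasing) real eigenvalues of a square complex matrix whose
   characteristic polynomial splits with real roots (e.g. a Hermitian
   matrix), listed with multiplicity; [::] if no such list exists. *)
Definition eig_spec n (A : 'M[C]_n) (s : seq R) : Prop :=
  sorted >=%R s /\ char_poly A = \prod_(x <- s) ('X - (x%:C)%:P).
Definition eigs n (A : 'M[C]_n) : seq R := xget [::] (eig_spec A).
(* j-th largest eigenvalue, 0-based: eig A 0 = lambda_1(A) *)
Definition eig n (A : 'M[C]_n) (j : nat) : R := nth 0 (eigs A) j.

Definition mxf p (f : nat -> nat -> C) : 'M[C]_p := \matrix_(i < p, j < p) f i j.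
Definition ent r (A : 'M[C]_r) (k l : nat) : C :=
  match insub k, insub l with
  | Some k', Some l' => A k' l'
  | _, _ => 0
  end.

Inductive model := IIDmodel | Orthmodel.

(* q_i(C) (1-based i) = det of leading (i-1)x(i-1) block; here 0-based i *)
Definition qcoef r (Cm : 'M[C]_r) (i : nat) : C := \det (mxf i (ent Cm)).
(* gamma^{j,i}(C), 0-based j < i, size i x i *)
Definition gammamx r (Cm : 'M[C]_r) (j i : nat) : 'M[C]_i :=
  mxf i (fun k l => if l == j then - ent Cm k i else ent Cm k l).
Definition Fmx r (Cm : 'M[C]_r) : 'M[C]_r :=
  \matrix_(j < r, i < r)
    (if j == i then qcoef Cm i
     else if (j < i)%N then \det (gammamx Cm j i) else 0).

Definition Ppoly (M : model) r (theta : 'I_r -> R) (K Cm : 'M[C]_r) : C :=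
  match M with
  | IIDmodel =>
      \det (diag_mx (\row_i ((theta i)^-1)%:C) - K)
  | Orthmodel =>
      let F := Fmx Cm in
      let FCF := ctr F *m Cm *m F in
      \det (diag_mx (\row_i (((theta i)^-1)%:C * FCF i i)) - ctr F *m K *m F)
  end.

Context {d : measure_display} {Omega : measurableType d}.

Definition sigma_vec r (g : 'I_r -> Omega -> C) : set (set Omega) :=
  smallest (sigma_algebra setT)
    [set A | exists i (B : set R), measurable B /\
       (A = (fun w => complex.Re (g i w)) @^-1` B \/
        A = (fun w => complex.Im (g i w)) @^-1` B)].

Definition iid_vecs (P : probability Omega R) r (g : nat -> 'I_r -> Omega -> C) : Prop :=
  (forall k i, measurable_fun setT (fun w => complex.Re (g k i w)) /\
               measurable_fun setT (fun w => complex.Im (g k i w))) /\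
  (forall (S : seq nat) (A : nat -> set Omega), uniq S ->
     (forall k, k \in S -> sigma_vec (g k) (A k)) ->
     P (\bigcap_(k in [set k | k \in S]) A k) = \big[*%E/1%E]_(k <- S) P (A k)) /\
  (forall k (t s : 'I_r -> R),
     P [set w | forall i, complex.Re (g k i w) <= t i /\ complex.Im (g k i w) <= s i] =
     P [set w | forall i, complex.Re (g 0%N i w) <= t i /\ complex.Im (g 0%N i w) <= s i]).

Definition cexpect (P : probability Omega R) (f : Omega -> C) : C :=
  Rintegral P setT (fun w => complex.Re (f w)) +i* Rintegral P setT (fun w => complex.Im (f w)).

End Defs.

Section Model.
Variable R : realType.
Local Notation C := R[i].

Definition cvnorm n (v : 'cV[C]_n) : R :=
  Num.sqrt (\sum_k ((complex.Re (v k 0)) ^+ 2 + (complex.Im (v k 0)) ^+ 2)).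

Definition gs_step n (us : seq 'cV[C]_n) (v : 'cV[C]_n) : 'cV[C]_n :=
  let w := v - \sum_(u <- us) ((ctr u *m v) 0 0) *: u in
  ((cvnorm w)^-1)%:C *: w.
Definition gram_schmidt n (vs : seq 'cV[C]_n) : seq 'cV[C]_n :=
  foldl (fun us v => rcons us (gs_step us v)) [::] vs.

Definition Xtilde (M : model) r (theta : 'I_r -> R) n (x : 'I_n -> R)
   (Gv : 'I_r -> 'cV[C]_n) : 'M[C]_n :=
  let X := diag_mx (\row_k (x k)%:C) in
  match M with
  | IIDmodel =>
      X + ((n%:R)^-1)%:C *: \sum_i (theta i)%:C *: (Gv i *m ctr (Gv i))
  | Orthmodel =>
      let U := gram_schmidt [seq Gv i | i <- enum 'I_r] in
      X + \sum_i (theta i)%:C *: (nth 0 U i *m ctr (nth 0 U i))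
  end.

Local Open Scope ereal_scope.

Definition elog (x : \bar R) : \bar R :=
  if x == 0 then -oo else (ln (fine x))%:E.

Definition good_rate_function (T : topologicalType) (L : T -> \bar R) : Prop :=
  (forall x, 0 <= L x) /\
  (forall t : R, closed [set x | L x <= t%:E]) /\
  (forall t : R, compact [set x | L x <= t%:E]).

Definition LDP {d} {Omega : measurableType d} (P : probability Omega R)
   (T : topologicalType) (Y : nat -> Omega -> T) (L : T -> \bar R) : Prop :=
  (forall F : set T, closed F ->
     limn_esup (fun n => ((n%:R)^-1)%:E * elog (P (Y n @^-1` F)))
       <= - ereal_inf (L @` F)) /\
  (forall G : set T, open G ->
     - ereal_inf (L @` G)
       <= limn_einf (fun n => ((n%:R)^-1)%:E * elog (P (Y n @^-1` G)))).

End Model.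

Definition zero_mult (R : realType) (f : R -> R) (x : R) (n : nat) : Prop :=
  (forall j, (j < n)%N -> derive1n j f x = 0) /\ derive1n n f x <> 0.

Definition msupport (R : realType) (mu : probability R R) : set R :=
  [set x | forall e : R, 0 < e -> (0 < mu (ball x e))%E].

(* Main.v *)
(* Proof idea. Write the perturbed matrix as X + W Theta W^* with W having r columns. For z above the
   spectrum of X, the Schur complements of the block matrix with diagonal blocks z - X and Theta^-1
   relate inertias, so "lambda_j > z" becomes a statement on the signature of the r x r matrix
   Theta^-1 - W^* (z - X)^-1 W, which is stable under small perturbations when its limit is invertible.
   By a Chernoff bound the entries of W^* (z - X)^-1 W concentrate exponentially fast around
   h(z) C^*, with h the Stieltjes transform of mu, and the limit signature counts the eigenvalues of
   A0 = W0 Theta W0^* above 1/h(z), where C^* = W0^* W0 in the i.i.d. model and W0 = 1 in the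
   orthonormalized one. The same factorization gives H(z) = c * prod_x (1 - h(z) x) over the
   eigenvalues x of A0, so the zeros of H are the limits. Exponential concentration then forces both
   the zero set of the rate function and, by Borel-Cantelli, almost sure convergence. *)
Require Import Defs.
From HB Require Import structures.
From mathcomp Require Import all_boot all_order all_algebra.
From mathcomp Require Import all_classical all_reals all_analysis.
From mathcomp Require Import measurable_realfun finmap complex.
From mathcomp Require Import ring lra zify.

Set Implicit Arguments.
Unset Strict Implicit.
Unset Printing Implicit Defensive.

Import Order.TTheory GRing.Theory Num.Theory.
Import numFieldNormedType.Exports.
Local Open Scope classical_set_scope.
Local Open Scope ring_scope.
Local Open Scope complex_scope.

(** * Hermitian forms and inertia *)

(** The signature of [Theta^-1 - h(z) Cstar] is stable only if this matrix is invertible, that is if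
    [h(z) * x] differs from 1 for every eigenvalue [x] of [A0]. The comparison is therefore never
    made at a limit point: each limit is squeezed between levels [z] chosen off a finite set. When a
    limit equals [b], no admissible level lies below it, since all levels are above the support; the
    lower estimate is then deterministic, a dimension count on the eigenvectors of [X] with
    eigenvalue close to [b].

    The rate function is never computed. A point where it vanishes has no neighbourhood of
    exponentially small probability, by the lower bound, so it can only be the limit point.
    Conversely boxes around the limit point have probability at least 1/2 for large [n], so the
    upper bound gives infimum 0 on each of them, and closed sublevel sets carry this to the centre.

    Multiplicities are read from the product formula for [H]: since [h] has nonzero derivative,
    [h - h(z0)] has a simple zero at [z0], and every factor vanishing there is a nonzero multiple of
    it. *)

Section QuadraticForms.
Variable R : realType.
Local Notation C := R[i].
Implicit Types (m n p q : nat).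

Lemma ctrK m n : cancel (@ctr R m n) (@ctr R n m).
Proof. by move=> A; apply/matrixP => i j; rewrite !mxE conjcK. Qed.

Lemma ctrM m n p (A : 'M[C]_(m, n)) (B : 'M[C]_(n, p)) :
  ctr (A *m B) = ctr B *m ctr A.
Proof. by rewrite /ctr map_mxM trmx_mul. Qed.

Lemma ctrD m n (A B : 'M[C]_(m, n)) : ctr (A + B) = ctr A + ctr B.
Proof. by rewrite /ctr map_mxD linearD. Qed.

Lemma ctrN m n (A : 'M[C]_(m, n)) : ctr (- A) = - ctr A.
Proof. by rewrite /ctr map_mxN linearN. Qed.

Lemma ctrB m n (A B : 'M[C]_(m, n)) : ctr (A - B) = ctr A - ctr B.
Proof. by rewrite ctrD ctrN. Qed.

Lemma ctrZ m n (a : C) (A : 'M[C]_(m, n)) : ctr (a *: A) = conjc a *: ctr A.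
Proof. by rewrite /ctr map_mxZ linearZ. Qed.

Lemma conj_RC (a : R) : conjc (a%:C) = a%:C :> C.
Proof. by apply/eqP; rewrite eq_complex /= oppr0 !eqxx. Qed.

Lemma ctr_diag n (d : 'I_n -> R) :
  ctr (diag_mx (\row_i (d i)%:C)) = diag_mx (\row_i (d i)%:C).
Proof.
apply/matrixP => i j; rewrite !mxE eq_sym.
case: (eqVneq i j) => [->|]; rewrite ?mulr1n ?mulr0n ?conjc0 //=.
by rewrite oppr0.
Qed.

Lemma ctr_scalar n (a : R) : ctr (a%:C%:M : 'M[C]_n) = a%:C%:M.
Proof.
apply/matrixP => i j; rewrite !mxE eq_sym.
by case: (i == j); rewrite ?mulr1n ?mulr0n ?conjc0 //= oppr0.
Qed.

Lemma ctr1 n : ctr (1%:M : 'M[C]_n) = 1%:M.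
Proof. exact: (ctr_scalar n 1). Qed.

Definition herm n (A : 'M[C]_n) := ctr A = A.

Definition qf n (A : 'M[C]_n) (v : 'rV[C]_n) : R :=
  complex.Re ((v *m A *m ctr v) 0 0).
Definition nsq n (v : 'rV[C]_n) : R := complex.Re ((v *m ctr v) 0 0).

Lemma qfD n (A B : 'M[C]_n) v : qf (A + B) v = qf A v + qf B v.
Proof. by rewrite /qf mulmxDr mulmxDl mxE raddfD. Qed.

Lemma qfN n (A : 'M[C]_n) v : qf (- A) v = - qf A v.
Proof. by rewrite /qf mulmxN mulNmx mxE raddfN. Qed.

Lemma qfB n (A B : 'M[C]_n) v : qf (A - B) v = qf A v - qf B v.
Proof. by rewrite qfD qfN. Qed.

Lemma Re_mulr (a : R) (z : C) : complex.Re (a%:C * z) = a * complex.Re z.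
Proof. by case: z => u v /=; rewrite mul0r subr0. Qed.

Lemma qfZ n (a : R) (A : 'M[C]_n) v : qf (a%:C *: A) v = a * qf A v.
Proof. by rewrite /qf -scalemxAr -scalemxAl mxE Re_mulr. Qed.

Lemma qf_scalar n (a : R) v : qf (a%:C%:M : 'M[C]_n) v = a * nsq v.
Proof. by rewrite -scalemx1 qfZ /qf mulmx1. Qed.

Lemma qf_mul n p (A : 'M[C]_n) (V : 'M[C]_(p, n)) y :
  qf A (y *m V) = qf (V *m A *m ctr V) y.
Proof. by rewrite /qf ctrM !mulmxA. Qed.

Lemma nsq_mul n p (V : 'M[C]_(p, n)) y :
  nsq (y *m V) = qf (V *m ctr V) y.
Proof. by rewrite /nsq /qf ctrM !mulmxA. Qed.

Definition abs2 (z : C) : R := complex.Re z ^+ 2 + complex.Im z ^+ 2.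

Lemma mul_conj_abs2 (z : C) : z * conjc z = (abs2 z)%:C.
Proof.
case: z => u v; rewrite /abs2 /=; apply/eqP; rewrite eq_complex /=.
by apply/andP; split; apply/eqP; ring.
Qed.

Lemma abs2_ge0 z : 0 <= abs2 z.
Proof. by rewrite addr_ge0 ?sqr_ge0. Qed.

Lemma abs2_eq0 z : (abs2 z == 0) = (z == 0).
Proof.
by rewrite /abs2 paddr_eq0 ?sqr_ge0 // !sqrf_eq0 [RHS]eq_complex.
Qed.

Lemma qf_diag n (d : 'I_n -> R) v :
  qf (diag_mx (\row_i (d i)%:C)) v = \sum_i d i * abs2 (v 0 i).
Proof.
rewrite /qf !mxE raddf_sum; apply: eq_bigr => i _.
rewrite mul_mx_diag !mxE mulrAC mul_conj_abs2 -rmorphM /=.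
by rewrite mulrC.
Qed.

Lemma nsqE n (v : 'rV[C]_n) : nsq v = \sum_i abs2 (v 0 i).
Proof.
rewrite /nsq mxE raddf_sum; apply: eq_bigr => i _.
by rewrite !mxE mul_conj_abs2.
Qed.

Lemma nsq_ge0 n (v : 'rV[C]_n) : 0 <= nsq v.
Proof. by rewrite nsqE sumr_ge0 // => i _; exact: abs2_ge0. Qed.

Lemma nsq_eq0 n (v : 'rV[C]_n) : (nsq v == 0) = (v == 0).
Proof.
rewrite nsqE psumr_eq0; last by move=> i _; exact: abs2_ge0.
apply/idP/eqP => [h|->]; last by apply/allP => i _; rewrite mxE abs2_eq0 eqxx implybT.
apply/rowP => i; rewrite mxE; apply/eqP; rewrite -abs2_eq0.
by apply: (implyP (allP h i _)) => //; rewrite mem_index_enum.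
Qed.

(* Witnessing a positive subspace by coefficients [y] makes the independence
   of the rows of [V] automatic. *)
Definition pos p n (A : 'M[C]_n) :=
  exists V : 'M[C]_(p, n), forall y : 'rV_p, y != 0 -> 0 < qf A (y *m V).

Lemma wide_kernel p n (V : 'M[C]_(p, n)) : (n < p)%N ->
  exists2 y : 'rV_p, y != 0 & y *m V = 0.
Proof.
move=> np; have : kermx V != 0.
  rewrite kermx_eq0 /row_free neq_ltn.
  by rewrite (leq_ltn_trans (rank_leq_col V) np).
by case/rowV0Pn => y /sub_kermxP yV y0; exists y.
Qed.

(** If [p + q > n], the rows of [V] and [U] together are dependent, and a relation between them
    produces a common vector on which the form would be both positive and negative. *)
Lemma pos_neg_leq p q n (A : 'M[C]_n) : pos p A -> pos q (- A) -> (p + q <= n)%N.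
Proof.
move=> [V hV] [U hU]; rewrite leqNgt; apply/negP => np.
have [y y0] := wide_kernel (col_mx V U) np.
rewrite -[y]hsubmxK mul_row_col => /eqP; rewrite addr_eq0 => /eqP e.
have y2 : rsubmx y = 0.
  apply/eqP/negP => /negP u0; have := hU _ u0.
  have [v0|v0] := eqVneq (lsubmx y) 0.
    rewrite qfN /qf -[X in X *m A]opprK -e v0 mul0mx oppr0 !mul0mx mxE /=.
    by rewrite oppr0 ltxx.
  have := hV _ v0; rewrite e !qfN /qf mulNmx ctrN mulNmx mulmxN opprK => h1 h2.
  by have := addr_gt0 h1 h2; rewrite subrr ltxx.
have v0 : lsubmx y != 0.
  by apply: contraNneq y0 => v0; rewrite -[y]hsubmxK y2 v0 row_mx0.
have := hV _ v0.
by rewrite e y2 mul0mx oppr0 /qf !mul0mx mxE ltxx.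
Qed.

Record spectral n (A : 'M[C]_n) (U : 'M[C]_n) (d : 'I_n -> R) : Prop := Spectral {
  sp_unitary : U *m ctr U = 1%:M;
  sp_eq : A = ctr U *m diag_mx (\row_i (d i)%:C) *m U }.

Lemma spectral_exists n (A : 'M[C]_n) : herm A -> exists U d, spectral A U d.
Proof.
move=> hA.
have hsA : A \is hermsymmx.
  apply/is_hermitianmxP; rewrite expr0 scale1r -{1}hA.
  by apply/matrixP => i j; rewrite !mxE.
have /orthomx_spectralP eA := hermitian_normalmx hsA.
have /mxOverP rd := hermitian_spectral_diag_real hsA.
have uA := spectral_unitarymx A.
have hU : spectralmx A *m ctr (spectralmx A) = 1%:M.
  move/unitarymxP: (uA) => <-; congr (_ *m _).
  by apply/matrixP => i j; rewrite !mxE.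
exists (spectralmx A), (fun i => complex.Re (spectral_diag A 0 i)); split; first exact: hU.
rewrite {1}eA; congr (_ *m diag_mx _ *m _); last first.
  by apply/rowP => i; rewrite mxE RRe_real.
rewrite invmx_unitary //.
by apply/matrixP => i j; rewrite !mxE.
Qed.

End QuadraticForms.

Section Spectrum.
Variable R : realType.
Local Notation C := R[i].
Implicit Types (m n p q : nat).

Section Spectral.
Variables (n : nat) (A U : 'M[C]_n) (d : 'I_n -> R).
Hypothesis spA : spectral A U d.

Lemma spectral_unitl : ctr U *m U = 1%:M.
Proof. exact: mulmx1C (sp_unitary spA). Qed.

Lemma qf_spectral v : qf A v = \sum_i d i * abs2 ((v *m ctr U) 0 i).
Proof. by rewrite -qf_diag qf_mul ctrK -(sp_eq spA). Qed.

Lemma nsq_spectral v : nsq v = \sum_i abs2 ((v *m ctr U) 0 i).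
Proof. by rewrite -nsqE nsq_mul ctrK spectral_unitl /qf mulmx1. Qed.

Lemma char_poly_spectral :
  char_poly A = \prod_i ('X - ((d i)%:C)%:P).
Proof.
rewrite (sp_eq spA) /char_poly /char_poly_mx.
have e : 'X%:M - map_mx polyC (ctr U *m diag_mx (\row_i (d i)%:C) *m U) =
   map_mx polyC (ctr U) *m ('X%:M - map_mx polyC (diag_mx (\row_i (d i)%:C)))
     *m map_mx polyC U.
  rewrite mulmxBr mulmxBl -!map_mxM; congr (_ - _).
  rewrite -scalemx1 -scalemxAr mulmx1 -scalemxAl -map_mxM spectral_unitl.
  by rewrite map_scalar_mx.
rewrite e !det_mulmx mulrAC -det_mulmx -map_mxM spectral_unitl map_scalar_mx.
rewrite det1 mul1r.
have -> : 'X%:M - map_mx polyC (diag_mx (\row_i (d i)%:C)) =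
   diag_mx (\row_i ('X - ((d i)%:C)%:P)).
  apply/matrixP => i j; rewrite !mxE.
  by case: (i == j); rewrite ?mulr1n ?mulr0n ?polyC0 ?subr0.
by rewrite det_diag; apply: eq_bigr => i _; rewrite mxE.
Qed.

(** The subspace is spanned by eigenvectors, rows of [U], with eigenvalue above [c]; [S] selects [p]
    of them. *)
Lemma above_subspace (c : R) p : (p <= #|[pred i | (c < d i)%R]|)%N ->
  exists V : 'M[C]_(p, n),
    forall y : 'rV_p, y != 0 -> c * nsq (y *m V) < qf A (y *m V).
Proof.
move=> pN; pose I := [pred i | c < d i].
pose s (a : 'I_p) : 'I_n := enum_val (widen_ord pN a : 'I_#|I|).
have sI a : c < d (s a) by have := enum_valP (widen_ord pN a : 'I_#|I|).
have s_inj : injective s.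
  by move=> a a' /enum_val_inj /(congr1 val) /= /val_inj.
pose S : 'M[C]_(p, n) := \matrix_(a, j) (j == s a)%:R.
exists (S *m U) => y y0.
have e : y *m (S *m U) *m ctr U = y *m S.
  by rewrite -!mulmxA (sp_unitary spA) mulmx1.
rewrite qf_spectral nsq_spectral e mulr_sumr.
have yS a : (y *m S) 0 (s a) = y 0 a.
  rewrite mxE (bigD1 a) //= mxE eqxx mulr1 big1 ?addr0 // => b ba.
  by rewrite mxE (inj_eq s_inj) eq_sym (negPf ba) mulr0.
have [a ya] : exists a, y 0 a != 0.
  apply/existsP; apply: contraNT y0 => /existsPn h.
  by apply/eqP/rowP => a; rewrite mxE; apply/eqP; rewrite -[_ == _]negbK h.
have yS0 j : ~~ (c < d j) -> (y *m S) 0 j = 0.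
  move=> jI; rewrite mxE big1 // => b _; rewrite mxE.
  by case: eqP => [e'|]; rewrite ?mulr0 //; rewrite e' sI in jI.
(* One nonzero coordinate gives strictness; the other terms are compared one by one, and those with
   eigenvalue at most [c] vanish. *)
rewrite [ltLHS](bigD1 (s a)) // [ltRHS](bigD1 (s a)) //=.
apply: ltr_leD.
  by rewrite ltr_pM2r ?sI // lt_neqAle abs2_ge0 andbT eq_sym abs2_eq0 yS.
apply: ler_sum => j _; have [cd|/yS0 ->] := boolP (c < d j).
  by rewrite ler_wpM2r ?abs2_ge0 // ltW.
by rewrite /abs2 /= expr0n /= addr0 !mulr0.
Qed.

(** With too many rows, some nonzero combination has no component along the eigenvectors above [c],
    and there the form is at most [c * nsq]. *)
Lemma above_subspace_leq (c : R) p (V : 'M[C]_(p, n)) :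
  (forall y : 'rV_p, y != 0 -> c * nsq (y *m V) < qf A (y *m V)) ->
  (p <= #|[pred i | (c < d i)%R]|)%N.
Proof.
move=> hV; rewrite leqNgt; apply/negP => Np.
pose I := [pred i | c < d i].
pose T : 'M[C]_(n, #|I|) := \matrix_(j, a) (j == enum_val a)%:R.
have [y y0 yT] := wide_kernel (V *m ctr U *m T) Np.
have := hV y y0; rewrite ltNge => /negP; apply.
rewrite qf_spectral nsq_spectral mulr_sumr; apply: ler_sum => j _.
have [cd|] := boolP (c < d j); last first.
  by rewrite -leNgt => cd; rewrite ler_wpM2r ?abs2_ge0.
suff -> : (y *m V *m ctr U) 0 j = 0 by rewrite /abs2 /= expr0n /= addr0 !mulr0.
have jI : j \in I by [].
have : (y *m V *m ctr U *m T) 0 (enum_rank_in jI j) = 0.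
  by rewrite -(mulmxA y) -(mulmxA y) yT mxE.
rewrite mxE (bigD1 j) //= [T j _]mxE enum_rankK_in // eqxx mulr1 big1 ?addr0 //.
by move=> k kj; rewrite [T k _]mxE (enum_rankK_in jI) // (negPf kj) mulr0.
Qed.

Lemma pos_spectral (c : R) p :
  pos p (A - c%:C%:M) <-> (p <= #|[pred i | (c < d i)%R]|)%N.
Proof.
split=> [[V hV]|/above_subspace[V hV]].
  apply: (@above_subspace_leq c p V) => y /hV.
  by rewrite qfB qf_scalar subr_gt0.
by exists V => y /hV; rewrite qfB qf_scalar subr_gt0.
Qed.

End Spectral.

Lemma prod_XsubC_perm (s t : seq R) :
  \prod_(x <- s) ('X - (x%:C)%:P) = \prod_(x <- t) ('X - (x%:C)%:P) :> {poly C} ->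
  perm_eq s t.
Proof.
move=> e; have : perm_eq (map (real_complex R) s) (map (real_complex R) t).
  by apply: prod_XsubC_eq; rewrite !big_map e.
move=> /perm_map_inj; apply; exact: complexI.
Qed.

Lemma eig_specP n (A U : 'M[C]_n) d : spectral A U d -> eig_spec A (eigs A).
Proof.
move=> spA; apply: (@xgetPex _ [::] (eig_spec A)).
exists (sort >=%R [seq d i | i <- enum 'I_n]); split.
  exact: (sort_sorted (ge_total)).
rewrite (char_poly_spectral spA) (perm_big [seq d i | i <- enum 'I_n]) /=.
  by rewrite big_map big_enum.
by rewrite perm_sort.
Qed.

Lemma perm_eigs n (A U : 'M[C]_n) d : spectral A U d ->
  perm_eq (eigs A) [seq d i | i <- enum 'I_n].
Proof.
move=> spA; apply: prod_XsubC_perm; have [_ <-] := eig_specP spA.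
by rewrite (char_poly_spectral spA) big_map big_enum.
Qed.

Lemma size_eigs n (A : 'M[C]_n) : herm A -> size (eigs A) = n.
Proof.
move=> /spectral_exists[U [d spA]].
by rewrite (perm_size (perm_eigs spA)) size_map size_enum_ord.
Qed.

Lemma sorted_eigs n (A : 'M[C]_n) : herm A -> sorted >=%R (eigs A).
Proof. by move=> /spectral_exists[U [d /eig_specP[]]]. Qed.

(** In a nonincreasing list the entries above [c] form an initial segment. *)
Lemma sorted_count_gt (s : seq R) (c : R) j : sorted >=%R s -> (j < size s)%N ->
  (c < nth 0 s j) = (j < count (fun x => c < x)%R s)%N.
Proof.
move=> hs js; pose a x := (c < x)%R.
have mono i k : (i <= k < size s)%N -> a (nth 0 s k) -> a (nth 0 s i).
  move=> /andP[ik ks] /lt_le_trans; apply.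
  have tr : transitive (>=%R : rel R) by move=> y u z h1 h2; exact: le_trans h2 h1.
  by apply: (sorted_leq_nth tr _ 0 hs) => // => [u|]; [exact: lexx | rewrite inE (leq_ltn_trans ik)].
rewrite -[in RHS](cat_take_drop j s) count_cat.
have [h|h] := boolP (a (nth 0 s j)).
  have -> : count a (take j s) = j.
    have sj := size_takel (ltnW js); rewrite -[RHS]sj; apply/eqP; rewrite -all_count.
    apply/(all_nthP (0 : R)) => i; rewrite size_takel ?(ltnW js) // => ij.
    by rewrite nth_take //; apply: (mono i j) => //; rewrite (ltnW ij).
  rewrite (drop_nth 0) //= -/(a _) h; symmetry; apply/idP.
  by rewrite addnA addn1 leq_addr.
have -> : count a (drop j s) = 0%N.
  apply/eqP; rewrite -leqn0 leqNgt -has_count; apply/negP => /(has_nthP (0 : R))[k].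
  rewrite size_drop nth_drop => kj; apply/negP; apply: contra h.
  by apply: mono; rewrite leq_addr /= -ltn_subRL.
rewrite addn0 ltnNge -/(a _) (negbTE h); apply/esym/negbTE; rewrite negbK.
by rewrite (leq_trans (count_size _ _)) // size_takel // ltnW.
Qed.

(** The Courant-Fischer principle. Ordered eigenvalues are accessed below through dimensions of
    positive subspaces; the successor comes from the 0-based numbering. *)
Lemma eig_gtP n (A : 'M[C]_n) (c : R) j : herm A -> (j < n)%N ->
  c < eig A j <-> pos j.+1 (A - c%:C%:M).
Proof.
move=> hA jn; have [U [d spA]] := spectral_exists hA.
have eN : count (fun x => c < x) (eigs A) = #|[pred i | (c < d i)%R]|.
  by rewrite (permP (perm_eigs spA)) count_map cardE -size_filter enumT.
split; rewrite /eig.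
  rewrite sorted_count_gt ?sorted_eigs ?size_eigs // eN.
  by move/(pos_spectral spA).
move/(pos_spectral spA); rewrite -eN => h.
by rewrite sorted_count_gt ?sorted_eigs ?size_eigs.
Qed.

End Spectrum.

(** * Inertia of the two Schur complements *)

Section Inertia.
Variable R : realType.
Local Notation C := R[i].
Implicit Types (m n p q : nat).

(** Compare two block triangular factorizations of the matrix with blocks [1, A] and [B, 1]. *)
Lemma det_1B_mulC m n (A : 'M[C]_(m, n)) (B : 'M[C]_(n, m)) :
  \det (1%:M - A *m B) = \det (1%:M - B *m A).
Proof.
have e1 : block_mx 1%:M A B 1%:M =
    block_mx 1%:M 0 B 1%:M *m block_mx 1%:M A 0 (1%:M - B *m A) :> 'M[C]_(m + n).
  rewrite mulmx_block !(mul1mx, mul0mx, mulmx0, mulmx1, addr0, add0r).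
  by rewrite addrC subrK.
have e2 : block_mx 1%:M A B 1%:M =
    block_mx (1%:M - A *m B) A 0 1%:M *m block_mx 1%:M 0 B 1%:M :> 'M[C]_(m + n).
  rewrite mulmx_block !(mul1mx, mul0mx, mulmx0, mulmx1, addr0, add0r).
  by rewrite subrK.
have := congr1 determinant e1; rewrite {1}e2 !det_mulmx !det_lblock !det_ublock.
by rewrite !det1 !mul1r !mulr1.
Qed.

Lemma pos_dim p n (A : 'M[C]_n) : pos p A -> (p <= n)%N.
Proof.
move=> [V hV]; rewrite leqNgt; apply/negP => /(wide_kernel V)[y /hV + yV].
by rewrite yV /qf !mul0mx mxE ltxx.
Qed.

(** Imposing [s] linear conditions on a [q]-dimensional space leaves dimension at least [q - s];
    [pid_mx] keeps [p] vectors of a basis of the kernel. *)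
Lemma left_kernel p q s (M : 'M[C]_(q, s)) : (p + s <= q)%N ->
  exists2 N : 'M[C]_(p, q), (forall y : 'rV_p, y != 0 -> y *m N != 0) & N *m M = 0.
Proof.
move=> psq; have rk : (p <= \rank (kermx M))%N.
  by rewrite mxrank_ker; have := rank_leq_col M; lia.
exists ((pid_mx p : 'M[C]_(p, \rank (kermx M))) *m row_base (kermx M)) => [y y0|].
  rewrite mulmxA mulmx_free_eq0 ?row_base_free //.
  apply: contraNneq y0 => e.
  have := congr1 (fun Z => Z *m (pid_mx p : 'M[C]_(\rank (kermx M), p))) e.
  by rewrite mul0mx -mulmxA mul_pid_mx minnn (minn_idPr rk) pid_mx_1 mulmx1 => ->.
have /sub_kermxP e : (row_base (kermx M) <= kermx M)%MS by rewrite eq_row_base.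
by rewrite -mulmxA e mulmx0.
Qed.

(** Both sides are [v B v^* - v W u^* - u W^* v^* + u Ti u^*], with the square completed in [v] on
    the left and in [u] on the right. *)
Lemma schur_identity n r (B Bi : 'M[C]_n) (Th Ti : 'M[C]_r) (W : 'M[C]_(n, r))
    (v : 'rV[C]_n) (u : 'rV[C]_r) :
  ctr B = B -> ctr Bi = Bi -> ctr Th = Th -> B *m Bi = 1%:M -> Th *m Ti = 1%:M ->
  qf (Ti - ctr W *m Bi *m W) u + qf B (v - u *m ctr W *m Bi) =
  qf (B - W *m Th *m ctr W) v + qf Ti (u - v *m W *m Th).
Proof.
move=> hB hBi hTh BBi ThTi.
have BiB := mulmx1C BBi; have TiTh := mulmx1C ThTi.
have ReD (X Y : 'M[C]_1) :
    complex.Re (X 0 0) + complex.Re (Y 0 0) = complex.Re ((X + Y) 0 0).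
  by rewrite mxE raddfD.
rewrite /qf !ReD; congr (complex.Re (fun_of_matrix _ 0 0)).
rewrite !ctrB !ctrM !ctrK hBi hTh !(mulmxBl, mulmxBr) !mulmxA.
have s1 (X : 'M[C]_(1, n)) : X *m Bi *m B = X by rewrite -mulmxA BiB mulmx1.
have s2 (X : 'M[C]_(1, n)) : X *m B *m Bi = X by rewrite -mulmxA BBi mulmx1.
have s3 (X : 'M[C]_(1, r)) : X *m Th *m Ti = X by rewrite -mulmxA ThTi mulmx1.
have s4 (X : 'M[C]_(1, r)) : X *m Ti *m Th = X by rewrite -mulmxA TiTh mulmx1.
rewrite !(s1, s2, s3, s4).
set a := u *m Ti *m _; set b := u *m ctr W *m Bi *m W *m _.
set c := v *m B *m _; set e := v *m W *m Th *m _ *m _; set f := v *m W *m _.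
set g := u *m ctr W *m _.
apply/matrixP => i j; rewrite !mxE; ring.
Qed.

Definition selmx n (I : pred 'I_n) : 'M[C]_(n, #|I|) :=
  \matrix_(j, a) (j == enum_val a)%:R.

Lemma mulmx_sel n (I : pred 'I_n) (x : 'rV[C]_n) (a : 'I_#|I|) :
  (x *m selmx I) 0 a = x 0 (enum_val a).
Proof.
rewrite mxE (bigD1 (enum_val a)) //= mxE eqxx mulr1 big1 ?addr0 //.
by move=> k /negPf ka; rewrite mxE ka mulr0.
Qed.

Lemma mulmx_sel_eq0 n (I : pred 'I_n) (x : 'rV[C]_n) :
  x *m selmx I = 0 -> forall i, I i -> x 0 i = 0.
Proof.
move=> x0 i Ii; have iI : i \in I by [].
by rewrite -[i in LHS](enum_rankK_in iI iI) -mulmx_sel x0 mxE.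
Qed.

Lemma mulmx_trsel n (I : pred 'I_n) (y : 'rV[C]_#|I|) (a : 'I_#|I|) :
  (y *m (selmx I)^T) 0 (enum_val a) = y 0 a.
Proof.
rewrite mxE (bigD1 a) //= !mxE eqxx mulr1 big1 ?addr0 //.
by move=> k /negPf ka; rewrite !mxE (inj_eq enum_val_inj) eq_sym ka mulr0.
Qed.

Lemma mulmx_trsel0 n (I : pred 'I_n) (y : 'rV[C]_#|I|) i :
  ~~ I i -> (y *m (selmx I)^T) 0 i = 0.
Proof.
move=> iI; rewrite mxE big1 // => a _; rewrite !mxE.
case: eqP => [e|]; rewrite ?mulr0 //.
by have := enum_valP a; rewrite -e /in_mem /= (negPf iI).
Qed.

Section Schur.
Variables (n r : nat) (bd : 'I_n -> R) (theta : 'I_r -> R) (W : 'M[C]_(n, r)).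
Hypothesis bd_gt0 : forall i, 0 < bd i.
Hypothesis theta_neq0 : forall i, theta i != 0.

Let B : 'M[C]_n := diag_mx (\row_i (bd i)%:C).
Let Bi : 'M[C]_n := diag_mx (\row_i ((bd i)^-1)%:C).
Let Th : 'M[C]_r := diag_mx (\row_i (theta i)%:C).
Let Ti : 'M[C]_r := diag_mx (\row_i ((theta i)^-1)%:C).
Let I := [pred i | theta i < 0].

Lemma diag_mxV k (f : 'I_k -> R) : (forall i, f i != 0) ->
  diag_mx (\row_i (f i)%:C) *m diag_mx (\row_i ((f i)^-1)%:C) = 1%:M :> 'M[C]_k.
Proof.
move=> f0; rewrite mul_diag_mx; apply/matrixP => i j; rewrite !mxE.
case: (eqVneq i j) => [->|]; rewrite ?mulr1n ?mulr0n ?mulr0 //.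
by rewrite -rmorphM /= mulfV.
Qed.

(** Additivity of inertia over Schur complements: [B] is positive definite and contributes no
    negative direction, whereas [Ti] contributes [#|I|] of them, hence the shift. Each direction
    chooses [u] and [v] so that the unwanted squares of [schur_identity] have the right sign. *)
Lemma schur_inertia p :
  pos p (W *m Th *m ctr W - B) <-> pos (p + #|I|) (ctr W *m Bi *m W - Ti).
Proof.
have BBi : B *m Bi = 1%:M by apply: diag_mxV => i; rewrite gt_eqF.
have ThTi : Th *m Ti = 1%:M by exact: diag_mxV.
have key v u := @schur_identity n r B Bi Th Ti W v u (ctr_diag _) (ctr_diag _)
  (ctr_diag _) BBi ThTi.
have qB v : 0 <= qf B v.
  by rewrite qf_diag sumr_ge0 // => i _; rewrite mulr_ge0 ?abs2_ge0 // ltW.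
have eK u : qf (ctr W *m Bi *m W - Ti) u = - qf (Ti - ctr W *m Bi *m W) u.
  by rewrite -qfN opprB.
have eB v : qf (W *m Th *m ctr W - B) v = - qf (B - W *m Th *m ctr W) v.
  by rewrite -qfN opprB.
split=> [[V hV]|[V hV]].
- exists (col_mx (V *m W *m Th) (selmx I)^T) => y.
  rewrite -[y]hsubmxK mul_row_col; set y1 := lsubmx y; set y2 := rsubmx y => y0.
  (* With this [u] the residual [u - v W Th] lies in the span of the coordinates where [Ti] is
     negative. *)
  pose u := y1 *m (V *m W *m Th) + y2 *m (selmx I)^T.
  have := key (y1 *m V) u.
  have -> : u - y1 *m V *m W *m Th = y2 *m (selmx I)^T.
    by rewrite /u !mulmxA addrAC subrr add0r.
  rewrite -/u eK; have := hV y1; rewrite eB.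
  have h2 : y2 != 0 -> qf Ti (y2 *m (selmx I)^T) < 0.
    move=> y20; have [a ya] : exists a, y2 0 a != 0.
      apply/existsP; apply: contraNT y20 => /existsPn h.
      by apply/eqP/rowP => a; rewrite [RHS]mxE; apply/eqP; rewrite -[_ == _]negbK h.
    rewrite qf_diag (bigD1 (enum_val a)) //= mulmx_trsel.
    apply: ltr_wnDr; last first.
      have ta : theta (enum_val a) < 0 by have := enum_valP a.
      have ya' : 0 < abs2 (y2 0 a) by rewrite lt_neqAle abs2_ge0 eq_sym abs2_eq0 ya.
      by rewrite pmulr_llt0 // invr_lt0.
    apply: sumr_le0 => i _; have [Ii|Ii] := boolP (I i).
      by rewrite mulr_le0_ge0 ?abs2_ge0 // invr_le0 ltW.
    by rewrite mulmx_trsel0 // /abs2 /= expr0n /= addr0 mulr0.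
  have h2' : qf Ti (y2 *m (selmx I)^T) <= 0.
    have [->|/h2/ltW//] := eqVneq y2 0.
    by rewrite /qf !mul0mx mxE.
  have := qB (y1 *m V - u *m ctr W *m Bi).
  have [y10|y10] := eqVneq y1 0 => qb hv E; last by have := hv isT; lra.
  have y20 : y2 != 0 by apply: contraNneq y0 => y20; rewrite y10 y20 row_mx0.
  have := h2 y20; move: E.
  have -> : qf (B - W *m Th *m ctr W) (y1 *m V) = 0.
    by rewrite y10 mul0mx /qf !mul0mx [(0 : 'M[C]_1) 0 0]mxE.
  lra.
(* Here [v = u W^* Bi] cancels the [B]-square. Giving up [#|I|] dimensions makes the residual [w]
   vanish on the negative coordinates of [Ti], so that its [Ti]-square is nonnegative. *)
have [N N0 NM] := @left_kernel p (p + #|I|) #|I|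
  (V *m (1%:M - ctr W *m Bi *m W *m Th) *m selmx I) (leqnn _).
exists (N *m V *m ctr W *m Bi) => y y0.
have h1 := hV _ (N0 _ y0).
have := key (y *m (N *m V *m ctr W *m Bi)) (y *m N *m V).
rewrite !mulmxA subrr; rewrite [qf B 0]/qf !mul0mx [(0 : 'M[C]_1) 0 0]mxE /= addr0.
set w := y *m N *m V - _; move=> e.
have wI : w *m selmx I = 0.
  have -> : w = y *m N *m V *m (1%:M - ctr W *m Bi *m W *m Th).
    by rewrite mulmxBr mulmx1 !mulmxA.
  have -> : y *m N *m V *m (1%:M - ctr W *m Bi *m W *m Th) *m selmx I =
    y *m (N *m (V *m (1%:M - ctr W *m Bi *m W *m Th) *m selmx I)).
    by rewrite !mulmxA.
  by rewrite NM mulmx0.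
have hw : 0 <= qf Ti w.
  rewrite qf_diag sumr_ge0 // => i _; have [Ii|Ii] := boolP (I i).
    by rewrite (mulmx_sel_eq0 wI Ii) /abs2 /= expr0n /= addr0 mulr0.
  by rewrite mulr_ge0 ?abs2_ge0 // invr_ge0 leNgt.
by move: h1; rewrite eK eB ?mulmxA; lra.
Qed.

End Schur.

Lemma spectral_opp n (A U : 'M[C]_n) d :
  spectral A U d -> spectral (- A) U (fun i => - d i).
Proof.
move=> spA; split; first exact: sp_unitary spA.
rewrite [in LHS](sp_eq spA) -mulNmx -mulmxN; congr (_ *m _ *m _).
by apply/matrixP => i j; rewrite !mxE; case: (i == j);
  rewrite ?mulr1n ?mulr0n ?oppr0 // rmorphN.
Qed.

Lemma det_spectral n (A U : 'M[C]_n) d :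
  spectral A U d -> \det A = \prod_i (d i)%:C.
Proof.
move=> spA; rewrite (sp_eq spA) !det_mulmx mulrAC -det_mulmx (spectral_unitl spA).
by rewrite det1 mul1r det_diag; apply: eq_bigr => i _; rewrite mxE.
Qed.

Lemma finite_lower_bound (T : finType) (f : T -> R) :
  (forall i, 0 < f i) -> exists2 e : R, 0 < e & forall i, e < f i.
Proof.
move=> f0; suff [e e0 he] : exists2 e : R, 0 < e & forall i, i \in enum T -> e < f i.
  by exists e => // i; apply: he; rewrite mem_enum.
elim: (enum T) => [|i s [e e0 he]]; first by exists 1.
exists (Num.min e (f i / 2)); first by rewrite lt_min e0 /= divr_gt0.
move=> k; rewrite inE => /predU1P[->|/he h].
  by rewrite gt_min; apply/orP; right; have := f0 i; lra.
by rewrite gt_min h.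
Qed.

(** Take [e] below all absolute values of eigenvalues. A perturbation of size [e] keeps the form
    positive on the [N] positive eigendirections and negative on the [n - N] others; the latter
    bounds the positive dimension of [A + E] by [N]. *)
Lemma pos_stable n (A : 'M[C]_n) : herm A -> \det A != 0 ->
  exists2 e : R, 0 < e & forall E : 'M[C]_n,
    (forall v, `|qf E v| <= e * nsq v) -> forall p, pos p (A + E) <-> pos p A.
Proof.
move=> hA dA; have [U [d spA]] := spectral_exists hA.
have d0 i : d i != 0.
  apply: contraNneq dA => di; rewrite (det_spectral spA).
  by apply/prodf_eq0; exists i => //; rewrite di.
have [e e0 he] : exists2 e : R, 0 < e & forall i, e < `|d i|.
  by apply: finite_lower_bound => i; rewrite normr_gt0.
exists e; first exact: e0.
move=> E hE p.
pose N := #|[pred i | (0 < d i)%R]|.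
have N1 : N = #|[pred i | (e < d i)%R]|.
  apply: eq_card => i; rewrite !inE; apply/idP/idP => [di|]; last exact: lt_trans.
  by have := he i; rewrite gtr0_norm.
have N2 : (n - N)%N = #|[pred i | (e < - d i)%R]|.
  rewrite -[n in LHS]card_ord -(cardC [pred i | (0 < d i)%R]) addKn.
  apply: eq_card => i; rewrite !inE -leNgt; apply/idP/idP => di.
    by have := he i; rewrite ler0_norm.
  by rewrite -oppr_ge0 ltW // (lt_trans e0 di).
have posN q : pos q A <-> (q <= N)%N.
  have := pos_spectral spA 0 q; rewrite (_ : _%:M = 0) ?subr0 //.
  by apply/matrixP => i j; rewrite !mxE mul0rn.
split=> [pAE|/posN].
  apply/posN; have Nn : (N <= n)%N by rewrite -[n]card_ord max_card.
  suff : pos (n - N) (- (A + E)) by move=> /(pos_neg_leq pAE); lia.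
  have [V hV] := @above_subspace _ _ _ _ _ (spectral_opp spA) e (n - N) (eq_leq N2).
  exists V => y /hV; rewrite !qfN qfD; have := hE (y *m V).
  by rewrite ler_norml => /andP[_]; lra.
rewrite N1 => /(above_subspace spA)[V hV].
exists V => y /hV; rewrite qfD; have := hE (y *m V).
by rewrite ler_norml => /andP[]; lra.
Qed.

(* [K = W^* (z - X)^{-1} W] only enters through the inertia of [K - Theta^{-1}],
   so it can be replaced by a nearby matrix [h *: C0]; the comparison is then
   read back on [W0 Theta W0^*] with [C0 = W0^* W0]. *)
Lemma pos_perturbation r (theta : 'I_r -> R) (W0 : 'M[C]_r) (h : R) :
  let Th := diag_mx (\row_i (theta i)%:C) : 'M[C]_r in
  let Ti := diag_mx (\row_i ((theta i)^-1)%:C) : 'M[C]_r in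
  (forall i, theta i != 0) -> 0 < h -> \det (Ti - h%:C *: (ctr W0 *m W0)) != 0 ->
  exists2 e : R, 0 < e & forall n (bd : 'I_n -> R) (W : 'M[C]_(n, r)),
    (forall i, 0 < bd i) ->
    (forall u, `|qf (ctr W *m diag_mx (\row_i ((bd i)^-1)%:C) *m W
                     - h%:C *: (ctr W0 *m W0)) u| <= e * nsq u) ->
    forall p, pos p (W *m Th *m ctr W - diag_mx (\row_i (bd i)%:C)) <->
              pos p (W0 *m Th *m ctr W0 - (h^-1)%:C%:M).
Proof.
move=> Th Ti th0 h0 dT.
have hA : herm (h%:C *: (ctr W0 *m W0) - Ti).
  by rewrite /herm ctrB ctrZ ctrM ctrK ctr_diag conj_RC.
have dA : \det (h%:C *: (ctr W0 *m W0) - Ti) != 0.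
  by rewrite -opprB -scaleN1r detZ mulf_neq0 // expf_neq0 // oppr_eq0 oner_eq0.
have [e e0 he] := pos_stable hA dA; exists e => // n bd W bd0 hW p.
have e1 : (h^-1)%:C%:M = diag_mx (\row_(i < r) ((fun=> h^-1) i)%:C) :> 'M[C]_r.
  by apply/matrixP => i j; rewrite !mxE.
have h'0 (i : 'I_r) : 0 < (fun=> h^-1) i by rewrite invr_gt0.
have s1 := schur_inertia W bd0 th0 p.
have s2 := schur_inertia W0 h'0 th0 p.
have s3 := he _ hW (p + #|[pred i | (theta i < 0)%R]|)%N.
have e2 : ctr W0 *m diag_mx (\row_(i < r) (((fun=> h^-1) i)^-1)%:C) *m W0 =
    h%:C *: (ctr W0 *m W0).
  rewrite (_ : diag_mx _ = h%:C%:M); first by rewrite mul_mx_scalar scalemxAl.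
  by apply/matrixP => i j; rewrite !mxE invrK.
rewrite e2 in s2; rewrite e1 s1 s2 -s3.
have -> : ctr W *m diag_mx (\row_i ((bd i)^-1)%:C) *m W - Ti =
    h%:C *: (ctr W0 *m W0) - Ti + (ctr W *m diag_mx (\row_i ((bd i)^-1)%:C) *m W
      - h%:C *: (ctr W0 *m W0)).
  by rewrite [RHS]addrC addrA subrK.
exact: iff_refl.
Qed.

End Inertia.

(** * Eigenvalue comparison above and inside the bulk *)

Section OutlierComparison.
Variable R : realType.
Local Notation C := R[i].
Implicit Types (m n p q : nat).

(** Factor out [Ti], then move [W0] cyclically with [det_1B_mulC]: what remains is [det (1 - t A0)]
    with [A0] Hermitian. *)
Lemma det_resolvent r (theta : 'I_r -> R) (W0 : 'M[C]_r) (t : R) :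
  (forall i, theta i != 0) ->
  \det (diag_mx (\row_i ((theta i)^-1)%:C) - t%:C *: (ctr W0 *m W0)) =
  ((\prod_i (theta i)^-1) *
   \prod_(x <- eigs (W0 *m diag_mx (\row_i (theta i)%:C) *m ctr W0)) (1 - t * x))%:C.
Proof.
move=> th0; set Th := diag_mx (\row_i (theta i)%:C).
set Ti := diag_mx _.
have TiTh : Ti *m Th = 1%:M by apply: mulmx1C; exact: diag_mxV.
have e1 : Ti - t%:C *: (ctr W0 *m W0) =
    Ti *m (1%:M - (t%:C *: (Th *m ctr W0)) *m W0).
  by rewrite mulmxBr mulmx1 -scalemxAl -scalemxAr !mulmxA TiTh mul1mx.
rewrite e1 det_mulmx det_1B_mulC -scalemxAr mulmxA.
set A0 := W0 *m Th *m ctr W0.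
have hA0 : herm A0 by rewrite /herm /A0 !ctrM ctrK ctr_diag mulmxA.
have [U [d spA]] := spectral_exists hA0.
have spB : spectral (1%:M - t%:C *: A0) U (fun i => 1 - t * d i).
  split; first exact: sp_unitary spA.
  rewrite [in LHS](sp_eq spA) -(spectral_unitl spA).
  have -> : diag_mx (\row_i (1 - t * d i)%:C) =
      1%:M - t%:C *: diag_mx (\row_i (d i)%:C) :> 'M[C]_r.
    apply/matrixP => i j; rewrite !mxE; case: (i == j); last first.
      by rewrite !mulr0n mulr0 subr0.
    by rewrite !mulr1n rmorphB rmorphM.
  by rewrite mulmxBr mulmxBl mulmx1 -scalemxAr -scalemxAl.
rewrite (det_spectral spB) det_diag rmorphM /= (perm_big _ (perm_eigs spA)) /=.
rewrite big_map big_enum /= !rmorph_prod; congr (_ * _).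
by apply: eq_bigr => i _; rewrite mxE.
Qed.

Lemma herm_congr n r (theta : 'I_r -> R) (W : 'M[C]_(n, r)) :
  herm (W *m diag_mx (\row_i (theta i)%:C) *m ctr W).
Proof. by rewrite /herm !ctrM ctrK ctr_diag mulmxA. Qed.

Lemma herm_diagD n r (x : 'I_n -> R) (theta : 'I_r -> R) (W : 'M[C]_(n, r)) :
  herm (diag_mx (\row_k (x k)%:C) + W *m diag_mx (\row_i (theta i)%:C) *m ctr W).
Proof. by rewrite /herm ctrD ctr_diag herm_congr. Qed.

(** The tolerance [e] depends on neither [n] nor [W], which is what lets a probabilistic estimate on
    the [r x r] form control eigenvalues of matrices of growing size. *)
Lemma outlier_comparison r (theta : 'I_r -> R) (W0 : 'M[C]_r) (h : R) :
  let Th := diag_mx (\row_i (theta i)%:C) : 'M[C]_r in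
  let A0 := W0 *m Th *m ctr W0 in
  (forall i, theta i != 0) -> 0 < h -> (forall x, x \in eigs A0 -> h * x != 1) ->
  exists2 e : R, 0 < e & forall n (x : 'I_n -> R) (z : R) (W : 'M[C]_(n, r)),
    (forall k, x k < z) ->
    (forall u, `|qf (ctr W *m diag_mx (\row_k ((z - x k)^-1)%:C) *m W
                     - h%:C *: (ctr W0 *m W0)) u| <= e * nsq u) ->
    forall j, (j < n)%N -> (j < r)%N ->
      (z < eig (diag_mx (\row_k (x k)%:C) + W *m Th *m ctr W) j) = (h^-1 < eig A0 j).
Proof.
move=> Th A0 th0 h0 hz.
have [|e e0 he] := @pos_perturbation R r theta W0 h th0 h0.
  rewrite det_resolvent // (inj_eq (@complexI R) _ 0) mulf_neq0 //.
    by apply/prodf_neq0 => i _; rewrite invr_eq0.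
  rewrite prodf_seq_neq0; apply/allP => y /hz /=.
  by apply: contraNN; rewrite subr_eq0 eq_sym.
exists e => // n x z W xz hW j jn jr.
have bd0 k : 0 < z - x k by rewrite subr_gt0.
have := he n (fun k => z - x k) W bd0 hW j.+1.
have -> : W *m Th *m ctr W - diag_mx (\row_i (z - x i)%:C) =
    diag_mx (\row_k (x k)%:C) + W *m Th *m ctr W - z%:C%:M.
  rewrite [in RHS]addrC addrA [in RHS]addrC; congr (_ + _).
  apply/matrixP => i k; rewrite !mxE; case: (i == k); last first.
    by rewrite !(mulr0n, oppr0, addr0, add0r).
  by rewrite !mulr1n rmorphB opprB addrC.
move=> H; apply/idP/idP.
  move=> /(eig_gtP _ (herm_diagD _ _ _) jn)/H.
  by move=> /(eig_gtP _ (herm_congr _ _) jr).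
move=> /(eig_gtP _ (herm_congr _ _) jr)/H.
by move=> /(eig_gtP _ (herm_diagD _ _ _) jn).
Qed.

(** [W0] may be singular here. If the eigenvalue exceeded some [c > 0], the inertia correspondence
    with [B = c] would produce a positive subspace of dimension [j + 1 + (r - m) > r] in dimension
    [r]. *)
Lemma eig_congr_le0 r (theta : 'I_r -> R) (W0 : 'M[C]_r) m j :
  (forall i : 'I_r, (i < m)%N -> 0 < theta i) ->
  (forall i : 'I_r, (m <= i)%N -> theta i < 0) ->
  (m <= j < r)%N ->
  eig (W0 *m diag_mx (\row_i (theta i)%:C) *m ctr W0) j <= 0.
Proof.
move=> thp thn /andP[mj jr]; rewrite leNgt; apply/negP => ej.
have th0 i : theta i != 0.
  by case: (ltnP i m) => [/thp/gt_eqF->|/thn/lt_eqF->].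
pose c := eig (W0 *m diag_mx (\row_i (theta i)%:C) *m ctr W0) j / 2.
have c0 : 0 < c by rewrite divr_gt0.
have : c < eig (W0 *m diag_mx (\row_i (theta i)%:C) *m ctr W0) j by rewrite /c; lra.
move=> /(eig_gtP _ (herm_congr _ _) jr).
have -> : (c%:C%:M : 'M[C]_r) = diag_mx (\row_(i < r) ((fun=> c) i)%:C).
  by apply/matrixP => i k; rewrite !mxE.
move=> /(schur_inertia W0 (fun=> c0) th0)/pos_dim.
have -> : #|[pred i | (theta i < 0)%R]| = (r - m)%N.
  rewrite -[r in RHS]card_ord -(cardC [pred i : 'I_r | (i < m)%N]).
  have -> : #|[pred i : 'I_r | (i < m)%N]| = m.
    have mr : (m <= r)%N by lia.
    by rewrite -sum1_card -(big_ord_widen r (fun=> 1%N) mr) sum1_card card_ord.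
  rewrite addKn; apply: eq_card => i; rewrite !inE -leqNgt.
  by case: (leqP m i) => [/thn ->//|/thp h]; rewrite ltNge ltW.
lia.
Qed.

(** Among the eigenvectors of the diagonal part above [c], those killed by [W] still span [j + 1]
    dimensions, and the perturbation vanishes on them. The bound is uniform in [theta] and [W]. *)
Lemma eig_perturbed_ge n r (x : 'I_n -> R) (theta : 'I_r -> R) (W : 'M[C]_(n, r))
    (c : R) j :
  (j.+1 + r <= #|[pred k | (c < x k)%R]|)%N ->
  c < eig (diag_mx (\row_k (x k)%:C) + W *m diag_mx (\row_i (theta i)%:C) *m ctr W) j.
Proof.
move=> hN; pose I := [pred k | c < x k].
have In : (#|I| <= n)%N by rewrite -[n in (_ <= n)%N]card_ord max_card.
have jn : (j < n)%N by apply: leq_trans In; rewrite -/I in hN; lia.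
apply/(eig_gtP _ (herm_diagD _ _ _) jn).
have [N N0 NW] := @left_kernel _ j.+1 #|I| r ((selmx R I)^T *m W) hN.
exists (N *m (selmx R I)^T) => y /N0 yN0.
rewrite qfB qfD qf_scalar qf_diag -qf_mul.
have -> : y *m (N *m (selmx R I)^T) *m W = 0.
  by rewrite -!mulmxA NW mulmx0.
have -> : qf (diag_mx (\row_i (theta i)%:C)) 0 = 0 by rewrite /qf !mul0mx mxE.
rewrite addr0 nsqE mulr_sumr -sumrB mulmxA.
have [a ya] : exists a, (y *m N) 0 a != 0.
  apply/existsP; apply: contraNT yN0 => /existsPn h.
  by apply/eqP/rowP => a; rewrite [RHS]mxE; apply/eqP; rewrite -[_ == _]negbK h.
rewrite (bigD1 (enum_val a)) //=; apply: ltr_wpDr.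
  apply: sumr_ge0 => i _; rewrite -mulrBl.
  have [Ii|Ii] := boolP (I i).
    by rewrite mulr_ge0 ?abs2_ge0 // subr_ge0 ltW.
  by rewrite mulmx_trsel0 // /abs2 /= expr0n /= addr0 mulr0.
rewrite mulmx_trsel -mulrBl mulr_gt0 ?subr_gt0 //.
  by have := enum_valP a.
by rewrite lt_neqAle abs2_ge0 eq_sym abs2_eq0 ya.
Qed.

Lemma spectral_diag_mx n (x : 'I_n -> R) :
  spectral (diag_mx (\row_k (x k)%:C)) 1%:M x.
Proof. by split; rewrite ctr1 ?mul1mx ?mulmx1. Qed.

(** The diagonal entries carry no ordering, so the bound is needed for every index. *)
Lemma eig_diag_ge n (x : 'I_n -> R) k : x k <= eig (diag_mx (\row_k (x k)%:C)) 0.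
Proof.
have hD : herm (diag_mx (\row_k (x k)%:C)) by exact: ctr_diag.
rewrite leNgt; apply/negP => h.
pose U := [pred i | (eig (diag_mx (\row_k (x k)%:C)) 0 < x i)%R].
have : pos 1 (diag_mx (\row_k (x k)%:C) -
   (eig (diag_mx (\row_k (x k)%:C)) 0)%:C%:M).
  apply/(pos_spectral (spectral_diag_mx x)).
  by apply/card_gt0P; exists k; rewrite inE.
move=> /(eig_gtP _ hD (leq_ltn_trans (leq0n _) (ltn_ord k))).
by rewrite ltxx.
Qed.

Lemma psd_sqrt n (A : 'M[C]_n) : herm A -> (forall v, 0 <= qf A v) ->
  exists W : 'M[C]_n, A = ctr W *m W.
Proof.
move=> hA pA; have [U [d spA]] := spectral_exists hA.
have d0 i : 0 <= d i.
  rewrite leNgt; apply/negP => di.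
  have : (1 <= #|[pred i | (0 < - d i)%R]|)%N.
    by apply/card_gt0P; exists i; rewrite inE oppr_gt0.
  move=> /(above_subspace (spectral_opp spA))[V hV].
  have /hV : const_mx 1 != 0 :> 'rV[C]_1.
    by apply/negP => /eqP/rowP/(_ 0); rewrite !mxE => /eqP; rewrite oner_eq0.
  by rewrite mul0r qfN oppr_gt0 ltNge pA.
exists (diag_mx (\row_i (Num.sqrt (d i))%:C) *m U).
rewrite ctrM ctr_diag -mulmxA (mulmxA (diag_mx _)) [LHS](sp_eq spA) -mulmxA.
congr (_ *m (_ *m _)); rewrite mul_diag_mx; apply/matrixP => i j; rewrite !mxE.
case: (eqVneq i j) => [->|]; rewrite ?mulr1n ?mulr0n ?mulr0 //.
by rewrite -rmorphM /= -expr2 sqr_sqrtr.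
Qed.

Lemma pd_lower_bound n (A : 'M[C]_n) : herm A -> (forall v, v != 0 -> 0 < qf A v) ->
  exists2 c : R, 0 < c & forall v, c * nsq v <= qf A v.
Proof.
move=> hA pA; have [U [d spA]] := spectral_exists hA.
have d0 i : 0 < d i.
  rewrite ltNge; apply/negP => di.
  pose v : 'rV[C]_n := delta_mx 0 i *m U.
  have vU : v *m ctr U = delta_mx 0 i by rewrite -mulmxA (sp_unitary spA) mulmx1.
  have /pA : v != 0.
    apply/eqP => v0; have := congr1 (fun M : 'rV[C]_n => M 0 i) vU.
    by rewrite v0 mul0mx !mxE !eqxx => /eqP; rewrite eq_sym oner_eq0.
  rewrite (qf_spectral spA) ltNge vU => /negP; apply.
  apply: sumr_le0 => j _; rewrite mxE eqxx /=.
  case: eqVneq => [->|_]; last by rewrite /abs2 /= expr0n /= addr0 mulr0.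
  by rewrite mulr_le0_ge0 ?abs2_ge0.
have [e e0 he] := finite_lower_bound d0.
exists e => // v; rewrite (qf_spectral spA) (nsq_spectral spA) mulr_sumr.
by apply: ler_sum => i _; rewrite ler_wpM2r ?abs2_ge0 // ltW.
Qed.

(** Each entry contributes at most [e * (abs2 (v i) + abs2 (v j))], its real and imaginary parts
    giving one half each; the double sum is [2 * n * e * nsq v]. *)
Lemma qf_entry_bound n (E : 'M[C]_n) (e : R) :
  (forall i j, `|complex.Re (E i j)| <= e /\ `|complex.Im (E i j)| <= e) ->
  forall v, `|qf E v| <= (2 * n%:R * e) * nsq v.
Proof.
move=> hE v.
have -> : qf E v = \sum_j \sum_i complex.Re (v 0 i * E i j * conjc (v 0 j)).
  rewrite /qf mxE raddf_sum; apply: eq_bigr => j _.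
  rewrite mxE mulr_suml raddf_sum; apply: eq_bigr => i _.
  by rewrite !mxE.
apply: (le_trans (ler_norm_sum _ _ _)).
have -> : 2 * n%:R * e * nsq v =
    \sum_(j < n) \sum_(i < n) e * (abs2 (v 0 i) + abs2 (v 0 j)).
  under eq_bigr => j _ do rewrite -mulr_sumr big_split /= sumr_const card_ord.
  rewrite -mulr_sumr big_split /= sumr_const card_ord sumrMnl -!nsqE.
  by rewrite mulr_natl; ring.
apply: ler_sum => j _; apply: (le_trans (ler_norm_sum _ _ _)).
apply: ler_sum => i _; have [] := hE i j; case: (E i j) => p q /=.
case: (v 0 i) => a b; case: (v 0 j) => a' b'; rewrite /abs2 /= => hp hq.
rewrite (_ : _ - _ = (a * a' + b * b') * p + (a * b' - b * a') * q); last by ring.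
apply: (le_trans (ler_normD _ _)); rewrite !normrM.
have h1 : `|a * a' + b * b'| <= (a ^+ 2 + b ^+ 2 + (a' ^+ 2 + b' ^+ 2)) / 2.
  have := sqr_ge0 (a + a'); have := sqr_ge0 (a - a').
  have := sqr_ge0 (b + b'); have := sqr_ge0 (b - b').
  by rewrite ler_norml !expr2 => *; apply/andP; split; lra.
have h2 : `|a * b' - b * a'| <= (a ^+ 2 + b ^+ 2 + (a' ^+ 2 + b' ^+ 2)) / 2.
  have := sqr_ge0 (a + b'); have := sqr_ge0 (a - b').
  have := sqr_ge0 (b + a'); have := sqr_ge0 (b - a').
  by rewrite ler_norml !expr2 => *; apply/andP; split; lra.
have := ler_pM (normr_ge0 _) (normr_ge0 _) h1 hp.
have := ler_pM (normr_ge0 _) (normr_ge0 _) h2 hq.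
lra.
Qed.

(** This makes [[set A | c < eig A j]] open among Hermitian matrices, which is the source of
    measurability of eigenvalues. *)
Lemma eig_gt_stable n (A : 'M[C]_n) (c : R) j : herm A -> (j < n)%N -> c < eig A j ->
  exists2 e : R, 0 < e & forall E : 'M[C]_n, herm E ->
    (forall v, `|qf E v| <= e * nsq v) -> c < eig (A + E) j.
Proof.
move=> hA jn cA; pose e := (eig A j - c) / 2.
have e0 : 0 < e by rewrite divr_gt0 ?subr_gt0.
exists e; first exact: e0.
move=> E hE bE; have hAE : herm (A + E) by rewrite /herm ctrD hA hE.
have : c + e < eig A j by rewrite /e; lra.
move=> /(eig_gtP _ hA jn)[V hV]; apply/(eig_gtP _ hAE jn); exists V => y /hV.
rewrite !qfB !qf_scalar qfD; have := bE (y *m V); rewrite ler_norml => /andP[].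
by lra.
Qed.

End OutlierComparison.

(** * Gram-Schmidt orthonormalization *)

Section GramSchmidt.
Variable R : realType.
Local Notation C := R[i].
Implicit Types (m n p q : nat).

(** Coefficients are indexed by [nat], so that appending a vector does not change their type. *)
Definition in_span n (vs : seq 'cV[C]_n) (v : 'cV[C]_n) :=
  exists c : nat -> C, v = \sum_(j < size vs) c j *: nth 0 vs j.

Definition lin_indep n (vs : seq 'cV[C]_n) :=
  forall c : nat -> C, \sum_(j < size vs) c j *: nth 0 vs j = 0 ->
    forall j, (j < size vs)%N -> c j = 0.

Lemma in_spanD n (vs : seq 'cV[C]_n) u v :
  in_span vs u -> in_span vs v -> in_span vs (u + v).
Proof.
move=> [c ->] [e ->]; exists (fun j => c j + e j).
by rewrite -big_split; apply: eq_bigr => j _; rewrite scalerDl.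
Qed.

Lemma in_spanZ n (vs : seq 'cV[C]_n) a v : in_span vs v -> in_span vs (a *: v).
Proof.
move=> [c ->]; exists (fun j => a * c j).
by rewrite scaler_sumr; apply: eq_bigr => j _; rewrite scalerA.
Qed.

Lemma in_span_sum n (vs us : seq 'cV[C]_n) (a : 'cV[C]_n -> C) :
  (forall u, u \in us -> in_span vs u) -> in_span vs (\sum_(u <- us) a u *: u).
Proof.
elim: us => [_|u us IH h].
  exists (fun=> 0); rewrite big_nil big1 // => j _; exact: scale0r.
rewrite big_cons; apply: in_spanD.
  by apply: in_spanZ; apply: h; rewrite mem_head.
by apply: IH => v vus; apply: h; rewrite inE vus orbT.
Qed.

Lemma in_span_rcons n (vs : seq 'cV[C]_n) v u :
  in_span vs u -> in_span (rcons vs v) u.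
Proof.
move=> [c ->]; exists (fun j => if (j < size vs)%N then c j else 0).
rewrite size_rcons big_ord_recr /= ltnn scale0r addr0.
by apply: eq_bigr => j _; rewrite ltn_ord nth_rcons ltn_ord.
Qed.

Lemma in_span_last n (vs : seq 'cV[C]_n) v : in_span (rcons vs v) v.
Proof.
exists (fun j => (j == size vs)%:R); rewrite size_rcons big_ord_recr /= eqxx.
rewrite nth_rcons ltnn eqxx scale1r big1 ?add0r // => j _.
by rewrite ltn_eqF // scale0r.
Qed.

Lemma lin_indep_rcons n (vs : seq 'cV[C]_n) v :
  lin_indep (rcons vs v) -> lin_indep vs /\ ~ in_span vs v.
Proof.
move=> h; split=> [c c0 j jvs|[c vE]].
  have := h (fun j => if (j < size vs)%N then c j else 0).
  rewrite size_rcons big_ord_recr /= ltnn scale0r addr0.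
  under eq_bigr => i _ do rewrite ltn_ord nth_rcons ltn_ord.
  by move=> /(_ c0 j); rewrite jvs; apply; exact: ltnW.
have := h (fun j => if (j < size vs)%N then c j else -1).
rewrite size_rcons big_ord_recr /= ltnn nth_rcons ltnn eqxx scaleN1r.
under eq_bigr => i _ do rewrite ltn_ord nth_rcons ltn_ord.
rewrite -vE subrr => /(_ erefl (size vs) (ltnSn _)); rewrite ltnn.
by move/eqP; rewrite oppr_eq0 oner_eq0.
Qed.

Definition colip n (u v : 'cV[C]_n) : C := (ctr u *m v) 0 0.

Lemma cvnorm_sqr n (v : 'cV[C]_n) : colip v v = (cvnorm v ^+ 2)%:C.
Proof.
rewrite /cvnorm sqr_sqrtr; last first.
  by rewrite sumr_ge0 // => k _; rewrite addr_ge0 ?sqr_ge0.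
rewrite /colip mxE rmorph_sum; apply: eq_bigr => k _.
by rewrite !mxE mulrC mul_conj_abs2.
Qed.

Lemma cvnorm_eq0 n (v : 'cV[C]_n) : cvnorm v = 0 -> v = 0.
Proof.
move=> /eqP; rewrite /cvnorm sqrtr_eq0 => h; apply/colP => k; rewrite mxE.
apply/eqP; rewrite -abs2_eq0 eq_le abs2_ge0 andbT (le_trans _ h) //.
rewrite (bigD1 k) //= lerDl sumr_ge0 // => i _; exact: abs2_ge0.
Qed.

Lemma colipB n (u v w : 'cV[C]_n) : colip u (v - w) = colip u v - colip u w.
Proof. by rewrite /colip mulmxBr !mxE. Qed.

Lemma colipZ n a (u v : 'cV[C]_n) : colip u (a *: v) = a * colip u v.
Proof. by rewrite /colip -scalemxAr mxE. Qed.

Lemma colip_sum n (u : 'cV[C]_n) (us : seq 'cV[C]_n) (a : 'cV[C]_n -> C) :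
  colip u (\sum_(v <- us) a v *: v) = \sum_(v <- us) a v * colip u v.
Proof.
elim: us => [|v us IH]; first by rewrite !big_nil /colip mulmx0 mxE.
rewrite !big_cons -IH -colipZ /colip mulmxDr.
by rewrite [LHS]mxE.
Qed.

Lemma colipC n (u v : 'cV[C]_n) : colip u v = conjc (colip v u).
Proof.
have -> : colip u v = ctr (ctr v *m u) 0 0 by rewrite ctrM ctrK.
by rewrite [LHS]mxE [LHS]mxE.
Qed.

Lemma colipZl n a (u v : 'cV[C]_n) : colip (a *: u) v = conjc a * colip u v.
Proof. by rewrite colipC colipZ rmorphM /= -colipC. Qed.

Definition orthonormal n (us : seq 'cV[C]_n) :=
  forall i j, (i < size us)%N -> (j < size us)%N ->
    colip (nth 0 us i) (nth 0 us j) = (i == j)%:R.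

Lemma gram_schmidt_rcons n (vs : seq 'cV[C]_n) v :
  gram_schmidt (rcons vs v) = rcons (gram_schmidt vs) (gs_step (gram_schmidt vs) v).
Proof. by rewrite /gram_schmidt foldl_rcons. Qed.

Lemma size_gram_schmidt n (vs : seq 'cV[C]_n) : size (gram_schmidt vs) = size vs.
Proof.
by elim/last_ind: vs => // vs v IH; rewrite gram_schmidt_rcons !size_rcons IH.
Qed.

(** The span statement is carried along in the induction: it is what turns a vanishing residual into
    a linear dependence. *)
Lemma gram_schmidtP n (vs : seq 'cV[C]_n) : lin_indep vs ->
  orthonormal (gram_schmidt vs) /\
  (forall u, u \in gram_schmidt vs -> in_span vs u).
Proof.
elim/last_ind: vs => [_|vs v IH /lin_indep_rcons[/IH[on sp] vN]].
  by split=> // u; rewrite in_nil.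
rewrite gram_schmidt_rcons; set us := gram_schmidt vs in on sp *.
pose w := v - \sum_(u <- us) ((ctr u *m v) 0 0) *: u.
have spw : in_span (rcons vs v) w.
  apply: in_spanD; first exact: in_span_last.
  rewrite -scaleN1r; apply: in_spanZ; apply: in_span_rcons.
  exact: (@in_span_sum _ _ _ (fun u => (ctr u *m v) 0 0)).
(* A zero residual would put [v] in the span of the previous vectors, against independence; this
   legitimates the division in [gs_step]. *)
have w0 : cvnorm w != 0.
  apply: contra_notN vN => /eqP/cvnorm_eq0/eqP; rewrite subr_eq0 => /eqP ->.
  exact: (@in_span_sum _ _ _ (fun u => (ctr u *m v) 0 0)).
have ow j : (j < size us)%N -> colip (nth 0 us j) w = 0.
  move=> js; rewrite colipB (colip_sum _ _ (fun u => colip u v)).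
  rewrite (big_nth 0) big_mkord (bigD1 (Ordinal js)) //= on // eqxx mulr1.
  rewrite big1 ?addr0 ?subrr // => i ij; rewrite on //.
  rewrite (_ : (j == i :> nat) = false) ?mulr0 //.
  by apply/negbTE; apply: contraNneq ij => ji; apply/eqP/val_inj.
have gE : gs_step us v = ((cvnorm w)^-1)%:C *: w by [].
split; last first.
  move=> u; rewrite mem_rcons inE => /predU1P[->|/sp].
    by rewrite gE; exact: in_spanZ.
  exact: in_span_rcons.
move=> i j; rewrite size_rcons !ltnS !nth_rcons => iu ju.
case: (ltngtP i (size us)) iu => // [iu _|iE _]; case: (ltngtP j (size us)) ju => // [ju _|jE _]; rewrite ?iE ?jE.
- exact: on.
- by rewrite gE colipZ ow // mulr0 ltn_eqF.
- by rewrite gE colipZl colipC ow // conjc0 mulr0 gtn_eqF.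
rewrite gE colipZ colipZl cvnorm_sqr conj_RC -!rmorphM eqxx /=.
by rewrite (_ : _ * (_ * _) = 1) //; field; exact: w0.
Qed.

(** Only the existence of the change of basis [T] matters below, so its triangular shape is not
    recorded. *)
Lemma gram_schmidt_mx n r (Gv : 'I_r -> 'cV[C]_n) :
  let G : 'M[C]_(n, r) := \matrix_(k, i) Gv i k 0 in
  let U : 'M[C]_(n, r) :=
    \matrix_(k, i) (nth 0 (gram_schmidt [seq Gv j | j <- enum 'I_r]) i) k 0 in
  (forall u : 'cV[C]_r, G *m u = 0 -> u = 0) ->
  ctr U *m U = 1%:M /\ exists T : 'M[C]_r, U = G *m T.
Proof.
move=> G U Ginj; set vs := [seq Gv j | j <- enum 'I_r] in U *.
have svs : size vs = r by rewrite size_map size_enum_ord.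
have nvs (j : 'I_r) : nth 0 vs j = Gv j.
  by rewrite (nth_map j) ?size_enum_ord // nth_ord_enum.
have combE (c : nat -> C) :
    \sum_(j < size vs) c j *: nth 0 vs j = G *m (\col_(j < r) c j).
  apply/colP => k; rewrite summxE mxE svs.
  by apply: eq_bigr => j _; rewrite nvs !mxE mulrC.
have ind : lin_indep vs.
  move=> c; rewrite combE => /Ginj /colP c0 j; rewrite svs => jr.
  by have := c0 (Ordinal jr); rewrite !mxE.
have [on sp] := gram_schmidtP ind.
have sg : size (gram_schmidt vs) = r by rewrite size_gram_schmidt.
split.
  apply/matrixP => i j; have := on i j; rewrite sg => /(_ (ltn_ord i) (ltn_ord j)).
  move=> eij; rewrite [RHS]mxE -[RHS]eij /colip !mxE.
  by apply: eq_bigr => k _; rewrite !mxE.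
have /(_ _)/cid T (i : 'I_r) : exists c : nat -> C,
    nth 0 (gram_schmidt vs) i = G *m (\col_(j < r) c j).
  have [|c cE] := sp (nth 0 (gram_schmidt vs) i); first by rewrite mem_nth ?sg.
  by exists c; rewrite -combE.
exists (\matrix_(j, i) projT1 (T i) j).
apply/matrixP => k i; rewrite mxE (projT2 (T i)) !mxE.
by apply: eq_bigr => j _; rewrite !mxE.
Qed.

Lemma sum_outer n r (theta : 'I_r -> R) (c : 'I_r -> 'cV[C]_n) :
  let M : 'M[C]_(n, r) := \matrix_(k, i) c i k 0 in
  \sum_i (theta i)%:C *: (c i *m ctr (c i)) =
  M *m diag_mx (\row_i (theta i)%:C) *m ctr M.
Proof.
move=> M; apply/matrixP => k l; rewrite summxE mul_mx_diag mxE.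
by apply: eq_bigr => i _; rewrite !mxE big_ord1 !mxE mulrCA mulrA.
Qed.

(** The error for [U] at [u] is the error for [G] at [u *m ctr T]. Since [ctr U *m U = 1], the Gram
    form of [G] at that vector is [nsq u], so its squared norm is at most [nsq u / c]. *)
Lemma orthonormal_close n r (x : 'I_n -> C) (G : 'M[C]_(n, r)) (T : 'M[C]_r)
    (h e c : R) :
  let U := G *m T in
  ctr U *m U = 1%:M -> 0 < c -> (forall u, c * nsq u <= qf (ctr G *m G) u) -> 0 <= e ->
  (forall u, `|qf (ctr G *m diag_mx (\row_k x k) *m G - h%:C *: (ctr G *m G)) u|
     <= e * nsq u) ->
  forall u, `|qf (ctr U *m diag_mx (\row_k x k) *m U - h%:C *: (ctr (1%:M : 'M[C]_r) *m 1%:M)) u|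
     <= e / c * nsq u.
Proof.
move=> U UU c0 hc e0 he u.
have -> : ctr U *m diag_mx (\row_k x k) *m U - h%:C *: (ctr (1%:M : 'M[C]_r) *m 1%:M) =
    ctr T *m (ctr G *m diag_mx (\row_k x k) *m G - h%:C *: (ctr G *m G)) *m ctr (ctr T).
  rewrite ctr1 mulmx1 -UU ctrK mulmxBr mulmxBl -scalemxAr -scalemxAl.
  by rewrite /U ctrM !mulmxA.
rewrite -qf_mul; apply: (le_trans (he _)); rewrite -mulrA ler_wpM2l //.
rewrite ler_pdivlMl // (le_trans (hc _)) // qf_mul ctrK.
rewrite (_ : _ *m _ *m T = 1%:M); last by rewrite -UU /U ctrM !mulmxA.
by rewrite /qf mulmx1.
Qed.

End GramSchmidt.

(** * The limiting polynomial *)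

Section Polynomial.
Variable R : realType.
Local Notation C := R[i].
Implicit Types (m n p q : nat).

Lemma entE r (Cm : 'M[C]_r) (i j : 'I_r) : ent Cm i j = Cm i j.
Proof. by rewrite /ent !valK. Qed.

Lemma qf_gt0_unit n (A : 'M[C]_n) : (forall v, v != 0 -> 0 < qf A v) -> \det A != 0.
Proof.
move=> pA; apply/det0P => -[v v0 vA].
by have := pA v v0; rewrite /qf vA mul0mx mxE ltxx.
Qed.

(** A leading block is the restriction of the form to a coordinate subspace, hence again positive
    definite. *)
Lemma qcoef_neq0 r (Cm : 'M[C]_r) (i : 'I_r) :
  (forall v, v != 0 -> 0 < qf Cm v) -> qcoef Cm i != 0.
Proof.
move=> pC; apply: qf_gt0_unit => v v0.
have ir : (i <= r)%N := ltnW (ltn_ord i).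
pose E : 'M[C]_(i, r) := \matrix_(k, l) (l == widen_ord ir k)%:R.
have inj : injective (widen_ord ir) by move=> a b /(congr1 val) /= /val_inj.
have rE q (X : 'M[C]_(r, q)) k l : (E *m X) k l = X (widen_ord ir k) l.
  rewrite mxE (bigD1 (widen_ord ir k)) //= mxE eqxx mul1r big1 ?addr0 //.
  by move=> j /negPf jk; rewrite mxE jk mul0r.
have cE q (X : 'M[C]_(q, r)) k l : (X *m ctr E) k l = X k (widen_ord ir l).
  rewrite mxE (bigD1 (widen_ord ir l)) //= !mxE eqxx conjc1 mulr1 big1 ?addr0 //.
  by move=> j /negPf jk; rewrite !mxE jk conjc0 mulr0.
have ME : mxf i (ent Cm) = E *m Cm *m ctr E.
  by apply/matrixP => k l; rewrite cE rE mxE -entE.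
rewrite ME -qf_mul; apply: pC; apply: contraNneq v0 => vE.
apply/eqP/rowP => k; have := congr1 (fun M : 'rV[C]_r => M 0 (widen_ord ir k)) vE.
rewrite !mxE (bigD1 k) //= !mxE eqxx mulr1 big1 ?addr0 // => j /negPf jk.
by rewrite !mxE (inj_eq inj) eq_sym jk mulr0.
Qed.

(* Column [i] of [F] is, by Cramer's rule, [det M] times the Gram-Schmidt
   combination, [M] being the leading block of [Cm]. *)
Lemma Fmx_orth r (Cm : 'M[C]_r) (k i : 'I_r) : (k < i)%N -> (Cm *m Fmx Cm) k i = 0.
Proof.
move=> ki; pose M := mxf i (ent Cm); pose b l := ent Cm l i.
have gam (j : 'I_i) : \det (gammamx Cm j i) = - \sum_l \adj M j l * b l.
  rewrite (expand_det_col _ j) -sumrN; apply: eq_bigr => l _.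
  rewrite [X in X * _]mxE [in RHS]mxE eqxx mulrC mulrN; congr (- (_ * _)).
  rewrite /cofactor; congr (_ * \det _); apply/matrixP => p q; rewrite !mxE.
  by rewrite (inj_eq val_inj) eq_sym (negPf (neq_lift _ _)).
have ir : (i <= r)%N := ltnW (ltn_ord i).
have -> : (Cm *m Fmx Cm) k i =
    \sum_(j < i) ent Cm k j * \det (gammamx Cm j i) + ent Cm k i * qcoef Cm i.
  rewrite mxE; pose G (j : nat) : C := ent Cm k j *
    (if j == i then qcoef Cm i else if (j < i)%N then \det (gammamx Cm j i) else 0).
  transitivity (\sum_(j < r) G j).
    by apply: eq_bigr => j _; rewrite !mxE /G entE.
  rewrite -(big_mkord xpredT G) (big_cat_nat _ (n := i.+1)) //=; last first.
  rewrite big_nat_recr //= [X in _ + X]big_nat_cond [X in _ + X]big1 ?addr0.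
    rewrite [G i]/G eqxx big_mkord; congr (_ + _).
    by apply: eq_bigr => j _; rewrite /G ltn_eqF ?ltn_ord // ltn_ord.
  by move=> j /andP[/andP[ij _] _]; rewrite /G gtn_eqF // ltnNge (ltnW ij) mulr0.
under eq_bigr => j _ do rewrite gam mulrN mulr_sumr.
rewrite sumrN exchange_big /=.
pose k' : 'I_i := Ordinal ki.
have -> : \sum_(l < i) \sum_(j < i) ent Cm k j * (\adj M j l * b l) =
    \sum_(l < i) (M *m \adj M) k' l * b l.
  apply: eq_bigr => l _; rewrite mxE mulr_suml; apply: eq_bigr => j _.
  by rewrite !mxE mulrA.
rewrite mul_mx_adj (bigD1 k') //= big1 => [|l /negPf lk].
  by rewrite mxE eqxx mulr1n addr0 /qcoef mulrC addrC subrr.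
by rewrite mxE eq_sym lk mulr0n mul0r.
Qed.

(** [F] is upper triangular and [Cm *m F] vanishes above the diagonal, so the product has no entries
    above the diagonal; Hermitian symmetry removes those below. Positivity of [D i] uses
    [F i i = qcoef Cm i], which is nonzero. *)
Lemma Fmx_diag r (Cm : 'M[C]_r) : herm Cm -> (forall v, v != 0 -> 0 < qf Cm v) ->
  exists2 D : 'I_r -> R, (forall i, 0 < D i) &
    ctr (Fmx Cm) *m Cm *m Fmx Cm = diag_mx (\row_i (D i)%:C).
Proof.
move=> hC pC; set F := Fmx Cm; set A := ctr F *m Cm *m F.
have hA : herm A by rewrite /herm /A !ctrM ctrK hC mulmxA.
have up (l i : 'I_r) : (l < i)%N -> A l i = 0.
  move=> li; rewrite /A -mulmxA mxE big1 // => k _.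
  have [kl|lk] := leqP k l.
    by rewrite Fmx_orth ?mulr0 // (leq_ltn_trans kl).
  have Fkl : F k l = 0.
    by rewrite mxE -val_eqE /= gtn_eqF // ltnNge (ltnW lk).
  have -> : ctr F l k = 0 by rewrite [LHS]mxE [LHS]mxE Fkl conjc0.
  exact: mul0r.
have offdiag l i : l != i -> A l i = 0.
  rewrite -(inj_eq val_inj) neq_ltn => /orP[/up //|il].
  by rewrite -hA [LHS]mxE [LHS]mxE up // conjc0.
pose e i : 'rV[C]_r := delta_mx 0 i.
have qA i : qf A (e i) = complex.Re (A i i).
  have ce : ctr (e i) = delta_mx i 0.
    by apply/matrixP => k l; rewrite !mxE andbC conjc_nat.
  by rewrite /qf ce -rowE -colE mxE [X in complex.Re X]mxE.
exists (fun i => complex.Re (A i i)) => [i|].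
  rewrite -qA /A -{2}(ctrK F) -qf_mul; apply: (pC).
  apply/eqP => /(congr1 (fun M : 'rV[C]_r => M 0 i)).
  rewrite -rowE [LHS]mxE [LHS]mxE [LHS]mxE [F i i]mxE eqxx [RHS]mxE => /eqP.
  by rewrite conjc_eq0 (negPf (qcoef_neq0 i pC)).
apply/matrixP => i j; rewrite [RHS]mxE [X in _ = X *+ _]mxE; case: eqVneq => [<-|/offdiag ->//].
rewrite mulr1n; apply/eqP; rewrite eq_complex /= eqxx /=.
have := congr1 (fun M : 'M[C]_r => complex.Im (M i i)) hA.
rewrite [X in complex.Im X]mxE [X in complex.Im X]mxE.
by case: (A i i) => u v /=; lra.
Qed.

Lemma prod_eigs n (A U : 'M[C]_n) d (f : R -> R) : spectral A U d ->
  \prod_(x <- eigs A) f x = \prod_i f (d i).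
Proof. by move=> spA; rewrite (perm_big _ (perm_eigs spA)) big_map big_enum. Qed.

(** In the orthonormalized model [F] diagonalizes [Cm] and the factors [D i] come out as constants,
    so the covariance disappears and [W0 = 1]. In the i.i.d. model [Cm] may be degenerate, and only
    a factorization [ctr W0 *m W0] is used. *)
Lemma Ppoly_factor (M : model) r (theta : 'I_r -> R) (Cm : 'M[C]_r) :
  (forall i, theta i != 0) -> herm Cm -> (forall v, 0 <= qf Cm v) ->
  (M = Orthmodel -> forall v, v != 0 -> 0 < qf Cm v) ->
  exists (W0 : 'M[C]_r) (c : R), [/\ c != 0,
    forall h, complex.Re (Ppoly M theta (h%:C *: Cm) Cm) =
      c * \prod_(x <- eigs (W0 *m diag_mx (\row_i (theta i)%:C) *m ctr W0)) (1 - h * x) &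
    if M is IIDmodel then Cm = ctr W0 *m W0 else W0 = 1%:M].
Proof.
move=> th0 hC pC; case: M => [_|/(_ erefl) ppC].
  have [W0 CE] := psd_sqrt hC pC.
  exists W0, (\prod_i (theta i)^-1); split=> // [|h].
    by apply/prodf_neq0 => i _; rewrite invr_eq0.
  by rewrite /= {1}CE det_resolvent.
have [D D0 FE] := Fmx_diag hC ppC.
exists 1%:M, (\prod_i (D i / theta i)); split=> // [|h].
  by apply/prodf_neq0 => i _; rewrite mulf_neq0 ?invr_eq0 // gt_eqF.
rewrite ctr1 mul1mx mulmx1 (prod_eigs _ (spectral_diag_mx theta)) /=.
rewrite -scalemxAr -scalemxAl FE -big_split /=.
have -> : diag_mx (\row_i (((theta i)^-1)%:C * diag_mx (\row_i0 (D i0)%:C) i i)) -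
    h%:C *: diag_mx (\row_i (D i)%:C) =
    diag_mx (\row_i ((D i / theta i) * (1 - h * theta i))%:C) :> 'M[C]_r.
  apply/matrixP => i j; rewrite !mxE eqxx mulr1n; case: (eqVneq i j) => [->|_].
    rewrite !mulr1n -!rmorphM -rmorphB /=; congr (_%:C).
    by field; exact: th0.
  by rewrite !mulr0n mulr0 subr0.
rewrite det_diag; under eq_bigr => i _ do rewrite mxE.
by rewrite -rmorph_prod.
Qed.

End Polynomial.

(** * Exponential concentration of i.i.d. sums *)

Section ProductExpectation.
Local Open Scope ereal_scope.
Context {R : realType} d (Omega : measurableType d) d' (T : measurableType d').
Variable P : probability Omega R.
Import HBNNSimple.

Lemma nnsfun_sum_indic (phi : {nnsfun T >-> R}) :
  exists (N : nat) (c : 'I_N -> R) (A : 'I_N -> set T),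
    [/\ forall i, (0 <= c i)%R, forall i, measurable (A i) &
        forall x, phi x = (\sum_i c i * \1_(A i) x)%R].
Proof.
pose s := fset_set (phi @` setT).
exists #|`s|%fset, (fun i => s`_i), (fun i => phi @^-1` [set s`_i]); split=> [i|i|x].
- have : s`_i \in s by rewrite mem_nth.
  by rewrite in_fset_set // => /set_mem[x _ <-].
- by rewrite -[X in measurable X]setTI; exact: measurable_funP.
- exact: fimfunEord.
Qed.

(** Independence passes from indicators to simple functions by linearity, and to nonnegative
    functions by monotone convergence. Taking [B = setT] shows that [c] is the expectation of
    [F]. *)
Lemma integral_mul_comp (F : Omega -> R) (Z : Omega -> T) (c : \bar R) (f : T -> R) :
  measurable_fun setT F -> (forall w, 0 <= F w)%R -> measurable_fun setT Z ->
  c \is a fin_num ->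
  (forall B, measurable B ->
    \int[P]_w (F w * \1_(Z @^-1` B) w)%:E = c * P (Z @^-1` B)) ->
  measurable_fun setT f -> (forall x, 0 <= f x)%R ->
  \int[P]_w (F w * f (Z w))%:E = c * \int[P]_w (f (Z w))%:E.
Proof.
move=> mF F0 mZ cfin hB mf f0.
have mfE : measurable_fun setT (EFin \o f : T -> \bar R) by exact/measurable_EFinP.
pose phi := nnsfun_approx measurableT mfE.
have mpre (A : set T) : measurable A -> measurable (Z @^-1` A).
  by move=> mA; rewrite -[X in measurable X]setTI; exact: mZ.
have mphi n : measurable_fun setT (fun w => phi n (Z w)).
  exact: (measurableT_comp _ mZ).
have step n : \int[P]_w (F w * phi n (Z w))%:E = c * \int[P]_w (phi n (Z w))%:E.
  have [N [a [A [a0 mA phiE]]]] := nnsfun_sum_indic (phi n).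
  have mI i : measurable_fun setT (\1_(Z @^-1` A i) : Omega -> R).
    by apply: measurable_indic; exact: mpre.
  transitivity (\sum_(i < N) (a i)%:E * (c * P (Z @^-1` A i))).
    transitivity (\int[P]_w \sum_(i < N) ((a i)%:E * (F w * \1_(Z @^-1` A i) w)%:E)).
      apply: eq_integral => w _; rewrite phiE mulr_sumr -sumEFin.
      by apply: eq_bigr => i _; rewrite -EFinM mulrCA.
    rewrite ge0_integral_sum //; last 2 first.
    - move=> i; apply/measurable_funeM/measurable_EFinP.
      exact: measurable_funM.
    - by move=> i w _; rewrite -EFinM lee_fin !mulr_ge0.
    apply: eq_bigr => i _; rewrite ge0_integralZl_EFin //; last 2 first.
    - by move=> w _; rewrite lee_fin mulr_ge0.
    - by apply/measurable_EFinP/measurable_funM.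
    by rewrite hB.
  transitivity (c * \int[P]_w \sum_(i < N) ((a i)%:E * (\1_(Z @^-1` A i) w)%:E)).
    rewrite ge0_integral_sum //; last 2 first.
    - by move=> i; apply/measurable_funeM/measurable_EFinP.
    - by move=> i w _; rewrite -EFinM lee_fin !mulr_ge0.
    rewrite ge0_sume_distrr; last first.
      by move=> i _; apply: integral_ge0 => w _; rewrite -EFinM lee_fin mulr_ge0.
    apply: eq_bigr => i _; rewrite ge0_integralZl_EFin //; last first.
      exact/measurable_EFinP.
    have mAi : measurable (Z @^-1` A i) by exact: mpre.
    by rewrite (integral_indic _ measurableT mAi) setIT muleCA.
  congr (_ * _); apply: eq_integral => w _; rewrite phiE -sumEFin.
  by apply: eq_bigr => i _; rewrite -EFinM.
(* Stated for general [G] so that it serves both sides, with [G = F] and [G = 1]. *)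
have mcv (G : Omega -> R) : measurable_fun setT G -> (forall w, 0 <= G w)%R ->
    \int[P]_w (G w * phi n (Z w))%:E @[n --> \oo] --> \int[P]_w (G w * f (Z w))%:E.
  move=> mG G0.
  have lE w : limn (fun n => (G w * phi n (Z w))%:E) = (G w * f (Z w))%:E.
    apply/cvg_lim => //; rewrite EFinM; under eq_fun do rewrite EFinM.
    apply: cvgeZl => //.
    by apply: (cvg_nnsfun_approx measurableT mfE) => // x _; rewrite lee_fin.
  rewrite (_ : (fun w => _) = (fun w => limn (fun n => (G w * phi n (Z w))%:E))).
    apply: cvg_monotone_convergence => //.
    - by move=> n; apply/measurable_EFinP/measurable_funM.
    - by move=> n w _; rewrite lee_fin mulr_ge0.
    - move=> w _ m n mn; rewrite lee_fin ler_wpM2l //.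
      exact/lefP/nd_nnsfun_approx.
  by apply/funext => w; rewrite lE.
have h1 := mcv F mF F0.
have h2 := mcv (fun=> 1%R) (measurable_cst _) (fun=> ler01).
have one (h : Omega -> R) : \int[P]_w (1 * h w)%:E = \int[P]_w (h w)%:E.
  by apply: eq_integral => w _; rewrite mul1r.
have h3 : c * \int[P]_w (phi n (Z w))%:E @[n --> \oo] --> c * \int[P]_w (f (Z w))%:E.
  apply: cvgeZl => //; rewrite one in h2; apply: cvg_trans h2.
  by apply: near_eq_cvg; apply: nearW => n /=; rewrite one.
apply: (cvg_unique _ h1) => //; apply: cvg_trans h3.
by apply: near_eq_cvg; apply: nearW => n /=; rewrite step.
Qed.

End ProductExpectation.

Section Independence.
Local Open Scope ereal_scope.
Context {R : realType} d (Omega : measurableType d) d' (T : measurableType d').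
Variable P : probability Omega R.
Variable Z : nat -> Omega -> T.
Hypothesis mZ : forall k, measurable_fun setT (Z k).
Hypothesis indep : forall (S : seq nat) (B : nat -> set T), uniq S ->
  (forall k, measurable (B k)) ->
  P (\bigcap_(k in [set k | k \in S]) (Z k @^-1` B k)) =
  \big[*%E/1%E]_(k <- S) P (Z k @^-1` B k).
Hypothesis ident : forall k (B : set T), measurable B ->
  P (Z k @^-1` B) = P (Z 0%N @^-1` B).

Lemma measurable_preim k (B : set T) : measurable B -> measurable (Z k @^-1` B).
Proof. by move=> mB; rewrite -[X in measurable X]setTI; exact: mZ. Qed.

Lemma integral_ident k (f : T -> R) :
  measurable_fun setT f -> (forall x, 0 <= f x)%R ->
  \int[P]_w (f (Z k w))%:E = \int[P]_w (f (Z 0%N w))%:E.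
Proof.
move=> mf f0.
have mfE : measurable_fun setT (EFin \o f : T -> \bar R) by exact/measurable_EFinP.
have pf j : \int[P]_w (f (Z j w))%:E = \int[pushforward P (Z j)]_y (f y)%:E.
  by rewrite ge0_integral_pushforward // => y _; rewrite lee_fin.
rewrite !pf; apply: eq_measure_integral => B mB _.
exact: ident.
Qed.

(** The indicator of events about later variables is what makes the induction work: the event for
    [Z n] is added to the list, and [integral_mul_comp] then replaces it by [f n]. *)
Lemma expectation_prod_indic (f : nat -> T -> R) :
  (forall k, measurable_fun setT (f k)) -> (forall k x, 0 <= f k x)%R ->
  (forall k, \int[P]_w (f k (Z k w))%:E \is a fin_num) ->
  forall n (S : seq nat) (B : nat -> set T), uniq S -> (forall k, k \in S -> n <= k)%N ->
  (forall k, measurable (B k)) ->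
  \int[P]_w ((\prod_(k < n) f k (Z k w)) *
     \1_(\bigcap_(k in [set k | k \in S]) (Z k @^-1` B k)) w)%:E =
  (\prod_(k < n) \int[P]_w (f k (Z k w))%:E) * \prod_(k <- S) P (Z k @^-1` B k).
Proof.
move=> mf f0 ffin; elim=> [|n IH] S B uS nS mB.
  have mcap : measurable (\bigcap_(k in [set k | k \in S]) (Z k @^-1` B k)).
    by apply: fin_bigcap_measurable => // k _; exact: measurable_preim.
  rewrite big_ord0 mul1e -indep // -[in RHS](setIT (\bigcap_(k in _) _)).
  rewrite -(integral_indic P measurableT mcap).
  by apply: eq_integral => w _; rewrite big_ord0 mul1r.
rewrite big_ord_recr /=.
have fin (a : 'I_n -> \bar R) : (forall i, a i \is a fin_num) ->
  \prod_(i < n) a i \is a fin_num by move=> ha; apply: prode_fin_num.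
pose F w := (\prod_(k < n) f k (Z k w) *
  \1_(\bigcap_(k in [set k | k \in S]) (Z k @^-1` B k)) w)%R.
have mcap : measurable (\bigcap_(k in [set k | k \in S]) (Z k @^-1` B k)).
  by apply: fin_bigcap_measurable => // k _; exact: measurable_preim.
transitivity (\int[P]_w (F w * f n (Z n w))%:E).
  apply: eq_integral => w _; rewrite /F big_ord_recr /=; congr (_%:E).
  by rewrite mulrAC.
rewrite (@integral_mul_comp _ _ _ _ _ _ F (Z n)
  (\prod_(k < n) \int[P]_w (f k (Z k w))%:E * \prod_(k <- S) P (Z k @^-1` B k))) //.
- by rewrite muleAC.
- apply: measurable_funM; last exact: measurable_indic.
  apply: measurable_prod => k _.
  exact: measurableT_comp.
- by move=> w; rewrite mulr_ge0 // prodr_ge0.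
- rewrite fin_numM ?fin //; apply: prode_fin_num => k _.
  exact/fin_num_measure/measurable_preim.
move=> C mC.
(* The event tested on [Z n] joins the family already imposed on [S], in which [n] does not
   occur. *)
pose B' k := if k == n then C else B k.
have nS' : n \notin S by apply/negP => /nS; rewrite ltnn.
have BB' k : k \in S -> B' k = B k.
  by rewrite /B'; case: eqP => [->|//]; rewrite (negPf nS').
have := IH (n :: S) B' _ _ _; rewrite big_cons /B' eqxx -/B'.
rewrite (eq_big_seq (fun k => P (Z k @^-1` B k))); last first.
  by move=> k kS /=; rewrite -/(B' k) BB'.
rewrite (muleC (P (Z n @^-1` C))) muleA => <- //; first last.
- by move=> k; rewrite /B'; case: eqP.
- by move=> k; rewrite inE => /predU1P[->//|/nS/ltnW].
- by rewrite /= nS'.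
apply: eq_integral => w _; rewrite /F -mulrA; congr ((_ * _)%R%:E).
transitivity (\1_((\bigcap_(k in [set k | k \in S]) (Z k @^-1` B k)) `&`
    (Z n @^-1` C)) w : R); first by rewrite indicI.
congr (\1__ w).
apply/seteqP; split=> [u [vS uC] k /=|u h].
  rewrite inE; have [-> _|kn /= kS] := eqVneq k n.
    exact: uC.
  exact: vS.
split=> [k /= kS|].
  have /= := h k; rewrite inE kS orbT => /(_ isT).
  by case: eqVneq => // kn; rewrite kn (negPf nS') in kS.
by have /= := h n; rewrite inE eqxx => /(_ isT).
Qed.

Lemma expectation_prod (f : nat -> T -> R) n :
  (forall k, measurable_fun setT (f k)) -> (forall k x, 0 <= f k x)%R ->
  (forall k, \int[P]_w (f k (Z k w))%:E \is a fin_num) ->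
  \int[P]_w (\prod_(k < n) f k (Z k w))%:E = \prod_(k < n) \int[P]_w (f k (Z k w))%:E.
Proof.
move=> mf f0 ffin.
have := @expectation_prod_indic f mf f0 ffin n [::] (fun=> setT) erefl.
rewrite big_nil mule1 => <- //.
apply: eq_integral => w _; rewrite indicE mem_set ?mulr1 //.
Qed.

End Independence.

Section ExpBound.
Variable R : realType.

(** For [x >= 0] apply [expR x <= 1 + x * expR x] twice; for [x < 0] the quadratic [1 + x + x ^+ 2]
    already suffices, because its product with [1 - x] is [1 - x ^+ 3 >= 1]. *)
Lemma expR_quadratic (x : R) : expR x <= 1 + x + x ^+ 2 * expR `|x|.
Proof.
have h1 := expR_ge1Dx x; have h2 := expR_ge1Dx (- x).
have e0 := expR_gt0 x; have ex : expR x * expR (- x) = 1.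
  by rewrite expRN mulfV // gt_eqF.
have [x0|x0] := leP 0 x.
  rewrite ger0_norm //; have : expR x * (1 - x) <= 1.
    by rewrite -[leRHS]ex ler_pM2l.
  by nra.
have h3 : 1 <= expR `|x| by rewrite -expR0 ler_expR.
have h4 : expR x * (1 - x) <= 1 by rewrite -[leRHS]ex ler_pM2l.
have h5 : expR x * (1 - x) <= (1 + x + x ^+ 2) * (1 - x) by nra.
have h6 : expR x <= 1 + x + x ^+ 2 by rewrite -(ler_pM2r (_ : 0 < 1 - x)) //; lra.
by have := sqr_ge0 x; nra.
Qed.

(** Square the inequality [a / 4 * y <= expR (a / 4 * y)]. *)
Lemma sqr_le_expR (a y : R) : 0 < a -> 0 <= y ->
  y ^+ 2 <= (16 / a ^+ 2) * expR (a / 2 * y).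
Proof.
move=> a0 y0; have h := expR_ge1Dx (a / 4 * y).
have e : expR (a / 2 * y) = expR (a / 4 * y) ^+ 2.
  by rewrite -expRM_natl; congr expR; field.
rewrite e mulrAC ler_pdivlMr ?exprn_gt0 //.
have q0 : 0 <= a / 4 * y by rewrite mulr_ge0 ?divr_ge0 // ltW.
have : (a / 4 * y) ^+ 2 <= expR (a / 4 * y) ^+ 2.
  by rewrite lerXn2r ?nnegrE ?expR_ge0 //; lra.
rewrite exprMn; have -> : (a / 4) ^+ 2 = a ^+ 2 / 16 by field.
lra.
Qed.

Lemma expR_moment (a s y W : R) : 0 < a -> `|s| <= a / 2 -> `|y| <= W ->
  expR (s * y) <= 1 + s * y + s ^+ 2 * ((16 / a ^+ 2) * expR (a * W)).
Proof.
move=> a0 sa yW; have W0 : 0 <= W by exact: le_trans yW.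
apply: (le_trans (expR_quadratic _)); rewrite lerD2l exprMn -[leLHS]mulrA.
rewrite ler_wpM2l ?sqr_ge0 //.
have y2 : y ^+ 2 <= 16 / a ^+ 2 * expR (a / 2 * W).
  apply: (le_trans _ (sqr_le_expR a0 W0)).
  by rewrite -(real_normK (num_real y)) lerXn2r ?nnegrE.
have sy : expR `|s * y| <= expR (a / 2 * W).
  by rewrite ler_expR normrM ler_pM.
have -> : expR (a * W) = expR (a / 2 * W) * expR (a / 2 * W).
  by rewrite -expRD; congr expR; field.
by rewrite mulrA ler_pM ?sqr_ge0 ?expR_ge0.
Qed.

End ExpBound.

Section Chernoff.
Local Open Scope ereal_scope.
Context {R : realType} d (Omega : measurableType d) d' (T : measurableType d').
Variable P : probability Omega R.
Variable Z : nat -> Omega -> T.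
Hypothesis mZ : forall k, measurable_fun setT (Z k).
Hypothesis indep : forall (S : seq nat) (B : nat -> set T), uniq S ->
  (forall k, measurable (B k)) ->
  P (\bigcap_(k in [set k | k \in S]) (Z k @^-1` B k)) =
  \big[*%E/1%E]_(k <- S) P (Z k @^-1` B k).
Hypothesis ident : forall k (B : set T), measurable B ->
  P (Z k @^-1` B) = P (Z 0%N @^-1` B).
Variables (psi N : T -> R) (alpha : R).
Hypothesis mpsi : measurable_fun setT psi.
Hypothesis mN : measurable_fun setT N.
Hypothesis psiN : forall x, (`|psi x| <= N x)%R.
Hypothesis alpha_gt0 : (0 < alpha)%R.
Hypothesis expN : \int[P]_w (expR (alpha * N (Z 0%N w)))%:E < +oo.

Let c : R := Rintegral P setT (fun w => psi (Z 0%N w)).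

Lemma integrable_expN (b : R) :
  P.-integrable setT (fun w => (expR (alpha * (N (Z 0%N w) + b)))%:E).
Proof.
have mm (e : R) : measurable_fun setT (fun w => expR (alpha * (N (Z 0%N w) + e))).
  apply: measurableT_comp => //; apply: measurable_funM => //.
  by apply: measurable_funD => //; exact: measurableT_comp.
have i0 : P.-integrable setT (fun w => (expR (alpha * N (Z 0%N w)))%:E).
  apply/integrableP; split.
    have := mm 0%R; under eq_fun do rewrite addr0.
    by move=> h; apply/measurable_EFinP.
  by under eq_integral => w _ do rewrite gee0_abs ?lee_fin ?expR_ge0 //.
have := integrableZl measurableT (expR (alpha * b)) i0.
apply: eq_integrable => // w _ /=; rewrite -EFinM -expRD; congr (expR _)%:E.
by rewrite mulrDr addrC.
Qed.

Lemma integrable_psi : P.-integrable setT (fun w => (psi (Z 0%N w))%:E).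
Proof.
have := integrableZl measurableT (alpha^-1) (integrable_expN 0).
apply: le_integrable => //.
  by apply/measurable_EFinP; exact: measurableT_comp.
move=> w _; rewrite -EFinM /= lee_fin [leRHS]ger0_norm; last first.
  by rewrite mulr_ge0 ?expR_ge0 // invr_ge0 ltW.
rewrite addr0 (le_trans (psiN _)) // mulrC ler_pdivlMr // mulrC.
by have := expR_ge1Dx (alpha * N (Z 0%N w)); lra.
Qed.

(** Centering kills the linear term of [expR_moment], leaving [1 + D * s ^+ 2 <= expR (D * s ^+ 2)],
    with [D] the expectation of the quadratic remainder. Identical distribution makes [D]
    independent of [k]. *)
Lemma mgf_bound : exists2 D : R, (0 <= D)%R &
  forall k s, (`|s| <= alpha / 2)%R ->
    \int[P]_w (expR (s * (psi (Z k w) - c)))%:E <= (expR (D * s ^+ 2))%:E.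
Proof.
pose V w := (16 / alpha ^+ 2 * expR (alpha * (N (Z 0%N w) + `|c|)))%R.
have iV : P.-integrable setT (fun w => (V w)%:E).
  exact: (integrableZl measurableT (16 / alpha ^+ 2)%R (integrable_expN `|c|)).
have V0 w : (0 <= V w)%R by rewrite /V mulr_ge0 ?expR_ge0 // divr_ge0 ?sqr_ge0.
exists (Rintegral P setT V); first by apply: Rintegral_ge0 => w _; exact: V0.
move=> k s hs.
have mf : measurable_fun setT (fun x => expR (s * (psi x - c))).
  apply: measurableT_comp => //; apply: measurable_funM => //.
  exact: measurable_funB.
have f0 x : (0 <= expR (s * (psi x - c)))%R by exact: expR_ge0.
rewrite (integral_ident mZ ident k mf f0).
pose G w := (1 + s * (psi (Z 0%N w) - c) + s ^+ 2 * V w)%R.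
have ic := finite_measure_integrable_cst P c measurableT.
have iB : P.-integrable setT (fun w => (psi (Z 0%N w) - c)%:E).
  exact: (integrableB measurableT integrable_psi ic).
have iY : P.-integrable setT (fun w => (s * (psi (Z 0%N w) - c))%:E).
  exact: (integrableZl measurableT s iB).
have i1 : P.-integrable setT (fun w => (1 : R)%:E).
  exact: finite_measure_integrable_cst.
have i2 : P.-integrable setT (fun w => (1 + s * (psi (Z 0%N w) - c))%:E).
  exact: (integrableD measurableT i1 iY).
have i3 : P.-integrable setT (fun w => (s ^+ 2 * V w)%:E).
  exact: (integrableZl measurableT (s ^+ 2)%R iV).
apply: (@le_trans _ _ (\int[P]_w (G w)%:E)).
  apply: ge0_le_integral => //.
  - by apply/measurable_EFinP; exact: (measurableT_comp mf).
  - have /measurable_int := integrableD measurableT i2 i3.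
    by apply.
  - move=> w _; rewrite lee_fin; apply: expR_moment => //.
    by rewrite (le_trans (ler_normB _ _)) // lerD2r.
have iG : P.-integrable setT (fun w => (G w)%:E) by exact: (integrableD measurableT i2 i3).
have -> : \int[P]_w (G w)%:E = (Rintegral P setT G)%:E.
  by rewrite fineK //; exact: integrable_fin_num.
have cst1 (r : R) : Rintegral P setT (fun=> r) = r.
  rewrite Rintegral_cst; last exact: measurableT.
  by rewrite (_ : fine _ = 1%R) ?mulr1 //; exact: (congr1 fine (probability_setT P)).
have -> : Rintegral P setT G = (1 + s ^+ 2 * Rintegral P setT V)%R.
  rewrite /G (RintegralD measurableT i2 i3) (RintegralD measurableT i1 iY) cst1.
  rewrite (RintegralZl _ measurableT iB) (RintegralZl _ measurableT iV).
  by rewrite (RintegralB measurableT integrable_psi ic) cst1 -/c subrr mulr0 addr0.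
by rewrite lee_fin mulrC; exact: expR_ge1Dx.
Qed.

Lemma fin_num_exp k s : (`|s| <= alpha / 2)%R ->
  \int[P]_w (expR (s * (psi (Z k w) - c)))%:E \is a fin_num.
Proof.
move=> hs; have [D _ hD] := mgf_bound.
rewrite ge0_fin_numE; first exact: (le_lt_trans (hD k s hs) (ltry _)).
by apply: integral_ge0 => w _; rewrite lee_fin expR_ge0.
Qed.

Lemma measurable_wsum (a : nat -> R) n :
  measurable_fun setT (fun w => \sum_(k < n) a k * (psi (Z k w) - c))%R.
Proof.
apply: measurable_sum => k; apply: measurable_funM => //.
by apply: measurable_funB => //; exact: measurableT_comp.
Qed.

(** The rate [kappa] is uniform over all weights bounded by [A], as needed for weights that change
    with [n]. *)
Lemma chernoff_sum (A e : R) : (0 < A)%R -> (0 < e)%R ->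
  exists2 kappa : R, (0 < kappa)%R &
  forall n (a : nat -> R), (forall k, (k < n)%N -> `|a k| <= A)%R ->
    P [set w | n%:R * e <= \sum_(k < n) a k * (psi (Z k w) - c)]%R
      <= (expR (- (kappa * n%:R)))%:E.
Proof.
move=> A0 e0; have [D D0 hD] := mgf_bound.
(* The first bound keeps each [t * a k] within the range of [mgf_bound]; the second makes the
   quadratic loss at most half the linear gain [t * e]. Adding 1 to [D] covers [D = 0]. *)
pose t := Num.min (alpha / 2 / A)%R (e / (2 * (D + 1) * A ^+ 2))%R.
have D1 : (0 < D + 1)%R by lra.
have t0 : (0 < t)%R.
  rewrite lt_min !divr_gt0 //= ?mulr_gt0 // exprn_gt0 //.
have tA : (t * A <= alpha / 2)%R by rewrite -ler_pdivlMr // ge_min lexx.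
have te : (D * t * A ^+ 2 <= e / 2)%R.
  have : (t <= e / (2 * (D + 1) * A ^+ 2))%R by rewrite ge_min lexx orbT.
  rewrite ler_pdivlMr ?mulr_gt0 ?exprn_gt0 // => h.
  have : (0 <= t * A ^+ 2)%R by rewrite mulr_ge0 ?sqr_ge0 // ltW.
  nra.
exists (t * e / 2)%R; first by rewrite divr_gt0 // mulr_gt0.
move=> n a ha.
(* Weights are cut off beyond [n] because [expectation_prod] asks for finite expectations at every
   index. *)
pose a' k := if (k < n)%N then a k else 0%R.
have ha' k : (`|t * a' k| <= alpha / 2)%R.
  rewrite /a'; case: ifP => [/ha h|_]; last by rewrite mulr0 normr0 divr_ge0 // ltW.
  by rewrite normrM gtr0_norm // (le_trans _ tA) // ler_wpM2l // ltW.
have mX := measurable_wsum a n.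
pose X : {RV P >-> R} := mfun_Sub (mem_set mX).
have := chernoff X (n%:R * e)%R t0; rewrite /mmt_gen_fun unlock => h.
apply: (le_trans h).
have -> : \int[P]_w ((expR \o t \o* X) w)%:E =
  \int[P]_w (\prod_(k < n) expR (t * a' k * (psi (Z k w) - c)))%:E.
  apply: eq_integral => w _; rewrite -expR_sum /=; congr (expR _)%:E.
  rewrite mulr_suml; apply: eq_bigr => k _.
  by rewrite /a' ltn_ord mulrC mulrA.
pose f k x := expR (t * a' k * (psi x - c)).
have mf k : measurable_fun setT (f k).
  apply: measurableT_comp => //; apply: measurable_funM => //.
  exact: measurable_funB.
have f0 k x : (0 <= f k x)%R by exact: expR_ge0.
have ff k : \int[P]_w (f k (Z k w))%:E \is a fin_num by exact: fin_num_exp.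
rewrite (expectation_prod mZ indep n mf f0 ff).
under eq_bigr => k _ do rewrite -(fineK (ff k)).
rewrite prodEFin -EFinM lee_fin.
apply: (@le_trans _ _ (\prod_(k < n) expR (D * (t * A) ^+ 2) * expR (- (t * (n%:R * e))))%R).
  rewrite ler_wpM2r ?expR_ge0 //; apply: ler_prod => k _; apply/andP; split.
    by rewrite fine_ge0 // integral_ge0 // => w _; rewrite lee_fin f0.
  rewrite -lee_fin fineK //; apply: (le_trans (hD _ _ (ha' k))).
  rewrite lee_fin ler_expR ler_wpM2l // -(real_normK (num_real (t * a' k)%R)).
  rewrite lerXn2r ?nnegrE ?mulr_ge0 ?(ltW t0) ?(ltW A0) //.
  rewrite normrM (gtr0_norm t0) ler_wpM2l ?(ltW t0) //.
  by rewrite /a' ltn_ord ha.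
rewrite prodr_const card_ord -expRM_natl -expRD ler_expR.
have n0 : (0 <= n%:R :> R)%R by exact: ler0n.
have : (t * (D * t * A ^+ 2) * n%:R <= t * (e / 2) * n%:R)%R.
  by rewrite ler_wpM2r // ler_wpM2l // ltW.
lra.
Qed.

Lemma chernoff_two_sided (A e : R) : (0 < A)%R -> (0 < e)%R ->
  exists2 kappa : R, (0 < kappa)%R &
  forall n (a : nat -> R), (forall k, (k < n)%N -> `|a k| <= A)%R ->
    P [set w | n%:R * e <= `|\sum_(k < n) a k * (psi (Z k w) - c)|]%R
      <= (2 * expR (- (kappa * n%:R)))%:E.
Proof.
move=> A0 e0; have [kappa k0 hk] := chernoff_sum A0 e0.
exists kappa => // n a ha.
pose E (b : nat -> R) := [set w | n%:R * e <= \sum_(k < n) b k * (psi (Z k w) - c)]%R.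
have mE b : measurable (E b).
  rewrite -[E b]setTI; apply: measurable_fun_le => //; exact: measurable_wsum.
apply: (@le_trans _ _ (P (E a `|` E (fun k => - a k)%R))).
  apply: le_measure.
  - apply: mem_set; rewrite -[X in measurable X]setTI; apply: measurable_fun_le => //.
    by apply: measurableT_comp => //; exact: measurable_wsum.
  - by apply: mem_set; exact: measurableU.
  move=> w; rewrite /E /=; under [X in _ \/ (_ <= X)%R]eq_bigr => k _ do rewrite mulNr.
  by rewrite sumrN; rewrite ler_normr => /orP[]; [left|right].
apply: (le_trans (measureU2 _ (mE _) (mE _))).
rewrite mulr_natl mulr2n EFinD leeD // hk // => k kn.
by rewrite normrN ha.
Qed.

End Chernoff.

(** * Laws of random vectors determined by distribution functions *)

Section Boxes.
Variable R : realType.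

Lemma measurable_fun_gt d (Omega : measurableType d) (f : Omega -> R) :
  (forall t, measurable [set w | t < f w]) -> measurable_fun setT f.
Proof.
move=> h; apply: (measurability _ (RGenOInfty.measurableE R)).
move=> _ [_ [t ->] <-]; rewrite setTI.
rewrite (_ : _ @^-1` _ = [set w | t < f w]) //.
by apply/seteqP; split=> w /=; rewrite in_itv /= andbT.
Qed.

Variable J : finType.

Definition boxes : set (set (J -> R)) :=
  [set A | exists t : J -> R, A = [set v | forall j, v j <= t j]].

(** Identity of laws is given only through joint distribution functions, so the sigma-algebra is
    generated by the sets that these measure; they are stable under intersection. *)
Definition coord_space := g_sigma_algebraType boxes.

Lemma boxes_setI : setI_closed boxes.
Proof.
move=> _ _ [t ->] [s ->]; exists (fun j => Num.min (t j) (s j)).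
apply/seteqP; split=> v /= => [[ht hs] j|h]; first by rewrite le_min ht hs.
by split=> j; have := h j; rewrite le_min => /andP[].
Qed.

Lemma nat_upper_bound (v : J -> R) : exists n : nat, forall j, v j <= n%:R.
Proof.
exists (\max_j Num.trunc `|v j|).+1 => j.
apply: (le_trans (ler_norm _)); apply: ltW.
apply: (lt_le_trans (truncnS_gt _)); rewrite ler_nat ltnS.
exact: (leq_bigmax j).
Qed.

Lemma boxes_cover : \bigcup_(n in setT) [set v : J -> R | forall j, v j <= n%:R] = setT.
Proof.
apply/seteqP; split=> // v _; have [n hn] := nat_upper_bound v.
by exists n.
Qed.

(** A half-space in one coordinate is a countable union of boxes whose other sides grow. *)
Lemma measurable_coord (j : J) : measurable_fun setT (fun v : coord_space => v j).
Proof.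
apply: measurable_fun_gt => t.
rewrite (_ : [set w : coord_space | t < w j] = ~` [set w : coord_space | w j <= t]); last first.
  by apply/seteqP; split=> v /=; rewrite ltNge => /negP.
apply: measurableC.
have -> : [set v : coord_space | v j <= t] =
    \bigcup_(n in setT) [set v | forall i, v i <= if i == j then t else n%:R].
  apply/seteqP; split=> v /= => [vj|[n _ /(_ j)]]; last by rewrite eqxx.
  have [n hn] := nat_upper_bound v; exists n => // i.
  by case: eqVneq => [->|].
apply: bigcupT_measurable => n; apply: sub_sigma_algebra.
by exists (fun i => if i == j then t else n%:R).
Qed.

End Boxes.

Section IID.
Context {R : realType} d (Omega : measurableType d).
Variables (P : probability Omega R) (r : nat) (g : nat -> 'I_r -> Omega -> R[i]).
Hypothesis iid : iid_vecs P g.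

Definition coords (v : 'I_r -> R[i]) : coord_space R ('I_r * bool)%type :=
  fun ib => if ib.2 then complex.Im (v ib.1) else complex.Re (v ib.1).

Definition gcoords k (w : Omega) := coords (fun i => g k i w).

Lemma measurable_comp_coord k (ib : 'I_r * bool) :
  measurable_fun setT (fun w => gcoords k w ib).
Proof. by case: ib => i [] /=; have [/(_ k i)[]] := iid. Qed.

Lemma gcoords_boxE k (t : 'I_r * bool -> R) :
  gcoords k @^-1` [set v | forall j, v j <= t j] =
  \bigcap_(j in [set: 'I_r * bool]) [set w | gcoords k w j <= t j].
Proof. by apply/seteqP; split=> w /= h j => [_|]; exact: h. Qed.

Lemma measurable_gcoords k : measurable_fun setT (gcoords k).
Proof.
apply: (@measurability _ _ _ _ setT (gcoords k) (@boxes R ('I_r * bool)%type)) => //.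
move=> _ [_ [t ->] <-]; rewrite setTI gcoords_boxE.
apply: fin_bigcap_measurable => // j _.
rewrite -[X in measurable X]setTI; apply: measurable_fun_le => //.
exact: measurable_comp_coord.
Qed.

(** [Omega] is given the sigma-algebra generated by the coordinates of [g k], so that the claim
    becomes measurability of [gcoords g k] and can be checked on boxes. *)
Lemma sigma_vec_gcoords k (B : set (coord_space R ('I_r * bool)%type)) :
  measurable B -> sigma_vec (g k) (gcoords k @^-1` B).
Proof.
pose gen := [set A | exists i (B : set R), measurable B /\
       (A = (fun w => complex.Re (g k i w)) @^-1` B \/
        A = (fun w => complex.Im (g k i w)) @^-1` B)].
have sE : sigma_vec (g k) = @measurable _ (g_sigma_algebraType gen) by [].
have mT (f : g_sigma_algebraType gen -> coord_space R ('I_r * bool)%type) :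
  measurable_fun setT f -> measurable B -> @measurable _ (g_sigma_algebraType gen) (f @^-1` B).
  by move=> mf mB; rewrite -[X in measurable X]setTI; exact: mf.
rewrite sE; apply: (mT (gcoords k)).
apply: (@measurability _ _ (g_sigma_algebraType gen) _ setT (gcoords k) (@boxes R ('I_r * bool)%type)) => //.
move=> _ [_ [t ->] <-]; rewrite setTI gcoords_boxE.
apply: fin_bigcap_measurable => // -[i b] _.
apply: sub_sigma_algebra; exists i, [set` `]-oo, t (i, b)]]; split; first exact: measurable_itv.
case: b; [right|left]; apply/seteqP; split=> w /=; rewrite in_itv /=; by [].
Qed.

Lemma gcoords_indep (S : seq nat) (B : nat -> set (coord_space R ('I_r * bool)%type)) :
  uniq S -> (forall k, measurable (B k)) ->
  P (\bigcap_(k in [set k | k \in S]) (gcoords k @^-1` B k)) =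
  \big[*%E/1%E]_(k <- S) P (gcoords k @^-1` B k).
Proof.
move=> uS mB; have [_ [h _]] := iid; apply: h => // k _.
exact: sigma_vec_gcoords.
Qed.

(** Uniqueness of a measure given on an intersection-stable generating class, exhausted by boxes
    with integer sides. *)
Lemma gcoords_ident k (B : set (coord_space R ('I_r * bool)%type)) :
  measurable B -> P (gcoords k @^-1` B) = P (gcoords 0 @^-1` B).
Proof.
move=> mB.
have cov : \bigcup_n [set v : coord_space R ('I_r * bool)%type | forall j, v j <= n%:R] = setT.
  exact: boxes_cover.
unshelve refine (@measure_unique _ R (coord_space R ('I_r * bool)%type) (@boxes R ('I_r * bool)%type)
  (fun n => [set v | forall j, v j <= n%:R]) erefl _ _ cov
  (pushforward P (gcoords k)) (pushforward P (gcoords 0)) _ _ B mB).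
- exact: measurable_gcoords.
- exact: measurable_gcoords.
- exact: boxes_setI.
- by move=> n; exists (fun=> n%:R).
- move=> _ [t ->].
  have [_ [_ h]] := iid.
  have := h k (fun i => t (i, false)) (fun i => t (i, true)).
  have e j : gcoords j @^-1` [set v | forall j, v j <= t j] =
    [set w | forall i : 'I_r, complex.Re (g j i w) <= t (i, false) /\
       complex.Im (g j i w) <= t (i, true)].
    apply/seteqP; split=> w /= hw; last by case=> i [] /=; have [] := hw i.
    by move=> i; split; [exact: (hw (i, false))|exact: (hw (i, true))].
  by rewrite -(e k) -(e 0).
move=> n; apply: (le_lt_trans _ (ltry 1)); apply: probability_le1.
rewrite -[X in measurable X]setTI; apply: measurable_gcoords => //.
by apply: sub_sigma_algebra; exists (fun=> n%:R).
Qed.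

End IID.

(** * Events of exponentially small probability *)

Section ExpSmall.
Context {R : realType} d (Omega : measurableType d) (P : probability Omega R).

(** A measurable superset is used because the bad events below quantify over all vectors [u], and no
    measurability is established for them. *)
Definition exp_small (B : nat -> set Omega) :=
  exists kappa K : R, [/\ 0 < kappa, 0 <= K & forall n, exists B' : set Omega,
    [/\ measurable B', B n `<=` B' & (P B' <= (K * expR (- (kappa * n%:R)))%:E)%E]].

Lemma exp_smallS (A B : nat -> set Omega) :
  (forall n, A n `<=` B n) -> exp_small B -> exp_small A.
Proof.
move=> AB [kappa [K [k0 K0 h]]]; exists kappa, K; split=> // n.
by have [B' [mB BB' PB]] := h n; exists B'; split=> //; apply: subset_trans BB'.
Qed.

Lemma exp_smallU (A B : nat -> set Omega) :
  exp_small A -> exp_small B -> exp_small (fun n => A n `|` B n).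
Proof.
move=> [k1 [K1 [k10 K10 h1]]] [k2 [K2 [k20 K20 h2]]].
exists (Num.min k1 k2), (K1 + K2); split; rewrite ?addr_ge0 ?lt_min ?k10 // => n.
have [A' [mA AA' PA]] := h1 n; have [B' [mB BB' PB]] := h2 n.
exists (A' `|` B'); split; [exact: measurableU|exact: setUSS|].
apply: (le_trans (measureU2 _ mA mB)); rewrite mulrDl EFinD; apply: leeD.
  apply: (le_trans PA); rewrite lee_fin ler_wpM2l // ler_expR lerN2 ler_wpM2r //.
  by rewrite ge_min lexx.
apply: (le_trans PB); rewrite lee_fin ler_wpM2l // ler_expR lerN2 ler_wpM2r //.
by rewrite ge_min lexx orbT.
Qed.

Lemma exp_small0 : exp_small (fun=> set0).
Proof.
by exists 1, 0; split=> // n; exists set0; split=> //; rewrite measure0 mul0r.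
Qed.

Lemma exp_small_finite (I : finType) (B : I -> nat -> set Omega) :
  (forall i, exp_small (B i)) -> exp_small (fun n => \bigcup_(i in setT) B i n).
Proof.
move=> hB; suff h : exp_small (fun n => \bigcup_(i in [set i | i \in enum I]) B i n).
  by apply: exp_smallS h => n w [i _ Bi]; exists i => //=; rewrite mem_enum.
elim: (enum I) => [|i s IH].
  by apply: exp_smallS exp_small0 => n w [].
apply: exp_smallS (exp_smallU (hB i) IH) => n w [k /=].
by rewrite inE => /predU1P[->|ks] Bk; [left|right; exists k].
Qed.

(** The extra constant [expR (kappa * n0%:R)] makes the bound at least 1, hence trivial, for
    [n < n0]. *)
Lemma exp_small_eventually (A B : nat -> set Omega) (n0 : nat) :
  (forall n, (n0 <= n)%N -> A n `<=` B n) -> exp_small B -> exp_small A.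
Proof.
move=> AB [kappa [K [k0 K0 h]]].
exists kappa, (K + expR (kappa * n0%:R)); split=> // [|n].
  by rewrite addr_ge0 ?expR_ge0.
have [n0n|nn0] := leqP n0 n.
  have [B' [mB BB' PB]] := h n; exists B'; split=> //.
    exact: subset_trans (AB n n0n) BB'.
  apply: (le_trans PB); rewrite lee_fin ler_wpM2r ?expR_ge0 //.
  by rewrite lerDl expR_ge0.
exists setT; split=> //; rewrite probability_setT lee_fin mulrDl -expRD.
have : 1 <= expR (kappa * n0%:R - kappa * n%:R).
  by rewrite -[leLHS]expR0 ler_expR subr_ge0 ler_wpM2l ?ler_nat ?(ltnW nn0) // ltW.
have : 0 <= K * expR (- (kappa * n%:R)) by rewrite mulr_ge0 ?expR_ge0.
lra.
Qed.

End ExpSmall.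

Section Entries.
Context {R : realType} d (Omega : measurableType d).
Variables (P : probability Omega R) (r : nat) (g : nat -> 'I_r -> Omega -> R[i]).
Hypothesis iid : iid_vecs P g.
Variable alpha : R.
Hypothesis alpha_gt0 : 0 < alpha.
Hypothesis exp_moment : (\int[P]_w (expR (alpha * \sum_i ((complex.Re (g 0%N i w)) ^+ 2
                                        + (complex.Im (g 0%N i w)) ^+ 2)))%:E < +oo)%E.

Let T := coord_space R ('I_r * bool)%type.

Definition psiRe (i j : 'I_r) (v : T) : R :=
  v (i, false) * v (j, false) + v (i, true) * v (j, true).
Definition psiIm (i j : 'I_r) (v : T) : R :=
  v (i, false) * v (j, true) - v (i, true) * v (j, false).
(** The dominating function of the Chernoff bound: (B) gives its exponential moment, and it bounds
    every [psiRe] and [psiIm]. *)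
Definition vec_nsq (v : T) : R := \sum_i (v (i, false) ^+ 2 + v (i, true) ^+ 2).

Lemma psiReE i j k w : psiRe i j (gcoords g k w) =
  complex.Re (conjc (g k i w) * g k j w).
Proof.
rewrite /psiRe /gcoords /coords /=.
by case: (g k i w) => a b; case: (g k j w) => p q /=; rewrite mulNr opprK.
Qed.

Lemma psiImE i j k w : psiIm i j (gcoords g k w) =
  complex.Im (conjc (g k i w) * g k j w).
Proof.
rewrite /psiIm /gcoords /coords /=.
by case: (g k i w) => a b; case: (g k j w) => p q /=; rewrite mulNr.
Qed.

Lemma measurable_psiRe i j : measurable_fun setT (psiRe i j).
Proof.
by apply: measurable_funD; apply: measurable_funM; exact: measurable_coord.
Qed.

Lemma measurable_psiIm i j : measurable_fun setT (psiIm i j).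
Proof.
by apply: measurable_funB; apply: measurable_funM; exact: measurable_coord.
Qed.

Lemma measurable_vec_nsq : measurable_fun setT vec_nsq.
Proof.
apply: measurable_sum => i; apply: measurable_funD; apply: measurable_funX;
  exact: measurable_coord.
Qed.

Lemma vec_nsq_ge i (v : T) : v (i, false) ^+ 2 + v (i, true) ^+ 2 <= vec_nsq v.
Proof.
rewrite /vec_nsq (bigD1 i) //= lerDl sumr_ge0 // => j _.
by rewrite addr_ge0 ?sqr_ge0.
Qed.

Lemma psiRe_le i j v : `|psiRe i j v| <= vec_nsq v.
Proof.
have hi := vec_nsq_ge i v; have hj := vec_nsq_ge j v.
rewrite /psiRe; set a := v (i, false) in hi *; set b := v (i, true) in hi *.
set p := v (j, false) in hj *; set q := v (j, true) in hj *.
have := sqr_ge0 (a + p); have := sqr_ge0 (a - p).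
have := sqr_ge0 (b + q); have := sqr_ge0 (b - q).
move: hi hj; rewrite ler_norml !expr2 => *; apply/andP; split; lra.
Qed.

Lemma psiIm_le i j v : `|psiIm i j v| <= vec_nsq v.
Proof.
have hi := vec_nsq_ge i v; have hj := vec_nsq_ge j v.
rewrite /psiIm; set a := v (i, false) in hi *; set b := v (i, true) in hi *.
set p := v (j, false) in hj *; set q := v (j, true) in hj *.
have := sqr_ge0 (a + q); have := sqr_ge0 (a - q).
have := sqr_ge0 (b + p); have := sqr_ge0 (b - p).
move: hi hj; rewrite ler_norml !expr2 => *; apply/andP; split; lra.
Qed.

Let expN : (\int[P]_w (expR (alpha * vec_nsq (gcoords g 0 w)))%:E < +oo)%E.
Proof. exact: exp_moment. Qed.

Definition Cstar : 'M[R[i]]_r :=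
  \matrix_(i, j) cexpect P (fun w => conjc (g 0%N i w) * g 0%N j w).

Lemma Re_Cstar i j :
  complex.Re (Cstar i j) = Rintegral P setT (fun w => psiRe i j (gcoords g 0 w)).
Proof. by rewrite mxE /=; apply: eq_Rintegral => w _; rewrite psiReE. Qed.

Lemma Im_Cstar i j :
  complex.Im (Cstar i j) = Rintegral P setT (fun w => psiIm i j (gcoords g 0 w)).
Proof. by rewrite mxE /=; apply: eq_Rintegral => w _; rewrite psiImE. Qed.

Definition bad_entry (n : nat) (a : nat -> R) (e : R) : set Omega :=
  [set w | exists i j,
    ~ (`|\sum_(k < n) a k * (complex.Re (conjc (g k i w) * g k j w) - complex.Re (Cstar i j))|
         < n%:R * e /\
       `|\sum_(k < n) a k * (complex.Im (conjc (g k i w) * g k j w) - complex.Im (Cstar i j))|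
         < n%:R * e)].

Lemma exp_small_psi (psi : T -> R) (A e : R) (a : nat -> nat -> R) :
  measurable_fun setT psi -> (forall v, `|psi v| <= vec_nsq v) -> 0 < A -> 0 < e ->
  (forall n k, (k < n)%N -> `|a n k| <= A) ->
  exp_small P (fun n => [set w | n%:R * e <= `|\sum_(k < n) a n k *
    (psi (gcoords g k w) - Rintegral P setT (fun w => psi (gcoords g 0 w)))|]).
Proof.
move=> mpsi psiN A0 e0 hA.
have [kappa k0 hk] := chernoff_two_sided (measurable_gcoords iid) (gcoords_indep iid)
  (gcoords_ident iid) mpsi measurable_vec_nsq psiN alpha_gt0 expN A0 e0.
set B := (X in exp_small _ X).
exists kappa, 2; split=> // n; exists (B n); split=> //; last exact: (hk n (a n) (hA n)).
rewrite -[X in measurable X]setTI; apply: measurable_fun_le => //.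
apply: measurableT_comp => //.
exact: (measurable_wsum P (measurable_gcoords iid) mpsi (a n) n).
Qed.

Lemma exp_small_entries (A e : R) (a : nat -> nat -> R) : 0 < A -> 0 < e ->
  (forall n k, (k < n)%N -> `|a n k| <= A) ->
  exp_small P (fun n => bad_entry n (a n) e).
Proof.
move=> A0 e0 hA.
have h1 (ij : 'I_r * 'I_r) := exp_small_psi (measurable_psiRe ij.1 ij.2)
  (psiRe_le ij.1 ij.2) A0 e0 hA.
have h2 (ij : 'I_r * 'I_r) := exp_small_psi (measurable_psiIm ij.1 ij.2)
  (psiIm_le ij.1 ij.2) A0 e0 hA.
apply: exp_smallS (exp_smallU (exp_small_finite h1) (exp_small_finite h2)) => n w.
move=> [i [j /not_andP[/negP|/negP]]]; rewrite -leNgt => h.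
  left; exists (i, j) => //=; rewrite -Re_Cstar.
  by under eq_bigr => k _ do rewrite psiReE.
right; exists (i, j) => //=; rewrite -Im_Cstar.
by under eq_bigr => k _ do rewrite psiImE.
Qed.

End Entries.

(** * The Stieltjes transform above the support *)

Lemma measurable_inv (R : realType) : measurable_fun setT (@GRing.inv R).
Proof.
have m0 : measurable ([set 0] : set R) by exact: measurable_set1.
rewrite -(setUCl ([set 0] : set R)); apply/measurable_funU => //.
  exact: measurableC.
split; last exact: measurable_fun_set1.
apply: open_continuous_measurable_fun; first exact/closed_openC/closed_eq.
by move=> x /set_mem /= /eqP x0; exact: inv_continuous.
Qed.

Section Support.
Variables (R : realType) (mu : probability R R) (a b : R).
Hypothesis supp_sub : msupport mu `<=` `[a, b].

(** Each point outside [[a, b]] has a null ball around it, which contains a null ball with rational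
    centre and radius [1 / (n + 1)] around the same point. There are countably many of these,
    enumerated by [pickle]. *)
Lemma support_null : mu (~` [set` `[a, b]]) = 0%E.
Proof.
pose F (k : nat) : set R := if choice.unpickle k is Some qn then
  let B := ball (ratr (qn.1 : rat) : R) (qn.2 : nat).+1%:R^-1 in
  if mu B == 0%E then B else set0 else set0.
have nF k : mu.-negligible (F k).
  rewrite /F; case: choice.unpickle => [qn|]; last exact: negligible_set0.
  case: eqP => [h|_]; last exact: negligible_set0.
  by exists (ball (ratr qn.1 : R) qn.2.+1%:R^-1); split=> //; exact: measurable_ball.
have mab : measurable (~` [set` `[a, b]] : set R) by apply: measurableC.
apply/(negligibleP _ mab); apply: (negligibleS _ (negligible_bigcup nF)) => y yab.
have [e e0 he] : exists2 e : R, 0 < e & mu (ball y e) = 0%E.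
  have : ~ msupport mu y by move=> /supp_sub.
  move=> /existsNP[e /not_implyP[e0 h]]; exists e => //; apply/eqP.
  by rewrite eq_le measure_ge0 andbT leNgt; apply/negP.
have [n hn] : exists n : nat, n.+1%:R^-1 < e / 2.
  have e2 : 0 < e / 2 by rewrite divr_gt0.
  have [n _ /(_ n (leqnn n)) hn] := near_infty_natSinv_lt (PosNum e2).
  by exists n.
have w0 : 0 < n.+1%:R^-1 :> R by rewrite invr_gt0.
have yn : y < y + n.+1%:R^-1 by rewrite ltrDl invr_gt0.
have [q] := rat_in_itvoo yn; rewrite in_itv /= => /andP[yq qy].
exists (choice.pickle (q, n)); first exact: I.
rewrite /F choice.pickleK /=; move: (n.+1%:R^-1) w0 hn yn qy => w w0 hn yn qy.
have sub : ball (ratr q : R) w `<=` ball y e.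
  by move=> u /=; rewrite /ball /= !ltr_norml => /andP[h1 h2]; apply/andP; split; lra.
rewrite ifT; last first.
  rewrite eq_le measure_ge0 andbT -he; apply: le_measure; last exact: sub.
    by apply: mem_set; exact: measurable_ball.
  by apply: mem_set; exact: measurable_ball.
by rewrite /ball /= ltr_norml; apply/andP; split; lra.
Qed.

Lemma support_full : mu [set` `[a, b]] = 1%E.
Proof.
have mab : measurable ([set` `[a, b]] : set R) by [].
rewrite -[X in mu X]setCK; have := @probability_setC _ _ _ mu (~` [set` `[a, b]]).
by rewrite support_null sube0; apply; exact: measurableC.
Qed.

(** [hpow 0] is the Stieltjes transform, and [hpow k] is its [k]-th derivative up to the factor
    [(-1)^k k!]; the family is closed under differentiation up to constants. *)
Definition hpow (k : nat) (z : R) : R :=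
  Rintegral mu [set` `[a, b]] (fun l => ((z - l)^-1) ^+ k.+1).

Let mD : measurable ([set` `[a, b]] : set R). Proof. by []. Qed.

Lemma measurable_kernel k z : measurable_fun setT (fun l : R => ((z - l)^-1) ^+ k.+1).
Proof.
apply: measurable_funX; apply: (measurableT_comp (@measurable_inv R)).
by apply: measurable_funB.
Qed.

Lemma kernel_bound k (z c l : R) : b < c -> c <= z -> l <= b ->
  0 <= ((z - l)^-1) ^+ k.+1 <= ((c - b)^-1) ^+ k.+1.
Proof.
move=> bc cz lb; have zl : 0 < z - l by lra.
rewrite exprn_ge0 ?invr_ge0 ?(ltW zl) //= lerXn2r ?nnegrE ?invr_ge0 ?(ltW zl) //; try lra.
by rewrite lef_pV2 ?posrE; lra.
Qed.

Lemma integrable_kernel k z : b < z ->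
  mu.-integrable [set` `[a, b]] (fun l => (((z - l)^-1) ^+ k.+1)%:E).
Proof.
move=> bz; apply: measurable_bounded_integrable => //.
- by rewrite (le_lt_trans (probability_le1 _ _)) ?ltry.
- exact: measurable_funS (measurable_kernel k z).
exists (((z - b)^-1) ^+ k.+1); split; first exact: num_real.
move=> M hM l /=; rewrite in_itv /= => /andP[_ lb].
have /andP[h0 h1] := kernel_bound k bz (lexx z) lb.
by rewrite ger0_norm // (le_trans h1) // ltW.
Qed.

Lemma is_derive_kernel k (z l : R) : z - l != 0 ->
  is_derive z 1 (fun z => ((z - l)^-1) ^+ k.+1)
    (- k.+1%:R * ((z - l)^-1) ^+ k.+2).
Proof.
move=> zl.
have d1 : is_derive z 1 (fun z : R => z - l) 1.
  by apply: is_derive_eq; rewrite subr0.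
have d2 := @is_deriveV R (fun z => z - l) z 1 1 zl d1.
have d3 := is_deriveX k.+1 d2.
rewrite (_ : (fun z => (z - l)^-1 ^+ k.+1) = (fun z => (z - l)^-1) ^+ k.+1); last first.
  by apply/funext => y; rewrite fctE.
apply: (is_derive_eq d3); rewrite /= /GRing.scale /= mulr1 -exprVn.
by rewrite (exprS _ k.+1) (exprS _ k); ring.
Qed.

Lemma is_derive_hpow k z : b < z ->
  is_derive z 1 (hpow k) (- k.+1%:R * hpow k.+1 z).
Proof.
(* Staying above the intermediate point [c] bounds the differentiated kernel uniformly, as
   differentiation under the integral requires. *)
move=> bz; pose c := (b + z) / 2; have bc : b < c by rewrite /c; lra.
have cz : c < z by rewrite /c; lra.
have zI : `]c, (z + 1)[%classic z by rewrite /= in_itv /=; apply/andP; split; lra.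
have inI x : `]c, (z + 1)[%classic x -> c < x by rewrite /= in_itv /= => /andP[].
have dk (x y : R) : `]c, (z + 1)[%classic x -> [set` `[a, b]] y ->
    is_derive x 1 (fun z => ((z - y)^-1) ^+ k.+1) (- k.+1%:R * ((x - y)^-1) ^+ k.+2).
  move=> /inI cx /=; rewrite in_itv /= => /andP[_ yb].
  by apply: is_derive_kernel; rewrite gt_eqF //; lra.
pose G := fun _ : R => k.+1%:R * ((c - b)^-1) ^+ k.+2.
have G0 y : 0 <= G y.
  by rewrite /G mulr_ge0 // exprn_ge0 // invr_ge0; lra.
have iG : mu.-integrable [set` `[a, b]]
    (EFin \o G : R -> \bar R).
  exact: finite_measure_integrable_cst.
have dE x y : `]c, (z + 1)[%classic x -> [set` `[a, b]] y ->
    partial1of2 (fun z l => ((z - l)^-1) ^+ k.+1) x y =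
    - k.+1%:R * ((x - y)^-1) ^+ k.+2.
  move=> xI yD; rewrite /partial1of2 derive1E.
  exact: (@derive_val _ _ _ _ _ _ _ (dk x y xI yD)).
have Gub x y : `]c, (z + 1)[%classic x -> [set` `[a, b]] y ->
    `|partial1of2 (fun z l => ((z - l)^-1) ^+ k.+1) x y| <=
      k.+1%:R * ((c - b)^-1) ^+ k.+2.
  move=> xI yD; rewrite dE // normrM normrN normr_nat ler_wpM2l //.
  move: yD => /=; rewrite in_itv /= => /andP[_ yb].
  have /andP[h0 h1] := kernel_bound k.+1 bc (ltW (inI _ xI)) yb.
  by rewrite ger0_norm.
have intf x : `]c, (z + 1)[%classic x ->
    mu.-integrable [set` `[a, b]] (EFin \o (fun l => ((x - l)^-1) ^+ k.+1)).
  by move=> /inI cx; apply: integrable_kernel; exact: lt_trans cx.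
have derf x y : `]c, (z + 1)[%classic x -> [set` `[a, b]] y ->
    derivable (fun z => ((z - y)^-1) ^+ k.+1) x 1.
  by move=> xI yD; exact: (@ex_derive _ _ _ _ _ _ _ (dk x y xI yD)).
have H := @cvg_differentiation_under_integral R _ _ mu
  (fun z l => ((z - l)^-1) ^+ k.+1) _ mD z c (z + 1) zI intf derf G G0 iG Gub.
have val : \int[mu]_(y in [set` `[a, b]])
    partial1of2 (fun z l => ((z - l)^-1) ^+ k.+1) z y = - k.+1%:R * hpow k.+1 z.
  rewrite /hpow -RintegralZl //; last exact: integrable_kernel.
  by apply: eq_Rintegral => y /set_mem yD; rewrite dE.
rewrite val in H.
have dqE : (fun h : R => h^-1 *: ((hpow k \o shift z) (h *: 1) - hpow k z)) =
           (fun h : R => h^-1 *: (hpow k (h + z) - hpow k z)).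
  by apply/funext => h; rewrite /= /GRing.scale /= mulr1.
apply: DeriveDef.
  by rewrite /derivable dqE; apply/cvg_ex; eexists; exact: H.
by rewrite /derive dqE; apply/cvg_lim.
Qed.

End Support.

Section Stieltjes.
Variables (R : realType) (mu : probability R R) (a b : R).
Hypothesis supp_sub : msupport mu `<=` `[a, b].
Hypothesis supp_b : msupport mu b.
Local Notation h := (hpow mu a b 0).
Let mD : measurable ([set` `[a, b]] : set R). Proof. by []. Qed.

Lemma stieltjesE z : b < z -> Rintegral mu setT (fun l => (z - l)^-1) = h z.
Proof.
move=> bz; have mN : measurable (~` [set` `[a, b]] : set R) by exact: measurableC.
have mf : measurable_fun setT (fun l : R => ((z - l)^-1)%:E).
  apply/measurable_EFinP.
  by have := measurable_kernel 0 z; under eq_fun do rewrite expr1.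
have e0 : setT `\` ~` [set` `[a, b]] = [set` `[a, b]] :> set R by rewrite setTD setCK.
have iD : mu.-integrable [set` `[a, b]] (fun l => ((z - l)^-1)%:E).
  exact: (integrable_kernel mu a 0 bz).
have iT : mu.-integrable setT (fun l : R => ((z - l)^-1)%:E).
  apply/integrableP; split=> //.
  rewrite (ge0_negligible_integral (N := ~` [set` `[a, b]])) //.
  - by rewrite e0; have /integrableP[] := iD.
  - exact: measurableT_comp.
  - exact: support_null.
rewrite /Rintegral (negligible_integral mN measurableT iT (support_null supp_sub)) e0.
by [].
Qed.

Lemma in_support_le : a <= b.
Proof. by have := supp_sub supp_b; rewrite /= in_itv /= => /andP[]. Qed.

Lemma Rintegral_support_cst (c : R) : Rintegral mu [set` `[a, b]] (fun=> c) = c.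
Proof.
rewrite Rintegral_cst; last exact: mD.
by rewrite (_ : fine _ = 1) ?mulr1 //; exact: (congr1 fine (support_full supp_sub)).
Qed.

Lemma integrable_support_cst (c : R) : mu.-integrable [set` `[a, b]] (fun=> c%:E).
Proof. exact: (finite_measure_integrable_cst mu c mD). Qed.

Lemma stieltjes_upper z : b < z -> h z <= (z - b)^-1.
Proof.
move=> bz; rewrite -[leRHS]Rintegral_support_cst; apply: le_Rintegral => //.
- exact: integrable_kernel.
- exact: integrable_support_cst.
move=> l /=; rewrite in_itv /= => /andP[al lb].
by rewrite expr1 lef_pV2 ?posrE; lra.
Qed.

Lemma hpow_gt0 k z : b < z -> 0 < hpow mu a b k z.
Proof.
move=> bz; have ab := in_support_le.
apply: (@lt_le_trans _ _ (((z - a)^-1) ^+ k.+1)).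
  by rewrite exprn_gt0 // invr_gt0; lra.
rewrite -[leLHS]Rintegral_support_cst; apply: le_Rintegral => //.
- exact: integrable_support_cst.
- exact: integrable_kernel.
move=> l /=; rewrite in_itv /= => /andP[al lb].
have zl : 0 < z - l by lra.
by rewrite lerXn2r ?nnegrE ?invr_ge0 // ?lef_pV2 ?posrE //; lra.
Qed.

Lemma stieltjes_gt0 z : b < z -> 0 < h z.
Proof. exact: hpow_gt0. Qed.

(** Monotonicity of the integral is only weak, so an explicit positive gap is inserted: by the
    resolvent identity the kernels differ by at least the value [c] reached at [l = a]. *)
Lemma stieltjes_decr y z : b < y -> y < z -> h z < h y.
Proof.
move=> bys yz; have bz : b < z by lra.
have ab := in_support_le.
pose c := (z - y) * ((z - a)^-1 * (y - a)^-1).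
have c0 : 0 < c by rewrite !mulr_gt0 ?invr_gt0; lra.
suff : h z + c <= h y by lra.
rewrite -(Rintegral_support_cst c) -RintegralD //; last 2 first.
- exact: integrable_kernel.
- exact: integrable_support_cst.
apply: le_Rintegral => //.
- exact: (integrableD mD (integrable_kernel mu a 0 bz) (integrable_support_cst c)).
- exact: integrable_kernel.
move=> l /=; rewrite in_itv /= => /andP[al lb]; rewrite !expr1 /c.
have e : (y - l)^-1 - (z - l)^-1 = (z - y) * ((z - l)^-1 * (y - l)^-1).
  by field; apply/andP; split; apply/eqP; lra.
have : (z - y) * ((z - a)^-1 * (y - a)^-1) <= (z - y) * ((z - l)^-1 * (y - l)^-1).
  rewrite ler_wpM2l; [by []|lra|].
  by rewrite ler_pM ?invr_ge0 ?lef_pV2 ?posrE; lra.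
by move: e; lra.
Qed.

Lemma stieltjes_continuous z : b < z -> {for z, continuous h}.
Proof.
move=> bz; apply/differentiable_continuous/derivable1_diffP.
by have [] := is_derive_hpow mu a 0 bz.
Qed.

(** [h] is continuous and tends to 0, so [h z * x] passes through 1 as soon as it reaches 1
    somewhere. It need not, since [h] may stay bounded near [b]; such an [x] creates no outlier. *)
Lemma solution_dichotomy (x : R) :
  (exists2 s, b < s & h s * x = 1) \/ (forall z, b < z -> h z * x < 1).
Proof.
have [[z [bz hz]]|no] := pselect (exists z, b < z /\ 1 <= h z * x); last first.
  right=> z bz; rewrite ltNge; apply/negP => hz; apply: no.
  by exists z.
left; have x0 : 0 < x.
  by rewrite -(pmulr_rgt0 _ (stieltjes_gt0 bz)) (lt_le_trans ltr01).
(* From [h w <= 1 / (w - b)] and [w - b >= x + 1] follows [h w * x <= 1]. *)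
pose w := Num.max (z + 1) (b + x + 1).
have zw : z < w by rewrite /w lt_max; apply/orP; left; lra.
have bw : b < w by lra.
have hw : h w * x <= 1.
  rewrite -ler_pdivlMr // (le_trans (stieltjes_upper bw)) // div1r lef_pV2 ?posrE; try lra.
  have : b + x + 1 <= w by rewrite /w le_max lexx orbT.
  lra.
have cont : {within `[z, w], continuous h}.
  apply: continuous_in_subspaceT => y /set_mem; rewrite /= in_itv /= => /andP[zy _].
  by apply: stieltjes_continuous; lra.
have vx : Num.min (h z) (h w) <= x^-1 <= Num.max (h z) (h w).
  rewrite ge_min le_max; apply/andP; split; apply/orP; [right|left].
    by rewrite -[x^-1]mul1r ler_pdivlMr.
  by rewrite -[x^-1]mul1r ler_pdivrMr.
have [c] := IVT (ltW zw) cont vx; rewrite in_itv /= => /andP[zc _] hc.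
by exists c; [lra|rewrite hc mulVf // gt_eqF].
Qed.

(** [sigma x] is the solution of [h z * x = 1], or [b] if there is none. Only its position relative
    to levels [z > b] is kept. *)
Lemma outlier_exists : exists sigma : R -> R, forall x, b <= sigma x /\
  forall z, b < z ->
    (z < sigma x) = (1 < h z * x) /\ (sigma x == z) = (h z * x == 1).
Proof.
suff /choice[sigma hs] : forall x, exists s, b <= s /\ forall z, b < z ->
    (z < s) = (1 < h z * x) /\ (s == z) = (h z * x == 1) by exists sigma.
move=> x; have [[s bs es]|h1] := solution_dichotomy x; last first.
  exists b; split=> // z bz; rewrite ltNge (ltW bz) (lt_eqF bz) (lt_eqF (h1 z bz)).
  by split=> //; apply/esym/negbTE; rewrite -leNgt ltW // h1.
have x0 : 0 < x by rewrite -(pmulr_rgt0 _ (stieltjes_gt0 bs)) es.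
exists s; split=> [|z bz]; first exact: ltW.
have [zs|sz|->] := ltgtP z s.
- have : h s * x < h z * x by rewrite ltr_pM2r //; exact: stieltjes_decr.
  by rewrite es => h1; rewrite h1 gt_eqF.
- have : h z * x < h s * x by rewrite ltr_pM2r //; exact: stieltjes_decr.
  by rewrite es => h1; rewrite (lt_eqF h1) ltNge (ltW h1).
by rewrite es ltxx eqxx.
Qed.

End Stieltjes.

(** * Multiplicity of the zeros *)

Section Multiplicity.
Variables (R : realType) (b : R).
Variable h : nat -> R -> R.
Hypothesis dh : forall k z, b < z -> is_derive z 1 (h k) (- k.+1%:R * h k.+1 z).

(** Polynomial expressions in the [h k]: a class closed under differentiation on [z > b], which
    supplies all iterated derivatives without a general smoothness theory. *)
Inductive jet : (R -> R) -> Prop :=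
| jet_cst c : jet (fun=> c)
| jet_h k : jet (h k)
| jet_add f g : jet f -> jet g -> jet (fun z => f z + g z)
| jet_mul f g : jet f -> jet g -> jet (fun z => f z * g z).

Lemma jet_derive f : jet f ->
  exists2 f', jet f' & forall z, b < z -> is_derive z 1 f (f' z).
Proof.
elim=> [c|k|f1 g1 _ [f' jf' df] _ [g' jg' dg]|f1 g1 jf [f' jf' df] jg [g' jg' dg]].
- by exists (fun=> 0); [exact: jet_cst|move=> z _; exact: is_derive_cst].
- exists (fun z => - k.+1%:R * h k.+1 z); last by move=> z /(dh k).
  exact: jet_mul (jet_cst _) (jet_h _).
- exists (fun z => f' z + g' z); first exact: jet_add.
  by move=> z bz; exact: (@is_deriveD _ _ _ f1 g1 z 1 _ _ (df z bz) (dg z bz)).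
exists (fun z => f1 z * g' z + g1 z * f' z).
  by apply: jet_add; exact: jet_mul.
move=> z bz; exact: (@is_deriveM _ _ f1 g1 z 1 _ _ (df z bz) (dg z bz)).
Qed.

Lemma near_gt_b z (Q : R -> Prop) : b < z -> (forall y, b < y -> Q y) ->
  \forall y \near z, Q y.
Proof.
move=> bz hQ; apply: filterS hQ _; exact: lt_nbhsr.
Qed.

(** Differentiating [u ^+ n.+1 * v] lowers the power by one and yields the new cofactor
    [n.+1 * u' * v + u * v'], still a jet and nonzero at [z0]. *)
Lemma zero_mult_power (u v f : R -> R) n (z0 : R) : b < z0 ->
  jet u -> jet v -> u z0 = 0 -> (forall u', (forall z, b < z -> is_derive z 1 u (u' z)) ->
    u' z0 != 0) ->
  v z0 != 0 -> (forall z, b < z -> f z = u z ^+ n * v z) -> zero_mult f z0 n.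
Proof.
move=> bz ju jv u0 u'0; have [u' ju' du] := jet_derive ju.
elim: n v jv f => [|n IH] v jv f v0 fE.
  by split=> //=; rewrite fE // expr0 mul1r; exact/eqP.
have [v' jv' dv] := jet_derive jv.
pose v2 z := n.+1%:R * u' z * v z + u z * v' z.
have jv2 : jet v2.
  by apply: jet_add; apply: jet_mul => //; apply: jet_mul => //; exact: jet_cst.
have df z : b < z -> derive1 f z = u z ^+ n * v2 z.
  move=> bz'; rewrite derive1E.
  have d1 : is_derive z 1 (fun z => u z ^+ n.+1 * v z) (u z ^+ n * v2 z).
    have dz := du z bz'; have dzv := dv z bz'.
    have dp := is_deriveX n.+1 dz.
    have eX : u ^+ n.+1 = (fun z => u z ^+ n.+1) by apply/funext => y; rewrite fctE.
    rewrite eX in dp.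
    have := @is_deriveM _ _ _ _ _ _ _ _ dp dzv.
    move=> /is_derive_eq; apply; rewrite /= /GRing.scale /= /v2 exprS; ring.
  (* The formula for [f] is known only above [b], which is enough near a point above [b]. *)
  rewrite (near_eq_derive (g := fun z => u z ^+ n.+1 * v z)).
    exact: derive_val.
  exact: near_gt_b.
have v20 : v2 z0 != 0.
  by rewrite /v2 u0 mul0r addr0 !mulf_neq0 ?u'0.
have [h1 h2] := IH v2 jv2 _ v20 df.
split=> [[|j] jn|].
- by rewrite /= fE // u0 expr0n mul0r.
- by rewrite derive1Sn; exact: h1.
by rewrite derive1Sn.
Qed.

(** The count may be 0: then the conclusion says that [f z0] is nonzero, so the same statement
    excludes further zeros. *)
Lemma zero_mult_prod (f : R -> R) (c : R) (s : seq R) (z0 : R) : b < z0 -> c != 0 ->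
  h 1 z0 != 0 -> (forall z, b < z -> f z = c * \prod_(x <- s) (1 - h 0 z * x)) ->
  zero_mult f z0 (count (fun x => h 0 z0 * x == 1) s).
Proof.
move=> bz c0 h10 fE; pose u z := h 0 z + - h 0 z0.
have ju : jet u by apply: jet_add; [exact: jet_h|exact: jet_cst].
have [v jv [v0 vE]] : exists2 v, jet v & v z0 != 0 /\ forall z,
    \prod_(x <- s) (1 - h 0 z * x) =
      u z ^+ (count (fun x => h 0 z0 * x == 1) s) * v z.
  clear fE; elim: s => [|x s [v jv [v0 vE]]].
    exists (fun=> 1); first exact: jet_cst.
    by split=> [|z]; rewrite ?oner_neq0 // big_nil mul1r.
  have [hx|hx] := eqVneq (h 0 z0 * x) 1.
    have x0 : x != 0 by apply: contra_eq_neq hx => ->; rewrite mulr0 eq_sym oner_neq0.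
    (* If [h 0 z0 * x = 1], then [1 - h 0 z * x = - x * (h 0 z - h 0 z0)]. *)
    exists (fun z => - x * v z); first exact: jet_mul (jet_cst _) jv.
    split=> [|z]; first by rewrite mulf_neq0 ?oppr_eq0.
    rewrite big_cons vE /= hx eqxx add1n exprS -[X in X - _]hx /u; ring.
  exists (fun z => (1 + - 1 * (h 0 z * x)) * v z).
    apply: jet_mul => //; apply: jet_add; first exact: jet_cst.
    apply: jet_mul; first exact: jet_cst.
    by apply: jet_mul; [exact: jet_h|exact: jet_cst].
  split=> [|z]; first by rewrite mulf_neq0 // mulN1r subr_eq0 eq_sym.
  by rewrite big_cons vE /= (negPf hx) add0n; ring.
apply: (@zero_mult_power u (fun z => c * v z)) => //.
- exact: jet_mul (jet_cst _) jv.
- exact: subrr.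
- move=> u' du; have d0 := dh 0 bz.
  have d1 : is_derive z0 1 u (- 1%:R * h 1 z0).
    have := @is_deriveD _ _ _ (h 0) (fun=> - h 0 z0) z0 1 _ _ d0 (is_derive_cst _ _ _).
    by move=> /is_derive_eq; apply; rewrite addr0.
  have := @derive_val _ _ _ _ _ _ _ (du z0 bz).
  rewrite (@derive_val _ _ _ _ _ _ _ d1) => <-.
  by rewrite mulN1r oppr_eq0.
- by rewrite mulf_neq0.
by move=> z bz'; rewrite fE // vE; ring.
Qed.

End Multiplicity.

Section Lists.
Variable R : realType.

(** The discarded entries all equal [b] and come last, so the default value [b] restores them. *)
Lemma nth_filter_gt (b : R) (L : seq R) j : sorted >=%R L -> (forall x, x \in L -> b <= x) ->
  nth b [seq x <- L | b < x] j = nth b L j.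
Proof.
elim: L j => [//|x L IH] j /= hs hb.
have tr : transitive (>=%R : rel R) by move=> y u z h1 h2; exact: le_trans h2 h1.
have hL := path_sorted hs.
have [bx|xb] := ltP b x.
  by case: j => //= j; apply: IH => // y yL; apply: hb; rewrite inE yL orbT.
have all_b y : y \in x :: L -> y = b.
  move=> yL; apply/eqP; rewrite eq_le hb // andbT (le_trans _ xb) //.
  move: yL; rewrite inE => /predU1P[->//|yL].
  by have /allP := order_path_min tr hs; apply.
have -> : [seq y <- L | b < y] = [::].
  apply/eqP; rewrite -size_eq0 size_filter -leqn0 leqNgt -has_count.
  by apply/hasPn => y yL; rewrite (all_b y) ?ltxx // inE yL orbT.
rewrite nth_nil; case: (ltnP j (size (x :: L))) => [jL|Lj].
  by rewrite (all_b (nth b (x :: L) j)) // mem_nth.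
by rewrite nth_default.
Qed.

Lemma avoid_finite (u v : R) (s : seq R) : u < v ->
  exists2 z, u < z < v & z \notin s.
Proof.
move=> uv; suff [u' [v' [h1 h2 h3 h4]]] : exists u' v', [/\ u <= u', u' < v', v' <= v &
    forall z, z \in s -> ~~ (u' < z < v')].
  exists ((u' + v') / 2); first by apply/andP; split; lra.
  by apply/negP => /h4/negP; apply; apply/andP; split; lra.
elim: s => [|x s [u' [v' [h1 h2 h3 h4]]]]; first by exists u, v.
have [xm|mx] := leP x ((u' + v') / 2).
  exists ((u' + v') / 2), v'; split=> //; try lra.
  move=> z; rewrite inE => /predU1P[->|/h4]; first by rewrite ltNge xm.
  apply: contraNN => /andP[z1 z2]; apply/andP; split; lra.
exists u', ((u' + v') / 2); split=> //; try lra.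
move=> z; rewrite inE => /predU1P[->|/h4]; first by rewrite [X in _ && X]ltNge (ltW mx) andbF.
apply: contraNN => /andP[z1 z2]; apply/andP; split; lra.
Qed.

End Lists.

(** * Measurability of eigenvalues *)

Section OpenPreimage.
Context {R : realType} d (Omega : measurableType d) (J : finType).

(** An open set of finitely many coordinates is the countable union of the rational boxes it
    contains. *)
Lemma measurable_open_preimage (xi : Omega -> J -> R) (O : set (J -> R)) :
  (forall j, measurable_fun setT (fun w => xi w j)) ->
  (forall v, O v -> exists2 e : R, 0 < e & forall u, (forall j, `|u j - v j| < e) -> O u) ->
  measurable [set w | O (xi w)].
Proof.
move=> mxi hO.
pose box (qn : {ffun J -> rat} * nat) : set (J -> R) :=
  [set u | forall j, `|u j - ratr (qn.1 j)| < qn.2.+1%:R^-1].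
pose F (k : nat) : set Omega := if choice.unpickle k is Some qn then
  if `[< box qn `<=` O >] then [set w | box qn (xi w)] else set0 else set0.
have mF k : measurable (F k).
  rewrite /F; case: choice.unpickle => [qn|] //; case: ifP => // _.
  have -> : [set w | box qn (xi w)] =
      \bigcap_(j in [set: J]) [set w | `|xi w j - ratr (qn.1 j)| < qn.2.+1%:R^-1].
    by apply/seteqP; split=> w /= h j => [_|]; exact: h.
  apply: fin_bigcap_measurable => // j _.
  rewrite (_ : [set w | _] =
      ~` [set w | qn.2.+1%:R^-1 <= `|xi w j - ratr (qn.1 j)|]); last first.
    by apply/seteqP; split=> w /=; rewrite ltNge => /negP.
  apply: measurableC; rewrite -[X in measurable X]setTI; apply: measurable_fun_le => //.
  by apply: measurableT_comp => //; apply: measurable_funB.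
rewrite (_ : [set w | O (xi w)] = \bigcup_k F k); first exact: bigcup_measurable.
apply/seteqP; split=> w /=; last first.
  move=> [k _]; rewrite /F; case: choice.unpickle => [qn|] //.
  by case: ifP => // /asboolP sub /sub.
move=> /hO[e e0 he].
have [n hn] : exists n : nat, n.+1%:R^-1 < e / 2.
  have e2 : 0 < e / 2 by rewrite divr_gt0.
  have [n _ /(_ n (leqnn n)) hn] := near_infty_natSinv_lt (PosNum e2).
  by exists n.
have w0 : 0 < n.+1%:R^-1 :> R by rewrite invr_gt0.
have /choice[q hq] : forall j, exists q : rat, `|xi w j - ratr q| < n.+1%:R^-1.
  move=> j.
  have yn : xi w j < xi w j + n.+1%:R^-1 by rewrite ltrDl.
  have [q] := rat_in_itvoo yn; rewrite in_itv /= => /andP[h1 h2].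
  by exists q; rewrite ltr_norml; apply/andP; split; move: (n.+1%:R^-1) w0 h2 => t; lra.
pose qf := [ffun j => q j].
exists (choice.pickle (qf, n)); first exact: I.
rewrite /F choice.pickleK ifT; last first.
  apply/asboolP => u hu; apply: he => j.
  have := hu j; have := hq j; rewrite /= ffunE.
  move: (ratr (q j)) (n.+1%:R^-1) hn => t s hs h1 h2.
  rewrite (_ : u j - xi w j = (u j - t) - (xi w j - t)); last by ring.
  by apply: (le_lt_trans (ler_normB _ _)); lra.
by move=> j /=; rewrite ffunE; exact: hq.
Qed.

End OpenPreimage.

Section MeasurableEig.
Context {R : realType} d (Omega : measurableType d).
Local Notation C := R[i].

Definition cmeasurable (f : Omega -> C) :=
  measurable_fun setT (fun w => complex.Re (f w)) /\
  measurable_fun setT (fun w => complex.Im (f w)).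

Lemma cmeasurable_cst c : cmeasurable (fun=> c).
Proof. by split; exact: measurable_cst. Qed.

Lemma cmeasurableD f g : cmeasurable f -> cmeasurable g ->
  cmeasurable (fun w => f w + g w).
Proof.
move=> [f1 f2] [g1 g2]; split.
  rewrite (_ : (fun w => _) = (fun w => complex.Re (f w) + complex.Re (g w))).
    exact: measurable_funD.
  by apply/funext => w; rewrite raddfD.
rewrite (_ : (fun w => _) = (fun w => complex.Im (f w) + complex.Im (g w))).
  exact: measurable_funD.
by apply/funext => w; rewrite raddfD.
Qed.

Lemma cmeasurableM f g : cmeasurable f -> cmeasurable g ->
  cmeasurable (fun w => f w * g w).
Proof.
move=> [f1 f2] [g1 g2]; split.
  rewrite (_ : (fun w => _) = (fun w => complex.Re (f w) * complex.Re (g w) -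
      complex.Im (f w) * complex.Im (g w))).
    by apply: measurable_funB; exact: measurable_funM.
  by apply/funext => w; case: (f w) => x y; case: (g w).
rewrite (_ : (fun w => _) = (fun w => complex.Re (f w) * complex.Im (g w) +
    complex.Im (f w) * complex.Re (g w))).
  by apply: measurable_funD; exact: measurable_funM.
by apply/funext => w; case: (f w) => x y; case: (g w).
Qed.

Lemma cmeasurable_conj f : cmeasurable f -> cmeasurable (fun w => conjc (f w)).
Proof.
move=> [f1 f2]; split.
  by rewrite (_ : (fun w => _) = (fun w => complex.Re (f w))) //;
     apply/funext => w; case: (f w).
rewrite (_ : (fun w => _) = (fun w => - complex.Im (f w))); first exact: measurable_funN.
by apply/funext => w; case: (f w).
Qed.

Lemma cmeasurable_real (f : Omega -> R) : measurable_fun setT f ->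
  cmeasurable (fun w => (f w)%:C).
Proof. by move=> mf; split=> //; exact: measurable_cst. Qed.

Lemma cmeasurable_sum (I : Type) (s : seq I) (F : I -> Omega -> C) :
  (forall i, cmeasurable (F i)) -> cmeasurable (fun w => \sum_(i <- s) F i w).
Proof.
move=> hF; elim: s => [|i s IH].
  rewrite (_ : (fun w => _) = fun=> 0); first exact: cmeasurable_cst.
  by apply/funext => w; rewrite big_nil.
rewrite (_ : (fun w => _) = (fun w => F i w + \sum_(j <- s) F j w)).
  exact: cmeasurableD.
by apply/funext => w; rewrite big_cons.
Qed.

Definition mxmeasurable m n (A : Omega -> 'M[C]_(m, n)) :=
  forall i j, cmeasurable (fun w => A w i j).

Lemma mxmeasurableD m n (A B : Omega -> 'M[C]_(m, n)) :
  mxmeasurable A -> mxmeasurable B -> mxmeasurable (fun w => A w + B w).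
Proof.
move=> mA mB i j; rewrite (_ : (fun w => _) = (fun w => A w i j + B w i j)).
  exact: cmeasurableD.
by apply/funext => w; rewrite mxE.
Qed.

Lemma mxmeasurable_cst m n (A : 'M[C]_(m, n)) : mxmeasurable (fun=> A).
Proof. by move=> i j; exact: cmeasurable_cst. Qed.

Lemma mxmeasurableZ m n (a : Omega -> C) (A : Omega -> 'M[C]_(m, n)) :
  cmeasurable a -> mxmeasurable A -> mxmeasurable (fun w => a w *: A w).
Proof.
move=> ma mA i j; rewrite (_ : (fun w => _) = (fun w => a w * A w i j)).
  exact: cmeasurableM.
by apply/funext => w; rewrite mxE.
Qed.

Lemma mxmeasurableM m n p (A : Omega -> 'M[C]_(m, n)) (B : Omega -> 'M[C]_(n, p)) :
  mxmeasurable A -> mxmeasurable B -> mxmeasurable (fun w => A w *m B w).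
Proof.
move=> mA mB i j; rewrite (_ : (fun w => _) = (fun w => \sum_k A w i k * B w k j)).
  by apply: cmeasurable_sum => k; exact: cmeasurableM.
by apply/funext => w; rewrite mxE.
Qed.

Lemma mxmeasurable_ctr m n (A : Omega -> 'M[C]_(m, n)) :
  mxmeasurable A -> mxmeasurable (fun w => ctr (A w)).
Proof.
move=> mA i j; rewrite (_ : (fun w => _) = (fun w => conjc (A w j i))).
  exact: cmeasurable_conj.
by apply/funext => w; rewrite !mxE.
Qed.

Lemma mxmeasurable_sum (I : Type) (s : seq I) m n (A : I -> Omega -> 'M[C]_(m, n)) :
  (forall i, mxmeasurable (A i)) -> mxmeasurable (fun w => \sum_(i <- s) A i w).
Proof.
move=> mA i j; rewrite (_ : (fun w => _) = (fun w => \sum_(k <- s) A k w i j)).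
  by apply: cmeasurable_sum => k; exact: mA.
by apply/funext => w; rewrite summxE.
Qed.

(** Openness of [c < eig] holds among Hermitian matrices only. The entries are therefore symmetrized
    by [H], which is defined on all arrays of numbers and leaves each [A w] unchanged. *)
Lemma measurable_eig n (A : Omega -> 'M[C]_n) j :
  mxmeasurable A -> (forall w, herm (A w)) -> measurable_fun setT (fun w => eig (A w) j).
Proof.
move=> mA hA; have [jn|nj] := ltnP j n; last first.
  rewrite (_ : (fun w => _) = fun=> 0); first exact: measurable_cst.
  by apply/funext => w; rewrite /eig nth_default // size_eigs.
apply: measurable_fun_gt => c.
pose M (v : 'I_n * 'I_n * bool -> R) : 'M[C]_n :=
  \matrix_(i, k) (v (i, k, false) +i* v (i, k, true)).
pose H (v : 'I_n * 'I_n * bool -> R) : 'M[C]_n := (2^-1)%:C *: (M v + ctr (M v)).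
have hH v : herm (H v) by rewrite /herm /H ctrZ conj_RC ctrD ctrK addrC.
pose xi w (ikb : 'I_n * 'I_n * bool) : R :=
  if ikb.2 then complex.Im (A w ikb.1.1 ikb.1.2) else complex.Re (A w ikb.1.1 ikb.1.2).
have Mxi w : M (xi w) = A w.
  by apply/matrixP => i k; rewrite mxE /xi /=; case: (A w i k).
have Hxi w : H (xi w) = A w.
  rewrite /H Mxi hA; apply/matrixP => i k; rewrite 2!mxE.
  case: (A w i k) => x y; apply/eqP; rewrite eq_complex /=.
  by apply/andP; split; apply/eqP; field.
rewrite (_ : [set w | c < eig (A w) j] = [set w | [set v | c < eig (H v) j] (xi w)]);
  last by apply/seteqP; split=> w /=; rewrite Hxi.
apply: measurable_open_preimage => [[[i k] [|]]|v /= cv].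
- by have [] := mA i k.
- by have [] := mA i k.
have [e e0 he] := eig_gt_stable (hH v) jn cv.
(* By [qf_entry_bound] a change of entries by [t] costs [2 * n * t <= e]; the added 1 covers
   [n = 0]. *)
pose t := e / (2 * n%:R + 1).
have n0 : 0 <= n%:R :> R by [].
have t0 : 0 < t by rewrite divr_gt0 //; lra.
exists t; [exact: t0|move=> u huv].
rewrite (_ : H u = H v + (H u - H v)); last by rewrite addrC subrK.
apply: he; first by rewrite /herm ctrB !hH.
move=> x; apply: (le_trans (qf_entry_bound (e := t) _ x)); last first.
  rewrite ler_wpM2r ?nsq_ge0 // /t mulrA ler_pdivrMr; nra.
move=> i k.
have e1 : (H u - H v) i k = (2^-1)%:C * ((M u i k - M v i k) + conjc (M u k i - M v k i)).
  rewrite rmorphB /= mxE [(H u) i k]mxE [(- H v) i k]mxE [(H v) i k]mxE.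
  rewrite [(M u + _) i k]mxE [(M v + _) i k]mxE ![ctr _ i k]mxE ![map_mx _ _ _ _]mxE.
  ring.
have m1 := huv (i, k, false); have m2 := huv (i, k, true).
have m3 := huv (k, i, false); have m4 := huv (k, i, true).
rewrite e1 !mxE /=; move: m1 m2 m3 m4; rewrite !ltr_norml !ler_norml.
move=> /andP[? ?] /andP[? ?] /andP[? ?] /andP[? ?].
by split; apply/andP; split; rewrite /= ?mul0r ?subr0 ?addr0; lra.
Qed.

End MeasurableEig.

(** * Almost sure convergence and zeros of the rate function *)

Section LimSup.
Context {R : realType}.
Local Open Scope ereal_scope.

Lemma limn_esup_le_near (u : (\bar R)^nat) (l : \bar R) N :
  (forall n, (N <= n)%N -> u n <= l) -> limn_esup u <= l.
Proof.
move=> h; apply: (@le_trans _ _ (ereal_sup (u @` [set n | (N <= n)%N]))).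
  apply: ereal_inf_lbound; exists [set n | (N <= n)%N] => //.
  exact: nbhs_infty_ge.
by apply: ge_ereal_sup => _ [n /h hn <-].
Qed.

Lemma limn_esup_ge_near (u : (\bar R)^nat) (l : \bar R) N :
  (forall n, (N <= n)%N -> l <= u n) -> l <= limn_esup u.
Proof.
move=> h; apply: le_ereal_inf_tmp => _ [A [M _ hM] <-].
apply: (le_trans (h _ (leq_maxl N M))); apply: ereal_sup_ubound.
by exists (maxn N M) => //; apply: hM; exact: leq_maxr.
Qed.

End LimSup.

Section BorelCantelli.
Context {R : realType} d (Omega : measurableType d) (P : probability Omega R).

Lemma exp_small_series (kappa K : R) : 0 < kappa -> 0 <= K ->
  (\sum_(n <oo) (K * expR (- (kappa * n%:R)))%:E < +oo)%E.
Proof.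
move=> k0 K0; pose q := expR (- kappa).
have q1 : q < 1 by rewrite -expR0 ltr_expR oppr_lt0.
have q0 : 0 < q by exact: expR_gt0.
have qn n : expR (- (kappa * n%:R)) = q ^+ n.
  by rewrite /q -expRM_natl; congr expR; ring.
apply: (@le_lt_trans _ _ (K / (1 - q))%:E); last exact: ltry.
apply: lime_le.
  by apply: is_cvg_nneseries => n _ _; rewrite lee_fin mulr_ge0 // expR_ge0.
apply: nearW => n; rewrite sumEFin lee_fin; under eq_bigr => k _ do rewrite qn.
rewrite -mulr_sumr ler_wpM2l // big_mkord.
have := subrX1 q n; rewrite (_ : q ^+ n - 1 = - (1 - q ^+ n)); last by ring.
rewrite (_ : q - 1 = - (1 - q)); last by ring.
rewrite mulNr => /oppr_inj e; rewrite -[leRHS]mul1r ler_pdivlMr ?subr_gt0 // mulrC -e.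
by rewrite gerBl exprn_ge0 // ltW.
Qed.

Lemma exp_small_limsup (B : nat -> set Omega) : exp_small P B ->
  P.-negligible (lim_sup_set B).
Proof.
move=> [kappa [K [k0 K0 h]]].
have /choice[B' hB'] := h.
exists (lim_sup_set B'); split.
- apply: bigcap_measurable => // n _; apply: bigcup_measurable => k _.
  by have [] := hB' k.
- apply: lim_sup_set_cvg0 => [k|]; first by have [] := hB' k.
  apply: (le_lt_trans _ (exp_small_series k0 K0)).
  apply: lee_nneseries => [n _ _|n _]; first exact: measure_ge0.
  by have [] := hB' n.
move=> w hw n _; have [k nk Bk] := hw n I; exists k => //.
by have [_ sub _] := hB' k; exact: sub.
Qed.

(** Borel-Cantelli for each tolerance [1 / (k + 1)] and each coordinate; the countable union of
    exceptional sets is negligible. *)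
Lemma as_cvg (m : nat) (Y : nat -> Omega -> 'rV[R]_m) (pt : 'rV[R]_m) :
  (forall j e, 0 < e -> exp_small P (fun n => [set w | e <= `|Y n w 0 j - pt 0 j|])) ->
  {ae P, forall w, (fun n => Y n w) @ \oo --> pt}.
Proof.
move=> conc.
pose N (k : nat) := \bigcup_(j in [set: 'I_m])
  lim_sup_set (fun n => [set w | k.+1%:R^-1 <= `|Y n w 0 j - pt 0 j|]).
have nN k : P.-negligible (N k).
  have e0 : 0 < k.+1%:R^-1 :> R by rewrite invr_gt0.
  have := exp_small_limsup (exp_small_finite (fun j => conc j _ e0)).
  apply: negligibleS => w [j _ hw] n _; have [i ni hi] := hw n I.
  by exists i => //; exists j.
apply: (negligibleS _ (negligible_bigcup nN)) => w; apply: contra_notP => hN.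
apply/cvg_ballP => e e0.
have [k hk] : exists k : nat, k.+1%:R^-1 < e.
  have [k _ /(_ k (leqnn k)) hk] := near_infty_natSinv_lt (PosNum e0).
  by exists k.
have hj (j : 'I_m) : \forall n \near \oo, `|Y n w 0 j - pt 0 j| < e.
  have : ~ lim_sup_set (fun n => [set w | k.+1%:R^-1 <= `|Y n w 0 j - pt 0 j|]) w.
    by move=> hl; apply: hN; exists k => //; exists j.
  move=> /existsNP[n0] /not_implyP[_ hn0]; exists n0 => // n /= n0n.
  apply: (lt_trans _ hk); rewrite ltNge; apply/negP => hle.
  by apply: hn0; exists n.
have : \forall n \near \oo, forall j, `|Y n w 0 j - pt 0 j| < e.
  by apply: filter_forall.
apply: filterS => n hn; split=> // i j; rewrite ord1 /ball /= distrC.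
exact: hn.
Qed.

End BorelCantelli.

(** * Zeros of the rate function *)

Section RateFunction.
Context {R : realType} d (Omega : measurableType d) (P : probability Omega R).
Variables (m : nat) (Y : nat -> Omega -> 'rV[R]_m) (pt : 'rV[R]_m).
Hypothesis mY : forall n j, measurable_fun setT (fun w => Y n w 0 j).
Hypothesis conc : forall j e, 0 < e ->
  exp_small P (fun n => [set w | e <= `|Y n w 0 j - pt 0 j|]).

Lemma elog_le (x : \bar R) (y : R) : (0 <= x)%E -> 0 < y -> (x <= y%:E)%E ->
  (elog x <= (ln y)%:E)%E.
Proof.
move=> x0 y0 xy; rewrite /elog; case: eqP => [_|/eqP xn]; first exact: leNye.
case: x x0 xy xn => [x| |] //; rewrite !lee_fin eqe => x0 xy xn.
by rewrite ler_ln ?posrE // lt_neqAle eq_sym xn.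
Qed.

Lemma elog_ge (x : \bar R) (y : R) : x \is a fin_num -> 0 < y -> (y%:E <= x)%E ->
  ((ln y)%:E <= elog x)%E.
Proof.
case: x => [x| |] // _ y0; rewrite lee_fin => yx; rewrite /elog eqe.
have x0 : 0 < x by exact: lt_le_trans yx.
by rewrite gt_eqF //= lee_fin ler_ln ?posrE.
Qed.

(** The normalized logarithm is at most [ln (K + 1) / n - kappa], hence at most [- kappa / 2] from
    [N] on. [K + 1] replaces [K], which may be 0. *)
Lemma exp_small_rate (A : nat -> set Omega) : (forall n, measurable (A n)) ->
  exp_small P A ->
  ~ (0 <= limn_einf (fun n => ((n%:R)^-1)%:E * elog (P (A n))))%E.
Proof.
move=> mA [kappa [K [k0 K0 h]]] h0.
have K1 : 0 < K + 1 by lra.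
pose N := (Num.trunc (2 * `|ln (K + 1)| / kappa)).+1.
have hN n : (N <= n)%N ->
    (((n%:R)^-1)%:E * elog (P (A n)) <= (- (kappa / 2))%:E)%E.
  move=> Nn; have n0 : 0 < n%:R :> R by rewrite ltr0n (leq_trans _ Nn).
  have PA : (P (A n) <= ((K + 1) * expR (- (kappa * n%:R)))%:E)%E.
    have [B' [mB sub PB]] := h n.
    apply: (@le_trans _ _ (P B')); first by apply: le_measure => //; apply: mem_set.
    apply: (le_trans PB); rewrite lee_fin ler_wpM2r ?expR_ge0 //; lra.
  have := elog_le (measure_ge0 _ _) _ PA; rewrite mulr_gt0 ?expR_gt0 // => /(_ isT).
  rewrite lnM ?posrE ?expR_gt0 // expRK => hl.
  have inv0 : (0 <= ((n%:R)^-1 : R)%:E)%E by rewrite lee_fin invr_ge0 ltW.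
  apply: (le_trans (lee_wpmul2l inv0 hl)); rewrite -EFinM lee_fin.
  rewrite mulrC ler_pdivrMr //.
  have : 2 * `|ln (K + 1)| / kappa < n%:R.
    by apply: (lt_le_trans (truncnS_gt _)); rewrite ler_nat.
  rewrite ltr_pdivrMr // => h1; have := ler_norm (ln (K + 1)).
  lra.
have h1 := limn_esup_le_near hN.
have h2 := limn_einf_sup (fun n => ((n%:R)^-1)%:E * elog (P (A n)))%E.
have := le_trans h0 (le_trans h2 h1); rewrite lee_fin; lra.
Qed.

Lemma open_coord_gt (j : 'I_m) (t : R) : open [set y : 'rV[R]_m | t < y 0 j].
Proof.
apply: (@open_comp _ _ (fun y : 'rV[R]_m => y 0 j) [set x | t < x]).
  by move=> y _; exact: coord_continuous.
exact: open_gt.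
Qed.

Lemma open_coord_lt (j : 'I_m) (t : R) : open [set y : 'rV[R]_m | y 0 j < t].
Proof.
apply: (@open_comp _ _ (fun y : 'rV[R]_m => y 0 j) [set x | x < t]).
  by move=> y _; exact: coord_continuous.
exact: open_lt.
Qed.

Lemma closed_box (e : R) : closed [set y : 'rV[R]_m | forall j, `|y 0 j - pt 0 j| <= e].
Proof.
rewrite (_ : [set y | _] = ~` \bigcup_(j in [set: 'I_m])
   ([set y : 'rV[R]_m | pt 0 j + e < y 0 j] `|` [set y | y 0 j < pt 0 j - e])).
  apply: open_closedC; apply: bigcup_open => j _.
  by apply: openU; [exact: open_coord_gt|exact: open_coord_lt].
apply/seteqP; split=> y /= h.
  by move=> [j _ /= [|]]; have := h j; rewrite ler_norml => /andP[]; lra.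
move=> j; rewrite ler_norml; apply/andP; split; rewrite leNgt; apply/negP => hlt;
  apply: h; exists j => //=; [right|left]; lra.
Qed.

(** The two bounds of the large deviation principle are used once each: the lower one excludes zeros
    away from [pt], the upper one produces the zero at [pt]. *)
Lemma rate_zero (L : 'rV[R]_m -> \bar R) :
  good_rate_function L -> LDP P Y L -> forall y, L y = 0%E <-> y = pt.
Proof.
move=> [L0 [Lcl _]] [LU LL].
have mgt n j t : measurable (Y n @^-1` [set y | t < y 0 j]).
  rewrite (_ : _ @^-1` _ = ~` [set w | Y n w 0 j <= t]); last first.
    by apply/seteqP; split=> w /=; rewrite ltNge => /negP.
  apply: measurableC; rewrite -[X in measurable X]setTI.
  exact: measurable_fun_le.
have mlt n j t : measurable (Y n @^-1` [set y | y 0 j < t]).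
  rewrite (_ : _ @^-1` _ = ~` [set w | t <= Y n w 0 j]); last first.
    by apply/seteqP; split=> w /=; rewrite ltNge => /negP.
  apply: measurableC; rewrite -[X in measurable X]setTI.
  exact: measurable_fun_le.
have zero_pt y : L y = 0%E -> y = pt.
  move=> Ly; apply/rowP => j; apply/eqP/negP => /negP yj.
  (* If [L y = 0], the lower bound makes the limit inferior for any open set containing [y]
     nonnegative. *)
  have no (G : set 'rV[R]_m) : open G -> G y -> (forall n, measurable (Y n @^-1` G)) ->
      ~ exp_small P (fun n => Y n @^-1` G).
    move=> oG Gy mG sm; apply: (exp_small_rate mG sm).
    apply: le_trans (LL G oG); rewrite oppe_ge0 -Ly.
    by apply: ereal_inf_lbound; exists y.
  (* The half-space cut midway between [y] and [pt] contains [y], and entering it means a deviation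
     of at least half their distance. *)
  have [lt|gt] : y 0 j < pt 0 j \/ pt 0 j < y 0 j.
    by case: (ltgtP (y 0 j) (pt 0 j)) yj => // h _; [left|right].
    apply: (no _ (@open_coord_lt j ((y 0 j + pt 0 j) / 2)) _ _ _).
    - by rewrite /=; lra.
    - by move=> n; exact: mlt.
    have e0 : 0 < (pt 0 j - y 0 j) / 2 by lra.
    apply: (@exp_smallS _ _ _ _ _ _ _ (conc j e0)) => n w /= h.
    by rewrite ler_normr; apply/orP; right; lra.
  apply: (no _ (@open_coord_gt j ((y 0 j + pt 0 j) / 2)) _ _ _).
  - by rewrite /=; lra.
  - by move=> n; exact: mgt.
  have e0 : 0 < (y 0 j - pt 0 j) / 2 by lra.
  apply: (@exp_smallS _ _ _ _ _ _ _ (conc j e0)) => n w /= h.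
  by rewrite ler_normr; apply/orP; left; lra.
move=> y; split=> [/zero_pt //|->].
apply/eqP; rewrite eq_le L0 andbT.
apply/lee_addgt0Pr => eta eta0; rewrite add0e.
(* The sublevel set equals its closure, so a point of it in every ball around [pt] suffices. *)
have [/(_ (Lcl eta)) cl _] := closure_id [set x | (L x <= eta%:E)%E].
suff : [set x | (L x <= eta%:E)%E] pt by [].
rewrite cl => B /nbhs_ballP[e /= e0 eB].
pose Fe := [set y : 'rV[R]_m | forall j, `|y 0 j - pt 0 j| <= e / 2].
have e2 : 0 < e / 2 by rewrite divr_gt0.
have mF n : measurable (Y n @^-1` Fe).
  rewrite (_ : _ @^-1` _ = \bigcap_(j in [set: 'I_m]) [set w | `|Y n w 0 j - pt 0 j| <= e / 2]).
    apply: fin_bigcap_measurable => // j _; rewrite -[X in measurable X]setTI.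
    apply: measurable_fun_le => //; apply: measurableT_comp => //.
    exact: measurable_funB.
  by apply/seteqP; split=> w /= h j => [_|]; exact: h.
have smC : exp_small P (fun n => ~` (Y n @^-1` Fe)).
  apply: (exp_smallS _ (exp_small_finite (fun j => conc j e2))) => n w /= /existsNP[j /negP].
  by rewrite -ltNge => /ltW h; exists j.
have inf0 : (ereal_inf (L @` Fe) <= 0)%E.
  apply/lee_addgt0Pr => t t0; rewrite add0e -leeN2 -EFinN.
  have [kappa [K [k0 K0 h]]] := smC.
  have := LU Fe (@closed_box (e / 2)); apply: le_trans.
  (* The first term makes the complement of the box have probability at most 1/2, through
     [1 + kappa * n <= expR (kappa * n)]; the second makes [ln 2 / n] at most [t]. *)
  pose N := maxn (Num.trunc (2 * K / kappa)).+1 (Num.trunc (`|ln (2^-1 : R)| / t)).+1.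
  apply: (@limn_esup_ge_near _ _ _ N) => n; rewrite geq_max => /andP[n1 n2].
  have n0 : 0 < n%:R :> R by rewrite ltr0n (leq_trans _ n1).
  have half : ((2^-1 : R)%:E <= P (Y n @^-1` Fe))%E.
    have [B' [mB sub PB]] := h n.
    have PC : (P (~` (Y n @^-1` Fe)) <= (2^-1 : R)%:E)%E.
      apply: (@le_trans _ _ (P B')).
        by apply: le_measure => //; apply: mem_set => //; exact: measurableC.
      apply: (le_trans PB); rewrite lee_fin expRN ler_pdivrMr ?expR_gt0 //.
      have := expR_ge1Dx (kappa * n%:R).
      have : 2 * K / kappa < n%:R.
        by apply: (lt_le_trans (truncnS_gt _)); rewrite ler_nat.
      rewrite ltr_pdivrMr //; lra.
    have := probability_setC P (mF n); move: PC => /[swap] ->.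
    case: (P (Y n @^-1` Fe)) (probability_le1 P (mF n)) (measure_ge0 P (Y n @^-1` Fe)).
    - move=> p _ _; rewrite -EFinB !lee_fin; lra.
    - by rewrite leye_eq.
    - by [].
  have Pfin : P (Y n @^-1` Fe) \is a fin_num by exact: fin_num_measure.
  have hl := elog_ge Pfin (_ : 0 < 2^-1) half.
  have inv0 : (0 <= ((n%:R)^-1 : R)%:E)%E by rewrite lee_fin invr_ge0 ltW.
  apply: (le_trans _ (lee_wpmul2l inv0 (hl _))); last by rewrite invr_gt0.
  rewrite -EFinM lee_fin mulrC ler_pdivlMr //.
  have : `|ln (2^-1 : R)| / t < n%:R.
    by apply: (lt_le_trans (truncnS_gt _)); rewrite ler_nat.
  rewrite ltr_pdivrMr // => h1; have := ler_norm (- ln (2^-1 : R)); rewrite normrN.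
  lra.
have : (ereal_inf (L @` Fe) < eta%:E)%E by apply: (le_lt_trans inf0); rewrite lte_fin.
move=> /ereal_inf_lt[_ [z Fz <-]] Lz.
exists z; split; first exact: ltW.
apply: eB; split=> // i j; rewrite ord1 /ball /= distrC (le_lt_trans (Fz j)) //; lra.
Qed.

End RateFunction.

(** * Concentration of the perturbed spectrum *)

Section Bulk.
Variables (R : realType) (x : forall n : nat, 'I_n -> R) (mu : probability R R) (a b : R).
Hypothesis weak_cvg : forall f : R -> R, continuous f -> (exists K : R, forall y, `|f y| <= K) ->
     (fun n : nat => (n%:R)^-1 * \sum_(k < n) f (x k)) @ \oo --> Rintegral mu setT f.
Hypothesis supp_b : msupport mu b.
Hypothesis supp_sub : msupport mu `<=` `[a, b].
Hypothesis top_cvg : (fun n : nat => eig (diag_mx (\row_k (x k)%:C) : 'M[R[i]]_n) 0) @ \oo --> b.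

Lemma bulk_upper (c : R) : b < c -> exists N, forall n, (N <= n)%N -> forall k : 'I_n, x k < c.
Proof.
move=> bc; have /cvgr_lt /(_ _ bc)[N _ hN] := top_cvg.
by exists N => n Nn k; apply: (le_lt_trans (eig_diag_ge _ k)); exact: hN.
Qed.

(** The kernel is unbounded, so weak convergence is applied to its truncation at [c]; this changes
    nothing on [[a, b]], nor at the points [x k] once [n] is large. *)
Lemma bulk_mean (z : R) : b < z ->
  (fun n : nat => (n%:R)^-1 * \sum_(k < n) (z - x k)^-1) @ \oo --> hpow mu a b 0 z.
Proof.
move=> bz; pose c := (b + z) / 2; have bc : b < c by rewrite /c; lra.
have cz : c < z by rewrite /c; lra.
pose f y := (z - Num.min y c)^-1.
have f0 y : 0 < z - Num.min y c by rewrite subr_gt0 (le_lt_trans _ cz) // ge_min lexx orbT.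
have cf : continuous f.
  move=> y; apply: cvgV; first by rewrite gt_eqF.
  apply: cvgB; first exact: cvg_cst.
  by apply: (@continuous_min R R (fun y : R => y) (fun=> c) y); [exact: cvg_id|exact: cvg_cst].
have bf : exists K : R, forall y, `|f y| <= K.
  exists (z - c)^-1 => y; rewrite gtr0_norm ?invr_gt0 // lef_pV2 ?posrE //; last lra.
  by rewrite lerD2l lerN2 ge_min lexx orbT.
have hE : Rintegral mu setT f = hpow mu a b 0 z.
  have mN : measurable (~` [set` `[a, b]] : set R) by exact: measurableC.
  have mf : measurable_fun setT f by exact: continuous_measurable_fun.
  have e0 : setT `\` ~` [set` `[a, b]] = [set` `[a, b]] :> set R by rewrite setTD setCK.
  have [K hK] := bf.
  have iT : mu.-integrable setT (EFin \o f).
    apply: measurable_bounded_integrable => //.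
      by rewrite (le_lt_trans (probability_le1 _ _)) ?ltry.
    exists K; split; first exact: num_real.
    by move=> M KM y _; exact: (le_trans (hK y) (ltW KM)).
  rewrite /Rintegral (negligible_integral mN measurableT iT (support_null supp_sub)) e0.
  congr fine; apply: eq_integral => l /set_mem; rewrite /= in_itv /= => /andP[_ lb].
  by rewrite expr1 /f; congr (_^-1)%:E; rewrite min_l //; lra.
have W : (fun n : nat => (n%:R)^-1 * \sum_(k < n) f (x k)) @ \oo --> hpow mu a b 0 z.
  by rewrite -hE; exact: (weak_cvg cf bf).
apply: cvg_trans W; apply: near_eq_cvg.
have [N hN] := bulk_upper bc; exists N => // n /= Nn.
by congr (_ * _); apply: eq_bigr => k _; rewrite /f min_l // ltW // hN.
Qed.

(** The ramp [f] rises from 0 at [b - e] to 1 at [b]. Its integral is positive because [b] is in the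
    support, so a positive proportion of the points lies above [b - e]. *)
Lemma bulk_count (e : R) (q : nat) : 0 < e ->
  exists N, forall n, (N <= n)%N -> (q <= #|[pred k : 'I_n | (b - e < x k)%R]|)%N.
Proof.
move=> e0; pose f y := Num.min 1 (Num.max 0 ((y - (b - e)) / e)).
have cf : continuous f.
  have c1 : continuous (fun y : R => (y - (b - e)) / e).
    move=> y; apply: cvgM; last exact: cvg_cst.
    by apply: cvgB; [exact: cvg_id|exact: cvg_cst].
  have c2 : continuous (fun y : R => Num.max 0 ((y - (b - e)) / e)).
    move=> y; apply: (@continuous_max R R (fun=> 0) (fun y : R => (y - (b - e)) / e) y).
      exact: cvg_cst.
    exact: c1.
  move=> y; apply: (@continuous_min R R (fun=> 1) (fun y : R => Num.max 0 ((y - (b - e)) / e)) y).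
    exact: cvg_cst.
  exact: c2.
have f0 y : 0 <= f y by rewrite /f le_min ler01 le_max lexx.
have f1 y : f y <= 1 by rewrite /f ge_min lexx.
have bf : exists K : R, forall y, `|f y| <= K by exists 1 => y; rewrite ger0_norm.
have mf : measurable_fun setT f by exact: continuous_measurable_fun.
pose B : set R := ball b (e / 2).
have mB : measurable B by exact: measurable_ball.
have e2 : 0 < e / 2 by rewrite divr_gt0.
have [K hK] := bf.
have iT : mu.-integrable setT (EFin \o f).
  apply: measurable_bounded_integrable => //.
    by rewrite (le_lt_trans (probability_le1 _ _)) ?ltry.
  exists K; split; first exact: num_real.
  by move=> M KM y _; exact: (le_trans (hK y) (ltW KM)).
have pos : 0 < Rintegral mu setT f.
  have muB : (0 < mu B)%E by exact: supp_b.
  have : ((2^-1)%:E * mu B <= \int[mu]_y (f y)%:E)%E.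
    rewrite (_ : mu B = \int[mu]_y (\1_B y)%:E)%E; last first.
      by rewrite (integral_indic mu measurableT mB) setIT.
    rewrite -ge0_integralZl_EFin //; last by apply/measurable_EFinP; exact: measurable_indic.
    apply: ge0_le_integral => //.
    - by apply/measurable_EFinP; apply: measurable_funM => //; exact: measurable_indic.
    - by apply/measurable_EFinP.
    move=> y _; rewrite -EFinM lee_fin indicE; case: (boolP (y \in B)) => [yB|_]; last by rewrite mulr0.
    move: yB => /set_mem; rewrite /B /ball /= ltr_norml => /andP[h1 h2].
    rewrite mulr1 /f le_min le_max ler_pdivlMr //; apply/andP; split; first lra.
    by apply/orP; right; lra.
  move=> h; rewrite -lte_fin fineK ?integrable_fin_num //; apply: lt_le_trans h.
  by rewrite mule_gt0 // lte_fin invr_gt0.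
have half : Rintegral mu setT f / 2 < Rintegral mu setT f by lra.
have /cvgr_gt /(_ _ half)[N _ hN] := weak_cvg cf bf.
pose I := Rintegral mu setT f.
exists (maxn N (Num.trunc (2 * q%:R / I)).+1) => n; rewrite geq_max => /andP[Nn n1].
have n0 : 0 < n%:R :> R by rewrite ltr0n (leq_trans _ n1).
have h1 := hN n Nn; rewrite -(ler_nat R).
have h2 : \sum_(k < n) f (x k) <= #|[pred k : 'I_n | (b - e < x k)%R]|%:R.
  rewrite -sum1_card natr_sum [leRHS]big_mkcond /=; apply: ler_sum => k _.
  rewrite inE; case: ltP => [//|xk]; rewrite /f ge_min ge_max lexx /=.
  by apply/orP; right; rewrite ler_pdivrMr // mul0r; lra.
apply: (le_trans _ h2).
have h3 : I / 2 * n%:R < \sum_(k < n) f (x k).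
  by rewrite -ltr_pdivlMr // [ltRHS]mulrC.
have : 2 * q%:R / I < n%:R.
  by apply: (lt_le_trans (truncnS_gt _)); rewrite ler_nat.
rewrite ltr_pdivrMr // -/I => h4.
lra.
Qed.

End Bulk.

Section Quadratic.
Context {R : realType} d (Omega : measurableType d).
Variables (P : probability Omega R) (r : nat) (g : nat -> 'I_r -> Omega -> R[i]).

Definition sample_mx n w : 'M[R[i]]_(n, r) :=
  ((Num.sqrt n%:R)^-1)%:C *: \matrix_(k < n, i < r) g k i w.

Lemma conj_RCM (a : R) (z : R[i]) : conjc (a%:C * z) = a%:C * conjc z.
Proof. by case: z => p q; congr (_ +i* _); ring. Qed.

Lemma sample_mxE n (a : 'I_n -> R) w i j :
  (ctr (sample_mx n w) *m diag_mx (\row_k (a k)%:C) *m sample_mx n w) i j =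
  ((n%:R)^-1)%:C * \sum_k (a k)%:C * (conjc (g k i w) * g k j w).
Proof.
rewrite mxE mulr_sumr; apply: eq_bigr => k _.
rewrite mul_mx_diag [X in X * _]mxE [X in _ * X * _]mxE.
rewrite [ctr _ _ _]mxE [map_mx _ _ _ _]mxE [sample_mx n w k i]mxE [sample_mx n w k j]mxE.
rewrite ![(\matrix_(_, _) _) _ _]mxE conj_RCM.
have -> : ((n%:R)^-1)%:C = ((Num.sqrt n%:R)^-1)%:C * ((Num.sqrt n%:R)^-1)%:C :> R[i].
  by rewrite -rmorphM /= -invfM -expr2 sqr_sqrtr ?ler0n.
ring.
Qed.

Lemma re_sample_mx n (a : 'I_n -> R) w i j :
  complex.Re ((ctr (sample_mx n w) *m diag_mx (\row_k (a k)%:C) *m sample_mx n w) i j) =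
  (n%:R)^-1 * \sum_k a k * complex.Re (conjc (g k i w) * g k j w).
Proof.
rewrite sample_mxE Re_mulr raddf_sum; congr (_ * _); apply: eq_bigr => k _.
exact: Re_mulr.
Qed.

Lemma Im_mulr (a : R) (z : R[i]) : complex.Im (a%:C * z) = a * complex.Im z.
Proof. by case: z => p q /=; rewrite mul0r addr0. Qed.

Lemma im_sample_mx n (a : 'I_n -> R) w i j :
  complex.Im ((ctr (sample_mx n w) *m diag_mx (\row_k (a k)%:C) *m sample_mx n w) i j) =
  (n%:R)^-1 * \sum_k a k * complex.Im (conjc (g k i w) * g k j w).
Proof.
rewrite sample_mxE Im_mulr raddf_sum; congr (_ * _); apply: eq_bigr => k _.
exact: Im_mulr.
Qed.

(** The error splits into a centred fluctuation and the error of the weights' mean times [c]; each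
    gets half of [e]. *)
Lemma weighted_mean_close n (a p : 'I_n -> R) (c abar s e : R) : (0 < n)%N ->
  `|\sum_k a k * (p k - c)| < n%:R * (e / 2) ->
  `|(n%:R)^-1 * \sum_k a k - abar| <= s -> `|c| * s <= e / 2 ->
  `|(n%:R)^-1 * \sum_k a k * p k - abar * c| <= e.
Proof.
move=> n0 h1 h2 h3; have n0' : 0 < n%:R :> R by rewrite ltr0n.
have -> : (n%:R)^-1 * \sum_k a k * p k - abar * c =
    (n%:R)^-1 * (\sum_k a k * (p k - c)) + c * ((n%:R)^-1 * \sum_k a k - abar).
  under [in RHS]eq_bigr => k _ do rewrite mulrBr.
  rewrite sumrB -mulr_suml; ring.
apply: (le_trans (ler_normD _ _)); rewrite !normrM normfV (ger0_norm (ltW n0')).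
have -> : e = e / 2 + e / 2 by field.
apply: lerD; first by rewrite ler_pdivrMl // ltW.
by apply: le_trans h3; rewrite ler_wpM2l.
Qed.

Hypothesis iid : iid_vecs P g.
Variable alpha : R.
Hypothesis alpha_gt0 : 0 < alpha.
Hypothesis exp_moment : (\int[P]_w (expR (alpha * \sum_i ((complex.Re (g 0%N i w)) ^+ 2
                                        + (complex.Im (g 0%N i w)) ^+ 2)))%:E < +oo)%E.

(** Closeness of the finitely many entries gives closeness of the form at all [u] at once, so no net
    on the sphere is needed. *)
Lemma exp_small_quadratic (a : forall n, 'I_n -> R) (abar A delta : R) (N : nat) :
  0 < A -> 0 < delta -> (forall n, (N <= n)%N -> forall k : 'I_n, `|a n k| <= A) ->
  (fun n : nat => (n%:R)^-1 * \sum_(k < n) a n k) @ \oo --> abar ->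
  exp_small P (fun n => [set w | ~ forall u,
    `|qf (ctr (sample_mx n w) *m diag_mx (\row_k (a n k)%:C) *m sample_mx n w
          - abar%:C *: Cstar P g) u| <= delta * nsq u]).
Proof.
move=> A0 d0 hA cvga.
(* [qf_entry_bound] loses a factor [2 * r]; the successor avoids a division by zero at [r = 0]. *)
pose e := delta / (2 * r.+1%:R).
have e0 : 0 < e by rewrite divr_gt0 // mulr_gt0.
(* The weights are set to 0 below [N] so that the bound [A] holds for every [n]. *)
pose b n k : R := if (N <= n)%N then
  (if insub k is Some k' then a n k' else 0) else 0.
have hb n k : (k < n)%N -> `|b n k| <= A.
  move=> kn; rewrite /b; case: leqP => [Nn|_]; last by rewrite normr0 ltW.
  by rewrite insubT hA.
have bE n (k : 'I_n) : (N <= n)%N -> b n k = a n k.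
  by move=> Nn; rewrite /b Nn valK.
have e20 : 0 < e / 2 by rewrite divr_gt0.
have small := exp_small_entries iid alpha_gt0 exp_moment A0 e20 hb.
pose B : R := 1 + \sum_i \sum_j (`|complex.Re (Cstar P g i j)| + `|complex.Im (Cstar P g i j)|).
have hB i j : `|complex.Re (Cstar P g i j)| <= B /\ `|complex.Im (Cstar P g i j)| <= B.
  have : `|complex.Re (Cstar P g i j)| + `|complex.Im (Cstar P g i j)| <= B.
    rewrite /B (bigD1 i) //= (bigD1 j) //=.
    set S1 := (X in _ + X + _); set S2 := (X in _ + _ + X).
    have : 0 <= S1 by apply: sumr_ge0 => ? _; exact: addr_ge0.
    have : 0 <= S2 by apply: sumr_ge0 => ? _; apply: sumr_ge0 => ? _; exact: addr_ge0.
    move=> h1 h2; lra.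
  have := normr_ge0 (complex.Re (Cstar P g i j)).
  have := normr_ge0 (complex.Im (Cstar P g i j)).
  by move=> h1 h2 h3; split; lra.
have B0 : 0 < B.
  rewrite /B ltr_pwDl // sumr_ge0 // => i _; apply: sumr_ge0 => j _; exact: addr_ge0.
pose s := e / 2 / B.
have s0 : 0 < s by rewrite divr_gt0.
have Bs c : `|c| <= B -> `|c| * s <= e / 2.
  by move=> cB; rewrite /s mulrCA ger_pMr // ler_pdivrMr // mul1r.
have /cvgrPdist_le /(_ _ s0)[N' _ hN'] := cvga.
apply: (exp_small_eventually (n0 := maxn N N'.+1) _ small) => n.
rewrite geq_max => /andP[Nn N'n] w /=.
apply: contra_notP => good u.
have n0 : (0 < n)%N by exact: leq_ltn_trans N'n.
have close : `|(n%:R)^-1 * (\sum_(k < n) a n k) - abar| <= s.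
  by rewrite distrC; apply: hN'; exact: ltnW.
have hij i j :
    `|\sum_(k < n) a n k * (complex.Re (conjc (g k i w) * g k j w) - complex.Re (Cstar P g i j))|
         < n%:R * (e / 2) /\
       `|\sum_(k < n) a n k * (complex.Im (conjc (g k i w) * g k j w) - complex.Im (Cstar P g i j))|
         < n%:R * (e / 2).
  have := contra_notP _ good => /(_ _ (fun h => ex_intro _ i (ex_intro _ j h))).
  by under eq_bigr => k _ do rewrite bE //;
     under [X in _ /\ `|X| < _]eq_bigr => k _ do rewrite bE //.
apply: le_trans (_ : 2 * r%:R * e * nsq u <= _); last first.
  rewrite ler_wpM2r ?nsq_ge0 // /e.
  rewrite (_ : 2 * r%:R * _ = delta * (r%:R / r.+1%:R)); last first.
    have : (r.+1)%:R != 0 :> R by rewrite pnatr_eq0.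
    by move: (r.+1)%:R => q q0; field.
  by rewrite ger_pMr // ler_pdivrMr // mul1r ler_nat.
apply: qf_entry_bound => i j; have [h1 h2] := hij i j; have [B1 B2] := hB i j.
have subE (X Y : 'M[R[i]]_r) c : (X - c *: Y) i j = X i j - c * Y i j by rewrite !mxE.
have reB (p q : R[i]) : complex.Re (p - q) = complex.Re p - complex.Re q by exact: raddfB.
have imB (p q : R[i]) : complex.Im (p - q) = complex.Im p - complex.Im q by exact: raddfB.
rewrite subE reB imB.
rewrite re_sample_mx im_sample_mx Re_mulr Im_mulr.
by split; apply: (weighted_mean_close n0 _ close) => //; exact: Bs.
Qed.

End Quadratic.

Section Covariance.
Context {R : realType} d (Omega : measurableType d).
Variable P : probability Omega R.

Lemma Rintegral_lincomb (I : Type) (s : seq I) (c : I -> R) (f : I -> Omega -> R) :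
  (forall i, P.-integrable setT (EFin \o f i)) ->
  P.-integrable setT (EFin \o (fun w => \sum_(i <- s) c i * f i w)) /\
  Rintegral P setT (fun w => \sum_(i <- s) c i * f i w) =
  \sum_(i <- s) c i * Rintegral P setT (f i).
Proof.
move=> hf; elim: s => [|i s [IH1 IH2]].
  under eq_fun do rewrite big_nil; rewrite big_nil Rintegral_cst // mul0r; split=> //.
  by apply: eq_integrable (integrable0 _ _) => // w _; rewrite /= big_nil.
have hZ : P.-integrable setT (EFin \o (fun w => c i * f i w)).
  exact: (integrableZl measurableT (c i) (hf i)).
under eq_fun do rewrite big_cons; rewrite big_cons -IH2; split.
  apply: eq_integrable (integrableD measurableT hZ IH1) => // w _.
by rewrite RintegralD // RintegralZl.
Qed.

Variables (r : nat) (g : nat -> 'I_r -> Omega -> R[i]).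
Hypothesis iid : iid_vecs P g.
Variable alpha : R.
Hypothesis alpha_gt0 : 0 < alpha.
Hypothesis exp_moment : (\int[P]_w (expR (alpha * \sum_i ((complex.Re (g 0%N i w)) ^+ 2
                                        + (complex.Im (g 0%N i w)) ^+ 2)))%:E < +oo)%E.

Lemma herm_Cstar : herm (Cstar P g).
Proof.
apply/matrixP => i j; rewrite [LHS]mxE [LHS]mxE; apply/eqP.
rewrite eq_complex.
have -> : complex.Re (conjc (Cstar P g j i)) = complex.Re (Cstar P g j i) by case: (Cstar _ _ _ _).
have -> : complex.Im (conjc (Cstar P g j i)) = - complex.Im (Cstar P g j i) by case: (Cstar _ _ _ _).
rewrite !Re_Cstar !Im_Cstar; apply/andP; split; apply/eqP.
  by apply: eq_Rintegral => w _; rewrite /psiRe mulrC [X in _ + X]mulrC.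
have iIm := integrable_psi (measurable_gcoords iid) (measurable_psiIm j i)
  (@measurable_vec_nsq R r) (psiIm_le j i) alpha_gt0 exp_moment.
rewrite -mulN1r -RintegralZl //.
by apply: eq_Rintegral => w _; rewrite /psiIm; ring.
Qed.

Let comb (v : 'rV[R[i]]_r) w : R := abs2 (\sum_i conjc (v 0 i) * g 0%N i w).

Lemma qf_re_im n (D : 'M[R[i]]_n) v : qf D v =
  \sum_(p : 'I_n * 'I_n) complex.Re (v 0 p.1 * conjc (v 0 p.2)) * complex.Re (D p.1 p.2) +
  \sum_(p : 'I_n * 'I_n) (- complex.Im (v 0 p.1 * conjc (v 0 p.2))) * complex.Im (D p.1 p.2).
Proof.
rewrite -big_split /= -(pair_bigA _ (fun i j =>
  complex.Re (v 0 i * conjc (v 0 j)) * complex.Re (D i j) +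
  (- complex.Im (v 0 i * conjc (v 0 j))) * complex.Im (D i j))) exchange_big /=.
rewrite /qf mxE raddf_sum; apply: eq_bigr => j _.
rewrite [ctr _ _ _]mxE [map_mx _ _ _ _]mxE [(v *m D) _ _]mxE mulr_suml raddf_sum.
apply: eq_bigr => i _; rewrite mulrAC.
by case: (v 0 i * _) => p q; case: (D i j) => p' q' /=; rewrite mulNr.
Qed.

Lemma qf_outer n (h : 'I_n -> R[i]) v :
  qf (\matrix_(i, j) (conjc (h i) * h j)) v = abs2 (\sum_i conjc (v 0 i) * h i).
Proof.
pose G : 'rV[R[i]]_n := \row_i h i.
have -> : \matrix_(i, j) (conjc (h i) * h j) = ctr G *m G.
  by apply/matrixP => i j; rewrite !mxE big_ord1 !mxE.
have -> : qf (ctr G *m G) v = nsq (v *m ctr G) by rewrite /qf /nsq ctrM ctrK !mulmxA.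
rewrite nsqE big_ord1 mxE.
have -> : \sum_i v 0 i * ctr G i 0 = conjc (\sum_i conjc (v 0 i) * h i).
  rewrite rmorph_sum; apply: eq_bigr => i _.
  by rewrite rmorphM /= conjcK !mxE.
by rewrite /abs2; case: (\sum_i _) => p q /=; rewrite sqrrN.
Qed.

(** The form is the second moment of the combination of the [g i] with coefficients [conjc (v i)].
    The proof expands into real and imaginary parts, since [cexpect] integrates these separately. *)
Lemma qf_Cstar v : P.-integrable setT (EFin \o comb v) /\
  qf (Cstar P g) v = Rintegral P setT (comb v).
Proof.
have iRe (p : 'I_r * 'I_r) := integrable_psi (measurable_gcoords iid) (measurable_psiRe p.1 p.2)
  (@measurable_vec_nsq R r) (psiRe_le p.1 p.2) alpha_gt0 exp_moment.
have iIm (p : 'I_r * 'I_r) := integrable_psi (measurable_gcoords iid) (measurable_psiIm p.1 p.2)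
  (@measurable_vec_nsq R r) (psiIm_le p.1 p.2) alpha_gt0 exp_moment.
have [i1 e1] := Rintegral_lincomb (index_enum _)
  (fun p : 'I_r * 'I_r => complex.Re (v 0 p.1 * conjc (v 0 p.2))) iRe.
have [i2 e2] := Rintegral_lincomb (index_enum _)
  (fun p : 'I_r * 'I_r => - complex.Im (v 0 p.1 * conjc (v 0 p.2))) iIm.
have cE : comb v = (fun w =>
   \sum_(p : 'I_r * 'I_r) complex.Re (v 0 p.1 * conjc (v 0 p.2)) * psiRe p.1 p.2 (gcoords g 0 w) +
   \sum_(p : 'I_r * 'I_r) - complex.Im (v 0 p.1 * conjc (v 0 p.2)) * psiIm p.1 p.2 (gcoords g 0 w)).
  apply/funext => w; rewrite /comb -qf_outer qf_re_im.
  by congr (_ + _); apply: eq_bigr => p _; rewrite ?psiReE ?psiImE mxE.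
split; first by rewrite cE; exact: (integrableD measurableT i1 i2).
rewrite cE RintegralD // e1 e2 qf_re_im.
by congr (_ + _); apply: eq_bigr => p _; rewrite ?Re_Cstar ?Im_Cstar.
Qed.

Lemma qf_Cstar_ge0 v : 0 <= qf (Cstar P g) v.
Proof.
have [_ ->] := qf_Cstar v; apply: Rintegral_ge0 => w _; exact: abs2_ge0.
Qed.

(** A zero second moment forces the combination to vanish almost surely, against nondegeneracy for
    the coefficients [conjc (v i)]. *)
Lemma qf_Cstar_gt0 v :
  (forall lam : 'I_r -> R[i], (exists i, lam i != 0) ->
     P [set w | \sum_i lam i * g 0%N i w = 0] = 0%E) ->
  v != 0 -> 0 < qf (Cstar P g) v.
Proof.
move=> hg v0; rewrite lt_neqAle qf_Cstar_ge0 andbT eq_sym; apply/eqP => q0.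
have [ic] := qf_Cstar v; rewrite q0 => e0.
have mc : measurable_fun setT (EFin \o comb v) by exact: measurable_int ic.
have /(ae_eq_integral_abs P measurableT mc) : (\int[P]_w `|(EFin \o comb v) w| = 0)%E.
  under eq_integral => w _ do rewrite gee0_abs ?lee_fin ?abs2_ge0 //.
  by rewrite -(fineK (integrable_fin_num measurableT ic)) -/(Rintegral P setT (comb v)) -e0.
move=> [N [mN N0 hN]].
pose Z := [set w | \sum_i conjc (v 0 i) * g 0%N i w = 0].
have mZ : measurable Z.
  rewrite (_ : Z = comb v @^-1` [set 0]).
    rewrite -[X in measurable X]setTI; move/measurable_EFinP: mc; apply => //.
  apply/seteqP; split=> w /=; rewrite /Z /comb /= => /eqP; last first.
    by rewrite abs2_eq0 => /eqP.
  by rewrite -abs2_eq0 => /eqP.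
have PZ : P Z = 0%E.
  apply: hg; have [i vi] := rV0Pn _ v0.
  by exists i; rewrite conjc_eq0.
have : (P setT <= P N + P Z)%E.
  apply: (le_trans _ (measureU2 _ mN mZ)); apply: le_measure.
  - by apply: mem_set; exact: measurableT.
  - by apply: mem_set; exact: measurableU.
  move=> w _; have [?|wN] := pselect (N w); first by left.
  right; rewrite /Z /=; apply/eqP; rewrite -abs2_eq0; apply/eqP.
  have : ~ (~ (setT w -> (EFin \o comb v) w = cst 0%E w)) by move=> /hN.
  by move/contrapT => /(_ I) [].
by rewrite N0 PZ adde0 probability_setT lee_fin ler10.
Qed.
End Covariance.

Section PerturbedMatrix.
Context {R : realType} d (Omega : measurableType d).
Local Notation C := R[i].

Definition pert_mx (M : model) n r (Gv : 'I_r -> 'cV[C]_n) : 'M[C]_(n, r) :=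
  match M with
  | IIDmodel => ((Num.sqrt n%:R)^-1)%:C *: \matrix_(k, i) Gv i k 0
  | Orthmodel =>
      \matrix_(k, i) (nth 0 (gram_schmidt [seq Gv j | j <- enum 'I_r]) i) k 0
  end.

Lemma XtildeE M r (theta : 'I_r -> R) n (x : 'I_n -> R) (Gv : 'I_r -> 'cV[C]_n) :
  Xtilde M theta x Gv = diag_mx (\row_k (x k)%:C) +
    pert_mx M Gv *m diag_mx (\row_i (theta i)%:C) *m ctr (pert_mx M Gv).
Proof.
case: M; rewrite /= sum_outer //.
congr (_ + _); rewrite ctrZ -!scalemxAl -scalemxAr scalerA conj_RC.
by rewrite -rmorphM /= -invfM -expr2 sqr_sqrtr ?ler0n.
Qed.

Lemma measurable_cvnorm n (v : Omega -> 'cV[C]_n) : mxmeasurable v ->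
  measurable_fun setT (fun w => cvnorm (v w)).
Proof.
move=> mv; apply: (@measurableT_comp _ _ _ _ _ _ (@Num.sqrt R)).
  by apply: continuous_measurable_fun => ?; exact: sqrt_continuous.
apply: measurable_sum => k; have [m1 m2] := mv k 0.
by apply: measurable_funD; apply: measurable_funX.
Qed.

(** The sum runs over a random list; fixing its size turns it into a sum over fixed indices. *)
Lemma mxmeasurable_gs_step n (s : nat) (us : Omega -> seq 'cV[C]_n) (v : Omega -> 'cV[C]_n) :
  (forall w, size (us w) = s) -> (forall j, mxmeasurable (fun w => nth 0 (us w) j)) ->
  mxmeasurable v -> mxmeasurable (fun w => gs_step (us w) (v w)).
Proof.
move=> su mus mv; pose z w := v w - \sum_(j < s) ((ctr (nth 0 (us w) j) *m v w) 0 0) *: nth 0 (us w) j.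
have mz : mxmeasurable z.
  rewrite (_ : z = fun w => v w + (-1) *: \sum_(j < s) ((ctr (nth 0 (us w) j) *m v w) 0 0) *: nth 0 (us w) j); last first.
    by apply/funext => w; rewrite scaleN1r.
  apply: mxmeasurableD => //; apply: mxmeasurableZ; first exact: cmeasurable_cst.
  apply: mxmeasurable_sum => j; apply: mxmeasurableZ => //.
  by apply: mxmeasurableM => //; exact: mxmeasurable_ctr.
rewrite (_ : (fun w => _) = fun w => ((cvnorm (z w))^-1)%:C *: z w).
  apply: mxmeasurableZ => //; apply: cmeasurable_real.
  apply: (@measurableT_comp _ _ _ _ _ _ (@GRing.inv R)); first exact: measurable_inv.
  exact: measurable_cvnorm.
apply/funext => w; rewrite /gs_step /z; set y := v w - _.
by set y' := v w - _; rewrite (_ : y = y') // /y (big_nth 0) big_mkord su.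
Qed.

Lemma mxmeasurable_gram_schmidt n (I : Type) (s : seq I) (Gv : Omega -> I -> 'cV[C]_n) j :
  (forall i, mxmeasurable (fun w => Gv w i)) ->
  mxmeasurable (fun w => nth 0 (gram_schmidt [seq Gv w i | i <- s]) j).
Proof.
move=> mG; elim/last_ind: s j => [|s i IH] j.
  by rewrite (_ : (fun w => _) = fun=> 0); [exact: mxmeasurable_cst|apply/funext => w; rewrite nth_nil].
under eq_fun => w do rewrite map_rcons gram_schmidt_rcons nth_rcons size_gram_schmidt size_map.
case: ltngtP => _; first exact: IH.
  exact: mxmeasurable_cst.
by apply: (@mxmeasurable_gs_step _ (size s)) => // w; rewrite size_gram_schmidt size_map.
Qed.

Lemma mxmeasurable_Xtilde M r (theta : 'I_r -> R) n (x : 'I_n -> R)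
    (Gv : Omega -> 'I_r -> 'cV[C]_n) :
  (forall i, mxmeasurable (fun w => Gv w i)) ->
  mxmeasurable (fun w => Xtilde M theta x (Gv w)).
Proof.
move=> mG; under eq_fun => w do rewrite XtildeE.
have mW : mxmeasurable (fun w => pert_mx M (Gv w)).
  case: M => /=; [move=> k i|move=> k i].
    under eq_fun => w do rewrite !mxE.
    by apply: cmeasurableM; [exact: cmeasurable_cst|exact: mG].
  under eq_fun => w do rewrite !mxE.
  exact: mxmeasurable_gram_schmidt.
apply: mxmeasurableD; first exact: mxmeasurable_cst.
apply: mxmeasurableM; last exact: mxmeasurable_ctr.
by apply: mxmeasurableM => //; exact: mxmeasurable_cst.
Qed.

Lemma herm_Xtilde M r (theta : 'I_r -> R) n (x : 'I_n -> R) (Gv : 'I_r -> 'cV[C]_n) :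
  herm (Xtilde M theta x Gv).
Proof. by rewrite XtildeE; exact: herm_diagD. Qed.

End PerturbedMatrix.

Section OrthonormalPerturbation.
Variable R : realType.
Local Notation C := R[i].

(* Orthonormalizing the columns of [G] turns its Gram matrix, which is close to
   [S], into the identity. *)
Lemma orth_pert_close n r (x : 'I_n -> C) (s : R) (Gv : 'I_r -> 'cV[C]_n)
    (S : 'M[C]_r) (h c e : R) :
  let G : 'M[C]_(n, r) := s%:C *: \matrix_(k, i) Gv i k 0 in
  let U := pert_mx Orthmodel Gv in
  0 < s -> 0 < h -> 0 < c -> 0 < e -> (forall u, c * nsq u <= qf S u) ->
  (forall u, `|qf (ctr G *m diag_mx (\row_k x k) *m G - h%:C *: S) u| <= e * c / 4 * nsq u) ->
  (forall u, `|qf (ctr G *m G - S) u| <= Num.min (c / 2) (e * c / (4 * h)) * nsq u) ->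
  forall u, `|qf (ctr U *m diag_mx (\row_k x k) *m U
               - h%:C *: (ctr (1%:M : 'M[C]_r) *m 1%:M)) u| <= e * nsq u.
Proof.
move=> G U s0 h0 c0 e0 hS hD hN.
have c20 : 0 < c / 2 by rewrite divr_gt0.
have GG u : c / 2 * nsq u <= qf (ctr G *m G) u.
  have := hN u; rewrite qfB ler_norml => /andP[h1 _].
  have h2 : Num.min (c / 2) (e * c / (4 * h)) * nsq u <= c / 2 * nsq u.
    by rewrite ler_wpM2r ?nsq_ge0 // ge_min lexx.
  have := hS u; move: h1 h2; set y := Num.min _ _ * _; lra.
have [|UU [T UT]] := @gram_schmidt_mx R n r Gv.
  move=> u Gu0; have Gu : G *m u = 0 by rewrite -scalemxAl Gu0 scaler0.
  have := GG (ctr u); rewrite -{2}(ctrK G) -nsq_mul -ctrM Gu.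
  rewrite (_ : nsq (ctr 0) = 0); last by apply/eqP; rewrite nsq_eq0 /ctr map_mx0 trmx0.
  rewrite pmulr_rle0 // => h1; have : nsq (ctr u) == 0 by rewrite eq_le h1 nsq_ge0.
  by rewrite nsq_eq0 => /eqP/(congr1 (@ctr R _ _)); rewrite ctrK => ->; rewrite /ctr map_mx0 trmx0.
(* Gram-Schmidt is applied to the unscaled columns; the factor [s] is absorbed in the change of
   basis. *)
have UG : U = G *m ((s^-1)%:C *: T).
  rewrite -scalemxAl -scalemxAr scalerA -rmorphM /= divff ?gt_eqF // scale1r.
  exact: UT.
(* The two errors add up to [e * c / 4 + h * (e * c / (4 * h)) = e * c / 2], and orthonormalization
   divides by the Gram lower bound [c / 2]. *)
have ee : e = e * c / 2 / (c / 2) by field; rewrite gt_eqF.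
have {UU}UU : ctr U *m U = 1%:M by exact: UU.
clearbody U; rewrite UG in UU * => u; rewrite [X in _ <= X * _]ee.
apply: (@orthonormal_close R n r x G _ h (e * c / 2) (c / 2) UU c20 GG) => [|v]; first by rewrite divr_ge0 // mulr_ge0 ?ltW.
have -> : ctr G *m diag_mx (\row_k x k) *m G - h%:C *: (ctr G *m G) =
   (ctr G *m diag_mx (\row_k x k) *m G - h%:C *: S) - h%:C *: (ctr G *m G - S).
  by rewrite scalerBr opprB addrA subrK.
rewrite qfB qfZ; apply: (le_trans (ler_normB _ _)); rewrite normrM (gtr0_norm h0).
have h1 := hD v; have := hN v.
have h2 : Num.min (c / 2) (e * c / (4 * h)) * nsq v <= e * c / (4 * h) * nsq v.
  by rewrite ler_wpM2r ?nsq_ge0 // ge_min lexx orbT.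
move=> /le_trans /(_ h2); rewrite -(ler_pM2l h0) => h3.
apply: (le_trans (lerD h1 h3)).
rewrite le_eqVlt; apply/orP; left; apply/eqP; field; rewrite gt_eqF //.
Qed.

End OrthonormalPerturbation.

Section Outliers.
Context {R : realType} d (Omega : measurableType d).
Variables (P : probability Omega R) (M : model) (r : nat) (theta : 'I_r -> R).
Variables (g : nat -> 'I_r -> Omega -> R[i]) (x : forall n : nat, 'I_n -> R).
Variables (mu : probability R R) (a b alpha : R).
Hypothesis theta_neq0 : forall i, theta i != 0.
Hypothesis iid : iid_vecs P g.
Hypothesis weak_cvg : forall f : R -> R, continuous f -> (exists K : R, forall y, `|f y| <= K) ->
     (fun n : nat => (n%:R)^-1 * \sum_(k < n) f (x k)) @ \oo --> Rintegral mu setT f.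
Hypothesis supp_b : msupport mu b.
Hypothesis supp_sub : msupport mu `<=` `[a, b].
Hypothesis alpha_gt0 : 0 < alpha.
Hypothesis exp_moment : (\int[P]_w (expR (alpha * \sum_i ((complex.Re (g 0%N i w)) ^+ 2
                                        + (complex.Im (g 0%N i w)) ^+ 2)))%:E < +oo)%E.
Hypothesis nondeg : M = Orthmodel -> forall v, v != 0 -> 0 < qf (Cstar P g) v.
Hypothesis top_cvg : (fun n : nat => eig (diag_mx (\row_k (x k)%:C) : 'M[R[i]]_n) 0) @ \oo --> b.
Variable W0 : 'M[R[i]]_r.
Hypothesis W0E : if M is IIDmodel then Cstar P g = ctr W0 *m W0 else W0 = 1%:M.

Let Gv n w i : 'cV[R[i]]_n := \col_(k < n) g k i w.
Let A0 := W0 *m diag_mx (\row_i (theta i)%:C) *m ctr W0.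
Let X n w := Xtilde M theta (@x n) (@Gv n w).

Lemma sample_mx_col n w :
  sample_mx g n w = ((Num.sqrt n%:R)^-1)%:C *: \matrix_(k, i) @Gv n w i k 0.
Proof. by congr (_ *: _); apply/matrixP => k i; rewrite !mxE. Qed.

(** All indices [j < r] fail together on one bad event, that of a deviating quadratic form; outside
    it the comparison is deterministic. *)
Lemma exp_small_outlier (z : R) : b < z ->
  (forall y, y \in eigs A0 -> hpow mu a b 0 z * y != 1) ->
  exp_small P (fun n => [set w | exists2 j, (j < r)%N &
    (z < eig (X n w) j) <> ((hpow mu a b 0 z)^-1 < eig A0 j)]).
Proof.
move=> bz hy; set h := hpow mu a b 0 z in hy *.
have h0 : 0 < h by exact: stieltjes_gt0.
have [e e0 he] := @outlier_comparison R r theta W0 h theta_neq0 h0 hy.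
pose c := (b + z) / 2; have bc : b < c by rewrite /c; lra.
have cz : c < z by rewrite /c; lra.
have [N hN] := bulk_upper top_cvg bc.
have zc0 : 0 < (z - c)^-1 by rewrite invr_gt0 subr_gt0.
pose ak n (k : 'I_n) := (z - x k)^-1.
have hak n : (N <= n)%N -> forall k : 'I_n, `|ak n k| <= (z - c)^-1.
  move=> Nn k; have xc := hN n Nn k.
  have zx : 0 < z - x k by lra.
  rewrite /ak gtr0_norm ?invr_gt0 // lef_pV2 ?posrE //; lra.
have mean := bulk_mean weak_cvg supp_sub top_cvg bz.
have main n w : (maxn N r <= n)%N ->
   (forall u, `|qf (ctr (pert_mx M (@Gv n w)) *m diag_mx (\row_k ((z - x k)^-1)%:C)
        *m pert_mx M (@Gv n w) - h%:C *: (ctr W0 *m W0)) u| <= e * nsq u) ->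
   ~ exists2 j, (j < r)%N & (z < eig (X n w) j) <> (h^-1 < eig A0 j).
  rewrite geq_max => /andP[Nn rn] close [j jr]; apply.
  rewrite /X XtildeE; apply: he => //; last exact: leq_trans rn.
  by move=> k; apply: lt_trans cz; exact: hN.
have [ME|ME] : M = IIDmodel \/ M = Orthmodel by case: (M); [left|right].
  have small := exp_small_quadratic iid alpha_gt0 exp_moment zc0 e0 hak mean.
  apply: (exp_small_eventually (n0 := maxn N r) _ small) => n Nn w /=.
  move=> bad good; apply: (main n w Nn) bad.
  move: W0E good; rewrite ME => ->; by rewrite sample_mx_col.
have [c1 c10 hC] := pd_lower_bound (herm_Cstar iid alpha_gt0 exp_moment) (nondeg ME).
have d10 : 0 < e * c1 / 4 by rewrite divr_gt0 ?mulr_gt0.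
have d20 : 0 < Num.min (c1 / 2) (e * c1 / (4 * h)).
  by rewrite lt_min !divr_gt0 ?mulr_gt0.
have small1 := exp_small_quadratic iid alpha_gt0 exp_moment zc0 d10 hak mean.
(* In the orthonormalized model the Gram matrix must concentrate as well; it is the sample form with
   all weights equal to 1. *)
have mean1 : (fun n : nat => (n%:R)^-1 * \sum_(k < n) 1) @ \oo --> (1 : R).
  have W : (fun n : nat => 1 : R) @ \oo --> (1 : R) by exact: cvg_cst.
  apply: cvg_trans W; apply: near_eq_cvg.
  exists 1%N => // n /= n1; rewrite sumr_const card_ord mulVf // pnatr_eq0.
  by rewrite -lt0n.
have bd1 (n : nat) : (0 <= n)%N -> forall k : 'I_n, `|1 : R| <= 1 by rewrite normr1.
have small2 := exp_small_quadratic iid alpha_gt0 exp_moment ltr01 d20 bd1 mean1.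
have := exp_smallU small1 small2.
apply: (exp_small_eventually (n0 := (maxn N r).+1)) => n Nn w /= bad.
apply: contrapT => /not_orP[/contrapT g1 /contrapT g2].
apply: (main n w (ltnW Nn)) bad.
have n0 : (0 < n)%N by exact: leq_ltn_trans Nn.
have WE : W0 = 1%:M by move: W0E; rewrite ME.
rewrite ME WE.
have s0 : 0 < (Num.sqrt n%:R)^-1 :> R by rewrite invr_gt0 sqrtr_gt0 ltr0n.
have K := @orth_pert_close R n r (fun k : 'I_n => ((z - x k)^-1)%:C)
  (Num.sqrt n%:R)^-1 (@Gv n w) (Cstar P g) h c1 e s0 h0 c10 e0 hC.
rewrite -sample_mx_col in K; apply: K; first exact: g1.
move=> u; have := g2 u; rewrite scale1r.
rewrite (_ : diag_mx (\row_k 1%:C) = 1%:M) ?mulmx1; first exact.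
by rewrite -diag_const_mx; congr diag_mx; apply/rowP => k; rewrite !mxE.
Qed.

(** Deterministic: [r] directions may be lost to the perturbation and at most [r] more are needed
    for index [j], hence [r + r]. *)
Lemma bulk_lower (e : R) : 0 < e -> exists N, forall n w j, (N <= n)%N -> (j < r)%N ->
  b - e < eig (X n w) j.
Proof.
move=> e0; have [N hN] := bulk_count weak_cvg supp_b (r + r) e0.
exists N => n w j Nn jr; rewrite /X XtildeE; apply: eig_perturbed_ge.
by apply: leq_trans (hN n Nn); rewrite leq_add2r.
Qed.

Lemma measurable_eig_X n j : measurable_fun setT (fun w => eig (X n w) j).
Proof.
apply: measurable_eig => [|w]; last exact: herm_Xtilde.
apply: mxmeasurable_Xtilde => i k l.
have [miid _] := iid; have [m1 m2] := miid k i.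
by split; under eq_fun => w do rewrite mxE.
Qed.

End Outliers.

(** * From eigenvalues of the limit matrix to limit positions *)

Section OutlierPositions.
Variables (R : realType) (b : R) (h sigma : R -> R) (E : seq R) (m : nat).
Hypothesis h_gt0 : forall z, b < z -> 0 < h z.
Hypothesis sigma_ge : forall y, b <= sigma y.
Hypothesis sigma_gt : forall y z, b < z -> (z < sigma y) = (1 < h z * y).
Hypothesis sigma_eq : forall y z, b < z -> (sigma y == z) = (h z * y == 1).
Hypothesis sorted_E : sorted >=%R E.
Hypothesis size_E : (m <= size E)%N.
Hypothesis E_le0 : forall j, (m <= j < size E)%N -> nth 0 E j <= 0.

(** A level strictly between two misordered values would separate them the wrong way. *)
Lemma sigma_homo : {homo sigma : x y / x <= y}.
Proof.
move=> x y xy; rewrite leNgt; apply/negP => lt.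
pose z := (sigma x + sigma y) / 2.
have by_ := sigma_ge y; have bz : b < z by rewrite /z; lra.
have : z < sigma x by rewrite /z; lra.
rewrite sigma_gt // => h1.
have : z < sigma y.
  by rewrite sigma_gt // (lt_le_trans h1) // ler_wpM2l // ltW // h_gt0.
by rewrite /z; lra.
Qed.

Definition outlier_seq := [seq y <- [seq sigma y | y <- take m E] | b < y].

Lemma size_outlier_seq : (size outlier_seq <= m)%N.
Proof. by rewrite size_filter (leq_trans (count_size _ _)) // size_map size_take geq_minl. Qed.

Lemma sorted_positions : sorted >=%R [seq sigma y | y <- take m E].
Proof.
have tr : transitive (>=%R : rel R) by move=> y u z h1 h2; exact: le_trans h2 h1.
rewrite (homo_sorted (e := >=%R)) ?take_sorted //.
by move=> x y; exact: sigma_homo.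
Qed.

Lemma sorted_outlier_seq : sorted >=%R outlier_seq.
Proof.
apply: sorted_filter sorted_positions.
by move=> y u z h1 h2; exact: le_trans h2 h1.
Qed.

Lemma mem_outlier_seq z : z \in outlier_seq -> b < z.
Proof. by rewrite mem_filter => /andP[]. Qed.

Lemma nth_outlier_seq j : (j < m)%N -> nth b outlier_seq j = sigma (nth 0 E j).
Proof.
move=> jm; rewrite nth_filter_gt ?sorted_positions //; last by move=> _ /mapP[y _ ->].
by rewrite (nth_map 0) ?size_takel // nth_take.
Qed.

(** Truncating at [m] loses no solution of [h z * y = 1], since the remaining eigenvalues are
    nonpositive and [h z > 0]. *)
Lemma count_outlier_seq z : b < z ->
  count_mem z outlier_seq = count (fun y => h z * y == 1) E.
Proof.
move=> bz; rewrite count_filter count_map -[in RHS](cat_take_drop m E) count_cat.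
rewrite [X in _ = (_ + X)%N](_ : _ = 0%N) ?addn0.
  apply: eq_count => y /=; rewrite sigma_eq // andb_idr //.
  by rewrite -sigma_eq // => /eqP ->.
apply/eqP; rewrite -leqn0 leqNgt -has_count; apply/hasPn => y /(nthP 0)[j].
rewrite size_drop nth_drop => js <-; apply/negP => /eqP e1.
have : nth 0 E (m + j) <= 0 by apply: E_le0; rewrite leq_addr -ltn_subRL.
by rewrite -(pmulr_rle0 _ (h_gt0 bz)) e1 ler10.
Qed.

End OutlierPositions.

(** * Zeros of the limiting polynomial and convergence of the extreme eigenvalues *)

Theorem theorem6p2 (R : realType) (d : measure_display) (Omega : measurableType d)
  (P : probability Omega R)
  (M : model) (r m : nat) (theta : 'I_r -> R)
  (g : nat -> 'I_r -> Omega -> R[i])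
  (x : forall n : nat, 'I_n -> R)
  (mu : probability R R) (a b : R) :
  (* 1 <= m <= r, theta_1 >= ... >= theta_m > 0 > theta_(m+1) >= ... >= theta_r *)
  (1 <= m <= r)%N ->
  (forall i j : 'I_r, (i <= j)%N -> theta j <= theta i) ->
  (forall i : 'I_r, (i < m)%N -> 0 < theta i) ->
  (forall i : 'I_r, (m <= i)%N -> theta i < 0) ->
  (* (G(k))_k i.i.d. copies of the random vector G *)
  iid_vecs P g ->
  (* (A) weak convergence of the empirical spectral measure of X_n to mu *)
  (forall f : R -> R, continuous f -> (exists K : R, forall y, `|f y| <= K) ->
     (fun n : nat => (n%:R)^-1 * \sum_(k < n) f (x n k)) @ \oo
       --> Rintegral mu setT f) ->
  (* mu compactly supported, a and b the bounds of its support *)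
  msupport mu a -> msupport mu b -> msupport mu `<=` `[a, b] ->
  (* (B) *)
  (exists alpha : R, 0 < alpha /\
     (\int[P]_w (expR (alpha * \sum_i ((complex.Re (g 0%N i w)) ^+ 2
                                        + (complex.Im (g 0%N i w)) ^+ 2)))%:E
        < +oo)%E) ->
  (M = Orthmodel -> forall lam : 'I_r -> R[i], (exists i, lam i != 0) ->
     P [set w | \sum_i lam i * g 0%N i w = 0] = 0%E) ->
  (* (C) extreme eigenvalues of X_n converge to b and a *)
  (fun n : nat => eig (diag_mx (\row_k (x n k)%:C)) 0) @ \oo --> b ->
  (fun n : nat => eig (diag_mx (\row_k (x n k)%:C)) n.-1) @ \oo --> a ->
  let Gv (n : nat) (w : Omega) (i : 'I_r) : 'cV[R[i]]_n := \col_(k < n) g k i w in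
  let Y (n : nat) (w : Omega) : 'rV[R]_m :=
    \row_(j < m) eig (Xtilde M theta (x n) (Gv n w)) j in
  let Cstar : 'M[R[i]]_r :=
    \matrix_(i, j) cexpect P (fun w => (g 0%N i w)^* * g 0%N j w) in
  let stieltjes (z : R) : R := Rintegral mu setT (fun l => (z - l)^-1) in
  let H (z : R) : R :=
    complex.Re (Ppoly M theta ((stieltjes z)%:C *: Cstar) Cstar) in
  exists k : nat, (k <= m)%N /\
  exists s : seq R,
    size s = (m - k)%N /\ sorted >=%R s /\ (forall z, z \in s -> b < z) /\
    (* s lists the zeros of H in (b, +oo) with multiplicity *)
    (forall z, b < z -> zero_mult H z (count_mem z s)) /\
    let pt : 'rV[R]_m := \row_(j < m) nth b s j in
    (forall L : 'rV[R]_m -> \bar R,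
       good_rate_function L -> LDP P Y L ->
       forall y, L y = 0%E <-> y = pt) /\
    {ae P, forall w, (fun n => Y n w) @ \oo --> pt}.
Proof.
move=> /andP[m1 mr] _ thp thn iid weak _ supp_b supp_sub [alpha [alpha0 expm]] nondeg top_cvg _.
move=> Gv Y Cst stieltjes H.
have th0 i : theta i != 0.
  by case: (ltnP i m) => [/thp/gt_eqF->|/thn/lt_eqF->].
have CstE : Cst = Cstar P g by [].
have hC := herm_Cstar iid alpha0 expm.
have nondeg' : M = Orthmodel -> forall v, v != 0 -> 0 < qf (Cstar P g) v.
  by move=> /nondeg hg v; apply: (qf_Cstar_gt0 iid alpha0 expm).
have [W0 [c [c0 HE W0E]]] := Ppoly_factor th0 hC (qf_Cstar_ge0 iid alpha0 expm) nondeg'.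
have outl := exp_small_outlier th0 iid weak supp_b supp_sub alpha0 expm nondeg' top_cvg W0E.
set A0 := W0 *m _ *m ctr W0 in HE outl.
have hA0 : herm A0 by exact: herm_congr.
pose h := hpow mu a b 0.
have h0 z : b < z -> 0 < h z by exact: (stieltjes_gt0 supp_sub supp_b).
have [sigma hsigma] := outlier_exists supp_sub supp_b.
have sge y : b <= sigma y by have [] := hsigma y.
have sgt y z : b < z -> (z < sigma y) = (1 < h z * y).
  by move=> bz; have [_ /(_ z bz)[]] := hsigma y.
have seq_ y z : b < z -> (sigma y == z) = (h z * y == 1).
  by move=> bz; have [_ /(_ z bz)[]] := hsigma y.
pose E := eigs A0.
have sE : sorted >=%R E by exact: sorted_eigs.
have szE : size E = r by exact: size_eigs.
have mE : (m <= size E)%N by rewrite szE.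
have E0 j : (m <= j < size E)%N -> nth 0 E j <= 0.
  by rewrite szE; exact: eig_congr_le0.
pose s := outlier_seq b sigma E m.
have sm : (size s <= m)%N by exact: size_outlier_seq.
(* [k] counts those of the [m] largest eigenvalues of [A0] that create no outlier. *)
exists (m - size s)%N; split; first exact: leq_subr.
exists s; split; first by rewrite subKn.
split; first exact: (sorted_outlier_seq m h0 sge sgt sE).
split; first by move=> z; exact: mem_outlier_seq.
split.
  move=> z bz; rewrite /s (count_outlier_seq h0 seq_ E0 bz).
  apply: (zero_mult_prod (h := hpow mu a b) _ bz c0).
  - by move=> k y bys; exact: is_derive_hpow.
  - by rewrite gt_eqF // (hpow_gt0 supp_sub supp_b).
  by move=> y bys; rewrite /H /stieltjes (stieltjesE supp_sub) // CstE HE.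
move=> pt.
have ptE (j : 'I_m) : pt 0 j = sigma (nth 0 E j).
  by rewrite mxE (nth_outlier_seq h0 sge sgt sE mE).
have YE n w (j : 'I_m) : Y n w 0 j = eig (Xtilde M theta (x n) (Gv n w)) j by rewrite mxE.
have mY n j : measurable_fun setT (fun w => Y n w 0 j).
  under eq_fun => w do rewrite YE.
  exact: (measurable_eig_X M theta x iid n j).
have conc (j : 'I_m) e : 0 < e -> exp_small P (fun n => [set w | e <= `|Y n w 0 j - pt 0 j|]).
  move=> e0; pose p := sigma (nth 0 E j); have bp : b <= p by exact: sge.
  have jr : (j < r)%N by exact: leq_trans (ltn_ord j) mr.
  (* The threshold [h(z)^-1 < y] on eigenvalues of [A0] is rewritten as [z < sigma y]; levels equal
     to some [sigma y] are the singular ones. *)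
  have outl' z : b < z -> z \notin [seq sigma y | y <- E] ->
      exp_small P (fun n => [set w | (z < Y n w 0 j) <> (z < p)]).
    move=> bz zN; apply: exp_smallS (outl z bz _) => [n w /= hw|y yE].
      exists (val j) => //; move: hw; rewrite YE /p sgt // -/h.
      by rewrite -[X in 1 < X]mulrC -ltr_pdivrMr ?h0 // div1r.
    rewrite -/h -seq_ //; apply: contra zN => /eqP <-.
    exact: map_f.
  have pe : p < p + e by lra.
  have [z1 /andP[pz1 z1e] z1N] := avoid_finite [seq sigma y | y <- E] pe.
  have up := outl' z1 (le_lt_trans bp pz1) z1N.
  (* If [p > b], a second regular level just below [p] bounds the eigenvalue from below. If [p = b],
     [bulk_lower] does so for all large [n]. *)
  have [bp'|pb] := ltP b p.
    have mp : Num.max b (p - e) < p by rewrite gt_max bp'; lra.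
    have [z2] := avoid_finite [seq sigma y | y <- E] mp.
    rewrite gt_max => /andP[/andP[bz2 ez2] z2p] z2N.
    apply: exp_smallS (exp_smallU up (outl' z2 bz2 z2N)) => n w /=.
    rewrite ptE -/p z2p (ltNge z1 p) (ltW pz1) /= => he.
    apply: contrapT => /not_orP[/contrapT/negbT h1 /contrapT h2].
    by move: he; rewrite leNgt ltr_distl => /negP; apply; apply/andP; split; lra.
  have [N hN] := bulk_lower M theta g weak supp_b e0.
  apply: (exp_small_eventually (n0 := N) _ up) => n Nn w /=.
  rewrite ptE -/p (ltNge z1 p) (ltW pz1) /= => he h1.
  have h2 := hN n w j Nn jr; rewrite -YE in h2.
  by move: he; rewrite leNgt ltr_distl => /negP; apply; apply/andP; split; lra.
split; last exact: as_cvg.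
by move=> L gL LL y; exact: (rate_zero mY conc gL LL).
Qed.
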